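(* If $h\in\mathcal{O}_{\mathbb{C}^m}$ defines a free divisor on $\mathbb{C}^m$ and $g_1,\ldots,g_n$ generate the $\mathcal{O}_{\mathbb{C}^m}$-ideal $I=(J_h,h)$, then $h\cdot\left(\sum_{i=1}^n g_iy_i\right)$ defines a free divisor on $\mathbb{C}^m\times\mathbb{C}^n$. In particular, $$h\cdot\left(hy_{m+1}+\sum_{i=1}^m\frac{\partial h}{\partial x_i}y_i\right)$$ always defines a free divisor on $\mathbb{C}^m\times\mathbb{C}^{m+1}$, and if $h\in J_h$ then $$h\cdot\left(\sum_{i=1}^m\frac{\partial h}{\partial x_i}y_i\right)$$ defines a free divisor on $\mathbb{C}^m\times\mathbb{C}^m$.
   Context: All spaces are regarded as complex analytic germs at the origin; $\mathcal{O}_{Y}$ is the ring of germs at $0$ of holomorphic functions on the smooth germ $Y$. Coordinates on $\mathbb{C}^m$ are $(x_1,\ldots,x_m)$, and $y_1,y_2,\ldots$ denote the coordinates on the second factor. $J_h=\left(\frac{\partial h}{\partial x_1},\ldots,\frac{\partial h}{\partial x_m}\right)$ is the Jacobian ideal of $h$. A nonzero $h\in\mathcal{O}_Y$ defines a free divisor if $h$ is reduced (squarefree) and $\mathrm{Der}_Y(-\log h)=\{D\in\mathrm{Der}_{\mathbb{C}}(\mathcal{O}_Y): D(h)\in (h)\}$ is a free $\mathcal{O}_Y$-module. *)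

(* Defs.v *)
From HB Require Import structures.
From mathcomp Require Import all_boot all_order all_algebra ring_quotient.
From mathcomp Require Import complex ring lra zify.
From mathcomp Require Import all_classical all_reals interval_inference.
From mathcomp Require Import topology normedtype derive sequences.
From mathcomp Require mpoly.
(* Multi-indices are multinomials' [multinom m]; its notations clash with
   those of MathComp-Analysis, hence the filtered import. *)
Import -(notations) mpoly.
Import numFieldNormedType.Exports.
Import Order.TTheory GRing.Theory Num.Theory.

Set Implicit Arguments.
Unset Strict Implicit.
Unset Printing Implicit Defensive.

Local Open Scope classical_set_scope.
Local Open Scope ring_scope.
Local Open Scope complex_scope.
Local Open Scope quotient_scope.

(* R[i] is given the topology and norm that the library attaches to R[i]^o. *)
HB.instance Definition _ (R : realType) := NormedModule.copy R[i] R[i]^o.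

Section Complex.
Variable R : realType.
Local Notation C := R[i].

Lemma bounded_mono_cauchy (T : nat -> C) M : (forall n, 0 <= T n <= M) -> {homo T : m n / (m <= n)%N >-> m <= n} ->
  forall e : C, 0 < e -> exists N, forall n, (N <= n)%N -> T n - T N < e.
Proof.
move=> T0 Tmono e e0.
have Tr n : T n = (complex.Re (T n))%:C.
  by rewrite RRe_real // ger0_real //; case/andP: (T0 n).
have eE : e = (complex.Re e)%:C by rewrite RRe_real // gtr0_real.
have e0' : 0 < complex.Re e by rewrite -(ltcR 0) -eE.
pose t n := complex.Re (T n).
have tm : nondecreasing_seq t.
  by move=> m n /Tmono; rewrite Tr (Tr n) lecR.
have tb : has_ubound (range t).
  exists (complex.Re M) => _ [n _ <-].
  by have /andP[_] := T0 n; rewrite lecE => /andP[].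
have tc := nondecreasing_is_cvgn tm tb.
have [N _ HN] : \forall n \near \oo, `|lim (t n @[n --> \oo]) - t n| < complex.Re e.
  by move/cvgrPdist_lt: tc; apply.
exists N => n Nn; rewrite (Tr n) (Tr N) eE -rmorphB /= ltcR.
have := HN N (leqnn _); apply: le_lt_trans.
rewrite ger0_norm ?subr_ge0; last exact: nondecreasing_cvgn_le.
by rewrite lerB //; exact: nondecreasing_cvgn_le.
Qed.

Lemma complex_le_norm (z : C) : `|z| <= `|complex.Re z|%:C + `|complex.Im z|%:C.
Proof.
rewrite {1}[z]complexE (le_trans (ler_normD _ _)) // normrM.
rewrite [`|'i%C|](_ : _ = 1); last first.
  by rewrite normc_def /= expr0n add0r expr1n sqrtr1.
by rewrite mul1r !normc_def /= expr0n /= !addr0 !sqrtr_sqr.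
Qed.

Lemma complex_ge_Im (z : C) : `|complex.Im z|%:C <= `|z|.
Proof.
have := normc_ge_Re (z * 'i); rewrite ReiNIm normrN normrM.
rewrite [`|'i%C|](_ : _ = 1) ?mulr1 //.
by rewrite normc_def /= expr0n add0r expr1n sqrtr1.
Qed.

Lemma complex_cvg (u T : nat -> C) M : (forall n, 0 <= T n <= M) ->
  (forall m n, (m <= n)%N -> `|u n - u m| <= T n - T m) ->
  exists l : C, u @ \oo --> l.
Proof.
move=> T0 uT.
have Tm : {homo T : m n / (m <= n)%N >-> m <= n}.
  by move=> m n mn; rewrite -subr_ge0; apply: le_trans (uT _ _ mn).
have key (f : C -> R) : {morph f : x y / x - y} -> (forall z, `|f z|%:C <= `|z|) ->
    cvgn (f \o u).
  move=> fB fle; apply: cauchy_cvg; apply/cauchy_exP => e e0.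
  have [|N HN] := @bounded_mono_cauchy T M T0 Tm e%:C; first by rewrite ltcR.
  exists (f (u N)); exists N => // n Nn /=.
  rewrite /ball /= distrC -fB -ltcR (le_lt_trans (fle _)) //.
  by apply: le_lt_trans (HN n Nn); exact: uT.
have /cvg_ex[a ua] := key (@complex.Re R) (fun x y => raddfB (@complex.Re R : {additive Rcomplex R -> R}) x y) (@normc_ge_Re R).
have /cvg_ex[b ub] := key (@complex.Im R) (fun x y => raddfB (@complex.Im R : {additive Rcomplex R -> R}) x y) complex_ge_Im.
exists (a +i* b); apply/cvgrPdist_lt => e e0.
have eE : e = (complex.Re e)%:C by rewrite RRe_real // gtr0_real.
have e0' : 0 < complex.Re e / 2 by rewrite divr_gt0 // -(ltcR 0) -eE.
move/cvgrPdist_lt : ua => /(_ _ e0') ua.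
move/cvgrPdist_lt : ub => /(_ _ e0') ub.
near=> n.
rewrite (le_lt_trans (complex_le_norm _)) // -rmorphD /= eE ltcR.
rewrite [ltRHS]splitr ltrD //.
- suff -> : complex.Re (a +i* b - u n) = a - (@complex.Re R \o u) n by near: n.
  by rewrite /=; case: (u n).
- suff -> : complex.Im (a +i* b - u n) = b - (@complex.Im R \o u) n by near: n.
  by rewrite /=; case: (u n).
Unshelve. all: by end_near. Qed.

End Complex.

Lemma coord_le_norm (K : numDomainType) n (x : 'rV[K]_n) i : `|x 0 i| <= `|x|.
Proof.
have H := le_bigmax (0%:nng : {nonneg K})
  (fun ij : 'I_1 * 'I_n => `|x ij.1 ij.2|%:nng) (0, i).
have : (`|x 0 i|%:nng)%:num <= (\big[Order.max/0%:nng]_i `|x i.1 i.2|%:nng)%:num by rewrite num_le.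
by [].
Qed.

Lemma norm_le_coord (K : numDomainType) n (x : 'rV[K]_n) (e : K) : 0 <= e ->
  (forall i, `|x 0 i| <= e) -> `|x| <= e.
Proof.
move=> /nonnegP[{}e] xe; rewrite [leLHS]/Num.norm /= mx_normE num_le.
apply/bigmax_leP; split => [|[i j] _]; first by rewrite -num_le /=.
by rewrite -num_le /= ord1.
Qed.
Section PowerSeries.
Variables (R : realType) (m : nat).
Local Notation C := R[i].
Implicit Types (c d : multinom m -> C) (f g : 'rV[C]_m -> C) (x : 'rV[C]_m).

Definition mono (x : 'rV[C]_m) (a : multinom m) : C := \prod_(i < m) x 0 i ^+ a i.

Definition psum c (N : nat) x : C := \sum_(a : bmultinom m N) c a * mono x a.

Definition asum c (N : nat) (r : C) : C :=
  \sum_(a : bmultinom m N) `|c a| * r ^+ mdeg a.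

(* f is the sum of the power series with coefficients c, which converges
   absolutely, on the polydisc |x| < r. The norm of row vectors is the sup norm,
   and for the order of R[i] the condition 0 < r says that r is real positive. *)
Definition has_expansion f c (r : C) : Prop :=
  [/\ 0 < r, (exists M, forall N, asum c N r <= M) &
      forall x, `|x| < r -> psum c N x @[N --> \oo] --> f x].

Definition analytic0 f : Prop := exists c r, has_expansion f c r.

Lemma monoD x a b : mono x (mnm_add a b) = mono x a * mono x b.
Proof. by rewrite -big_split; apply: eq_bigr => i _ /=; rewrite mnmDE exprD. Qed.

Lemma mono_norm x r a : `|x| <= r -> `|mono x a| <= r ^+ mdeg a.
Proof.
move=> xr; rewrite /mono normr_prod mdegE -prodrXr.
apply: ler_prod => i _; rewrite normr_ge0 normrX lerXn2r ?nnegrE //.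
  by rewrite (le_trans _ xr).
by rewrite (le_trans _ xr) // coord_le_norm.
Qed.

Lemma bsum_widen (V : nmodType) (F : multinom m -> V) K N : (K <= N)%N ->
  \sum_(a : bmultinom m K) F a = \sum_(a : bmultinom m N | (mdeg a < K)%N) F a.
Proof.
move=> KN.
pose h (a : bmultinom m K) : bmultinom m N :=
  BMultinom (leq_trans (bmdeg a) KN).
rewrite (reindex_omap h (fun a => insub (bmnm a))) /=; last first.
  move=> a aK; rewrite insubT //=; congr Some.
  by apply/val_inj.
apply/eq_big => [a|//].
rewrite bmdeg /=; case: insubP => [b _ bE|]; last by rewrite bmdeg.
by apply/esym/eqP; congr Some; apply/val_inj.
Qed.

Lemma bsum_mono (F : multinom m -> C) K N : (forall a, 0 <= F a) -> (K <= N)%N ->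
  \sum_(a : bmultinom m K) F a <= \sum_(a : bmultinom m N) F a.
Proof.
move=> F0 KN; rewrite (bsum_widen _ KN) [leRHS](bigID (fun a : bmultinom m N => (mdeg a < K)%N)) /=.
by rewrite lerDl sumr_ge0.
Qed.

Lemma bsum_diff (F G : multinom m -> C) K N : (forall a, `|F a| <= G a) -> (K <= N)%N ->
  `|\sum_(a : bmultinom m N) F a - \sum_(a : bmultinom m K) F a| <=
  \sum_(a : bmultinom m N) G a - \sum_(a : bmultinom m K) G a.
Proof.
move=> FG KN; have key (H : multinom m -> C) : \sum_(a : bmultinom m N) H a - \sum_(a : bmultinom m K) H a =
    \sum_(a : bmultinom m N | ~~ (mdeg a < K)%N) H a :> C.
  rewrite (bsum_widen _ KN) (bigID (fun a : bmultinom m N => (mdeg a < K)%N)) /=.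
  by rewrite [X in X - _]addrC addrK.
rewrite !key (le_trans (ler_norm_sum _ _ _)) //.
exact: ler_sum.
Qed.

Lemma asum_ge0 c N r : 0 <= r -> 0 <= asum c N r.
Proof. by move=> r0; rewrite sumr_ge0 // => a _; rewrite mulr_ge0 // exprn_ge0. Qed.

Lemma asum_mono c r K N : 0 <= r -> (K <= N)%N -> asum c K r <= asum c N r.
Proof.
move=> r0 KN; apply: (bsum_mono (F := fun a => `|c a| * r ^+ mdeg a)) => // a.
by rewrite mulr_ge0 // exprn_ge0.
Qed.

Lemma expansion_shrink f c r s : 0 < s -> s <= r -> has_expansion f c r -> has_expansion f c s.
Proof.
move=> s0 sr [r0 [M HM] Hf]; split; first exact: s0.
- exists M => N; apply: le_trans (HM N); apply: ler_sum => a _.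
  by rewrite ler_wpM2l // lerXn2r ?nnegrE // ltW.
- by move=> x xs; apply: Hf; exact: lt_le_trans sr.
Qed.

Lemma common_radius (r s : C) : 0 < r -> 0 < s -> exists t, [/\ 0 < t, t <= r & t <= s].
Proof.
move=> r0 s0; have [rs|sr] := real_leP (gtr0_real r0) (gtr0_real s0).
  by exists r; split.
by exists s; split => //; exact: ltW.
Qed.

Lemma expansionB f g c d r : has_expansion f c r -> has_expansion g d r ->
  has_expansion (f - g) (fun a => c a - d a) r.
Proof.
move=> [r0 [M HM] Hf] [_ [M' HM'] Hg]; split; first exact: r0.
- exists (M + M') => N; apply: le_trans (lerD (HM N) (HM' N)).
  rewrite -big_split /=; apply: ler_sum => a _.
  by rewrite -mulrDl ler_wpM2r ?exprn_ge0 ?ler_normB // ltW.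
- move=> x xr.
  have -> : (fun N => psum (fun a => c a - d a) N x) = (fun N => psum c N x - psum d N x).
    by apply/funext => N; rewrite -sumrB; apply: eq_bigr => a _; rewrite mulrBl.
  exact: cvgB (Hf x xr) (Hg x xr).
Qed.

Lemma expansion_mono k a0 r : 0 < r ->
  has_expansion (fun x => k * mono x a0) (fun a => k * (a == a0)%:R) r.
Proof.
move=> r0.
have key (V : nmodType) N (F : multinom m -> V) : (mdeg a0 < N)%N -> (forall a, a != a0 -> F a = 0) ->
    \sum_(a : bmultinom m N) F a = F a0.
  move=> aN F0; rewrite (bigD1 (BMultinom aN)) //= big1 ?addr0 // => a.
  by rewrite bmeqP /= => /F0.
split; first exact: r0.
- exists (`|k| * r ^+ mdeg a0) => N.
  apply: (@le_trans _ _ (asum (fun a => k * (a == a0)%:R) (maxn N (mdeg a0).+1) r)).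
    by rewrite asum_mono ?leq_maxl // ltW.
  rewrite /asum (key _ _ (fun a => `|k * (a == a0)%:R| * r ^+ mdeg a)) ?leq_maxr //.
    by rewrite eqxx mulr1.
  by move=> a /negbTE ->; rewrite mulr0 normr0 mul0r.
- move=> x _; apply: cvg_near_cst; exists (mdeg a0).+1 => // N /= aN.
  rewrite /psum (key _ _ (fun a => k * (a == a0)%:R * mono x a)) //.
    by rewrite eqxx mulr1.
  by move=> a /negbTE ->; rewrite mulr0 mul0r.
Qed.

Definition conv c d (e : multinom m) : C :=
  \sum_(a : bmultinom m (mdeg e).+1)
    \sum_(b : bmultinom m (mdeg e).+1 | e == mnm_add a b) c a * d b.

Lemma convE c d e N : (mdeg e < N)%N ->
  conv c d e = \sum_(a : bmultinom m N) \sum_(b : bmultinom m N | e == mnm_add a b) c a * d b.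
Proof.
move=> eN; rewrite /conv.
under eq_bigr => a _ do
  rewrite big_mkcond (bsum_widen (fun b : multinom m => if e == mnm_add a b then c a * d b else 0) eN).
rewrite (bsum_widen (fun a : multinom m => \sum_(b : bmultinom m N | (mdeg b < (mdeg e).+1)%N) if e == mnm_add a b then c a * d b else 0) eN).
rewrite [LHS]big_mkcond /=; apply: eq_bigr => a _.
rewrite [RHS]big_mkcond; case: ifPn => ae.
  rewrite [LHS]big_mkcond; apply: eq_bigr => b _; case: ifPn => // be.
  case: eqP => // eE; move: be; rewrite eE mdegD ltnS leq_addl //.
rewrite big1 // => b _.
case: eqP => // eE; move: ae; rewrite eE mdegD ltnS leq_addr //.
Qed.

Lemma conv_sum c d (F : multinom m -> C) N : {morph F : a b / mnm_add a b >-> a * b} ->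
  \sum_(e : bmultinom m N) conv c d e * F e =
  \sum_(a : bmultinom m N) \sum_(b : bmultinom m N)
     (if (mdeg a + mdeg b < N)%N then c a * F a * (d b * F b) else 0).
Proof.
move=> FM.
under eq_bigr => e _.
  rewrite (convE _ _ (bmdeg e)) mulr_suml.
  under eq_bigr do rewrite mulr_suml big_mkcond.
  over.
rewrite exchange_big; apply: eq_bigr => a _ /=.
rewrite exchange_big; apply: eq_bigr => b _ /=.
rewrite -mdegD; case: ifPn => abN.
  rewrite (bigD1 (BMultinom abN)) //= eqxx big1 ?addr0.
    by rewrite FM mulrACA.
  by move=> e; rewrite bmeqP /= => /negbTE ->.
rewrite big1 // => e _; case: eqP => // eE.
by move: abN; rewrite -eE bmdeg.
Qed.

Lemma sum_prod (I J : finType) (F : I -> C) (G : J -> C) :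
  (\sum_a F a) * (\sum_b G b) = \sum_a \sum_b F a * G b.
Proof. by rewrite mulr_suml; apply: eq_bigr => a _; rewrite mulr_sumr. Qed.

Definition aconv c d N r := \sum_(e : bmultinom m N) conv (fun a => `|c a|) (fun a => `|d a|) e * r ^+ mdeg e.

Lemma expr_mdegM (r : C) : {morph (fun a : multinom m => r ^+ mdeg a) : a b / mnm_add a b >-> a * b}.
Proof. by move=> a b; rewrite mdegD exprD. Qed.

Lemma aconv_le c d N r : 0 <= r -> aconv c d N r <= asum c N r * asum d N r.
Proof.
move=> r0; rewrite /aconv (conv_sum _ _ _ (@expr_mdegM r)) /asum sum_prod.
apply: ler_sum => a _; apply: ler_sum => b _; case: ifP => // _.
by rewrite !mulr_ge0 ?exprn_ge0.
Qed.

Lemma aconv_ge c d N r : 0 <= r -> asum c N r * asum d N r <= aconv c d (N + N) r.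
Proof.
move=> r0; rewrite /aconv (conv_sum _ _ _ (@expr_mdegM r)) /asum sum_prod.
under eq_bigr => a _ do rewrite (bsum_widen (fun b : multinom m => `|c a| * r ^+ mdeg a * (`|d b| * r ^+ mdeg b)) (leq_addr N N)).
rewrite (bsum_widen (fun a : multinom m => \sum_(b : bmultinom m (N + N) | (mdeg b < N)%N) (`|c a| * r ^+ mdeg a * (`|d b| * r ^+ mdeg b))) (leq_addr N N)).
rewrite big_mkcond; apply: ler_sum => a _; case: ifPn => aN; last first.
  by rewrite sumr_ge0 // => b _; case: ifP => // _; rewrite !mulr_ge0 ?exprn_ge0.
rewrite big_mkcond; apply: ler_sum => b _; case: ifPn => bN.
  rewrite (_ : (_ < _)%N) //; apply: leq_trans (leq_add aN (ltnW bN)).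
  by rewrite addSn.
by case: ifP => // _; rewrite !mulr_ge0 ?exprn_ge0.
Qed.
End PowerSeries.

Section PowerSeries2.
Variables (R : realType) (m : nat).
Local Notation C := R[i].
Implicit Types (c d : multinom m -> C) (f g : 'rV[C]_m -> C) (x : 'rV[C]_m).

Lemma expansionM f g c d r : has_expansion f c r -> has_expansion g d r ->
  has_expansion (f * g) (conv c d) r.
Proof.
move=> [r0 [M HM] Hf] [_ [M' HM'] Hg].
have r0' := ltW r0.
have TM N : 0 <= aconv c d N r <= M * M'.
  rewrite (le_trans (aconv_le _ _ _ r0')) ?ler_pM ?asum_ge0 // andbT.
  apply: sumr_ge0 => a _; rewrite mulr_ge0 ?exprn_ge0 //.
  by rewrite !sumr_ge0 // => b _; rewrite sumr_ge0 // => b' _; rewrite mulr_ge0.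
have Tmono : {homo (fun N => aconv c d N r) : K N / (K <= N)%N >-> K <= N}.
  move=> K N KN; apply: (bsum_mono (F := fun e =>
     conv (fun a => `|c a|) (fun a => `|d a|) e * r ^+ mdeg e)) => // a.
  rewrite mulr_ge0 ?exprn_ge0 //.
  by rewrite !sumr_ge0 // => b _; rewrite sumr_ge0 // => b' _; rewrite mulr_ge0.
split; first exact: r0.
- exists (M * M') => N; have /andP[_] := TM N; apply: le_trans.
  apply: ler_sum => e _; rewrite ler_wpM2r ?exprn_ge0 //.
  rewrite (le_trans (ler_norm_sum _ _ _)) //; apply: ler_sum => a _.
  rewrite (le_trans (ler_norm_sum _ _ _)) //; apply: ler_sum => b _.
  by rewrite normrM.
- move=> x xr.
  have fg : (psum c N x * psum d N x) @[N --> \oo] --> (f x * g x : C).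
    by apply: cvgM; [exact: Hf|exact: Hg].
  suff H : (psum c N x * psum d N x - psum (conv c d) N x) @[N --> \oo] --> (0 : C).
    have -> : (fun N => psum (conv c d) N x) = (fun N => psum c N x * psum d N x -
        (psum c N x * psum d N x - psum (conv c d) N x)).
      by apply/funext => N; rewrite opprB addrC subrK.
    by have := cvgB fg H; rewrite subr0; apply.
  apply/cvgrPdist_lt => e e0.
  have [K HK] := bounded_mono_cauchy TM Tmono e0.
  exists K => // N /= KN; rewrite sub0r normrN.
  have := HK (N + N)%N (leq_trans KN (leq_addr _ _)).
  apply: le_lt_trans; apply: (@le_trans _ _ (aconv c d (N + N) r - aconv c d N r)); last first.
    by rewrite lerB // Tmono.
  apply: (@le_trans _ _ (asum c N r * asum d N r - aconv c d N r)); last first.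
    by rewrite lerB // aconv_ge.
  rewrite /asum /psum /aconv (conv_sum _ _ _ (monoD x)) (conv_sum _ _ _ (@expr_mdegM R m r)) !sum_prod.
  rewrite -!sumrB (le_trans (ler_norm_sum _ _ _)) //; apply: ler_sum => a _.
  rewrite -!sumrB (le_trans (ler_norm_sum _ _ _)) //; apply: ler_sum => b _.
  case: ifPn => _; first by rewrite !subrr normr0.
  rewrite !subr0 !normrM ler_pM ?mulr_ge0 //.
    by rewrite ler_wpM2l // mono_norm // ltW.
  by rewrite ler_wpM2l // mono_norm // ltW.
Qed.

Lemma expansion_exists c r M : 0 < r -> (forall N, asum c N r <= M) ->
  exists f, has_expansion f c r.
Proof.
move=> r0 HM.
have H x : exists l : C, `|x| < r -> psum c N x @[N --> \oo] --> l.
  have [xr|] := boolP (`|x| < r); last by exists 0.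
  have [|K N KN|l Hl] := @complex_cvg R (fun N => psum c N x) (fun N => asum c N r) M.
  - by move=> N; rewrite HM asum_ge0 // ltW.
  - apply: (bsum_diff (F := fun a => c a * mono x a) (G := fun a => `|c a| * r ^+ mdeg a)) => // a.
    by rewrite normrM ler_wpM2l // mono_norm // ltW.
  by exists l.
exists (fun x => sval (cid (H x))); split; [exact: r0|by exists M|].
by move=> x; exact: (svalP (cid (H x))).
Qed.

Lemma cvg_norm_le (u : nat -> C) (l B : C) : 
  u @ \oo --> l -> (forall n, `|u n| <= B) -> `|l| <= B.
Proof.
move=> ul uB; apply/ler_addgt0Pr => e e0.
move/cvgrPdist_lt: ul => /(_ e e0) [N _ HN].
have := HN N (leqnn N) => /= /ltW H.
rewrite -[l](subrK (u N)) (le_trans (ler_normD _ _)) // addrC lerD //.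
Qed.

Section Derivative.
Variable i : 'I_m.

Definition dcoef c (a : multinom m) : C := (a i).+1%:R * c (mnm_add a (mnm1 i)).

Lemma bsum_shift (V : nmodType) (H : multinom m -> V) N :
  (forall b : multinom m, b i = 0%N -> H b = 0) ->
  \sum_(b : bmultinom m N.+1) H b = \sum_(a : bmultinom m N) H (mnm_add a (mnm1 i)).
Proof.
move=> H0; rewrite (bigID (fun b : bmultinom m N.+1 => (b i != 0)%N)) /= addrC big1 ?add0r; last first.
  by move=> b; rewrite negbK => /eqP /H0.
have hP (a : bmultinom m N) : (mdeg (mnm_add a (mnm1 i)) < N.+1)%N.
  by rewrite mdegD mdeg1 addn1 ltnS bmdeg.
have subK (b : multinom m) : (b i != 0)%N -> mnm_add (mnm_sub b (mnm1 i)) (mnm1 i) = b.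
  move=> bi; apply/mnmP => j; rewrite !mnmE; case: eqP => [<-|_]; last by rewrite subn0 addn0.
  by rewrite subnK // lt0n.
pose h (a : bmultinom m N) : bmultinom m N.+1 := BMultinom (hP a).
rewrite (reindex_omap h (fun b => insub (mnm_sub (bmnm b) (mnm1 i)))) /=; last first.
  move=> b bi; rewrite insubT /=.
    have E : (mdeg (mnm_sub b (mnm1 i))).+1 = mdeg b.
      by rewrite -[in RHS](subK _ bi) mdegD mdeg1 addn1.
    by rewrite -ltnS E bmdeg.
  by move=> bN; congr Some; apply/val_inj => /=; rewrite subK.
apply/eq_big => [a|//].
rewrite mnmDE mnm1E eqxx addn1 /=.
case: insubP => [b _ bE|].
  by apply/eqP; congr Some; apply/val_inj; rewrite [LHS]bE; apply/mnmP => j; rewrite mnmBE mnmDE addnK.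
rewrite (_ : mnm_sub _ _ = a) ?bmdeg //.
by apply/mnmP => j; rewrite mnmBE mnmDE addnK.
Qed.

Lemma pow_quot_bound (y t s : C) k : 0 <= s -> `|y| + `|t| <= s ->
  s ^+ 2 * `|(y + t) ^+ k - y ^+ k - t * (k%:R * y ^+ k.-1)| <= `|t| ^+ 2 * (k ^ 2)%:R * s ^+ k.
Proof.
move=> s0 yts; elim: k => [|k IH].
  by rewrite !expr0 subrr mul0r mulr0 subr0 normr0 !mulr0 mul0r.
have -> : (y + t) ^+ k.+1 - y ^+ k.+1 - t * (k.+1%:R * y ^+ k.+1.-1) =
   (y + t) * ((y + t) ^+ k - y ^+ k - t * (k%:R * y ^+ k.-1)) + t ^+ 2 * (k%:R * y ^+ k.-1).
  have -> : y ^+ k.+1 = y * y ^+ k by rewrite exprS.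
  have -> : (y + t) ^+ k.+1 = (y + t) * (y + t) ^+ k by rewrite exprS.
  have yk : k%:R * y ^+ k = y * (k%:R * y ^+ k.-1).
    by case: k {IH} => [|k]; rewrite ?mul0r ?mulr0 // exprS mulrCA.
  rewrite /= -[k.+1%:R]natr1 (mulrDl _ _ (y ^+ k)) mul1r yk expr2.
  move: (y ^+ k) ((y + t) ^+ k) (k%:R * y ^+ k.-1) => A B D; ring.
have yt : `|y + t| <= s by rewrite (le_trans (ler_normD _ _)).
have ys : `|y| <= s by rewrite (le_trans _ yts) // lerDl.
apply: (@le_trans _ _ (s * (`|t| ^+ 2 * (k ^ 2)%:R * s ^+ k) + `|t| ^+ 2 * (k%:R * s ^+ k.+1))).
  rewrite (le_trans (ler_wpM2l _ (ler_normD _ _))) ?exprn_ge0 // mulrDr.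
  apply: lerD.
    rewrite normrM mulrCA ler_pM ?mulr_ge0 ?exprn_ge0 //.
  rewrite !normrM normr_nat !normrX mulrCA ler_wpM2l ?exprn_ge0 //.
  case: k {IH} => [|k]; first by rewrite !mul0r mulr0.
  rewrite mulrCA ler_wpM2l ?ler0n // (exprD s 2 k : s ^+ k.+2 = _) ler_wpM2l ?exprn_ge0 //.
  by rewrite lerXn2r ?nnegrE.
have -> : s * (`|t| ^+ 2 * (k ^ 2)%:R * s ^+ k) + `|t| ^+ 2 * (k%:R * s ^+ k.+1) =
   `|t| ^+ 2 * (k ^ 2 + k)%:R * s ^+ k.+1.
  by rewrite natrD (exprS s k); ring.
rewrite ler_wpM2r ?exprn_ge0 // ler_wpM2l ?exprn_ge0 // ler_nat.
by rewrite -!mulnn; nia.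
Qed.

Lemma sqr_le_exp2 k : (k ^ 2 <= 2 ^ k.+1)%N.
Proof.
case: k => [|[|[|]]] // k; elim: k => // k IH.
rewrite -mulnn in IH; rewrite -mulnn expnS; move: IH.
by set A := (2 ^ k.+4)%N; nia.
Qed.

Lemma le_exp2_pred k : (k <= 2 ^ k.-1)%N.
Proof. by case: k => //= k; exact: ltn_expl. Qed.

Definition evec : 'rV[C]_m := delta_mx 0 i.

Lemma mono_split x (t : C) (b : multinom m) :
  mono (x + t *: evec) b = (x 0 i + t) ^+ b i * \prod_(j < m | j != i) x 0 j ^+ b j.
Proof.
rewrite /mono (bigD1 i) //=; congr (_ * _).
  by rewrite !mxE !eqxx mulr1.
by apply: eq_bigr => j ji; rewrite !mxE eqxx (negbTE ji) mulr0 addr0.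
Qed.

Lemma mono_sub x (b : multinom m) :
  (b i)%:R * mono x (mnm_sub b (mnm1 i)) =
  (b i)%:R * x 0 i ^+ (b i).-1 * \prod_(j < m | j != i) x 0 j ^+ b j.
Proof.
rewrite -mulrA /mono (bigD1 i) //= mnmBE mnm1E eqxx subn1; congr (_ * (_ * _)).
by apply: eq_bigr => j ji; rewrite mnmBE mnm1E eq_sym (negbTE ji) subn0.
Qed.

Lemma mono_quot_bound x (t s : C) (b : multinom m) : 0 <= s -> `|x| + `|t| <= s ->
  s ^+ 2 * `|mono (x + t *: evec) b - mono x b - t * ((b i)%:R * mono x (mnm_sub b (mnm1 i)))|
  <= `|t| ^+ 2 * (2 * (s *+ 2) ^+ mdeg b).
Proof.
move=> s0 xts; rewrite mono_sub mono_split.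
have -> : mono x b = x 0 i ^+ b i * \prod_(j < m | j != i) x 0 j ^+ b j.
  by rewrite /mono (bigD1 i).
set P := \prod_(j < m | _) _.
rewrite [X in `|X|](_ : _ = ((x 0 i + t) ^+ b i - x 0 i ^+ b i - t * ((b i)%:R * x 0 i ^+ (b i).-1)) * P); last first.
  by ring.
have PE : `|P| <= s ^+ (\sum_(j < m | j != i) b j).
  rewrite /P normr_prod -prodrXr; apply: ler_prod => j _.
  have xs : `|x 0 j| <= s by rewrite (le_trans (coord_le_norm _ _)) // (le_trans _ xts) // lerDl.
  by rewrite normr_ge0 normrX lerXn2r ?nnegrE.
rewrite normrM (mulrA (s ^+ 2)).
have H := @pow_quot_bound (x 0 i) t s (b i) s0.
have {}H := H (le_trans (lerD (coord_le_norm x i) (lexx _)) xts).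
apply: (le_trans (ler_pM _ _ H PE)); rewrite ?mulr_ge0 ?exprn_ge0 //.
rewrite -[leLHS]mulrA -exprD.
have -> : (b i + \sum_(j < m | j != i) b j)%N = mdeg b by rewrite mdegE [RHS](bigD1 i).
rewrite -mulrA ler_wpM2l ?exprn_ge0 // -[s *+ 2]mulr_natl exprMn mulrA ler_wpM2r ?exprn_ge0 //.
rewrite -natrX -natrM ler_nat -expnS (leq_trans (sqr_le_exp2 _)) // leq_exp2l // ltnS.
by rewrite mdegE (bigD1 i) //= leq_addr.
Qed.

Lemma dcoef_sum c N x : psum (dcoef c) N x =
  \sum_(b : bmultinom m N.+1) c b * ((b i)%:R * mono x (mnm_sub b (mnm1 i))).
Proof.
rewrite (bsum_shift (H := fun b => c b * ((b i)%:R * mono x (mnm_sub b (mnm1 i))))); last first.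
  by move=> b ->; rewrite mul0r mulr0.
apply: eq_bigr => a _; rewrite mnmDE mnm1E eqxx addn1 /dcoef.
rewrite (_ : mnm_sub _ _ = a); last by apply/mnmP => j; rewrite mnmBE mnmDE addnK.
by rewrite mulrA (mulrC (c _)).
Qed.

Lemma dcoef_asum c r M : 0 < r -> (forall N, asum c N r <= M) ->
  forall N, asum (dcoef c) N (r / 2) <= M / (r / 2).
Proof.
move=> r0 HM N.
have s0 : 0 < r / 2 by rewrite divr_gt0.
rewrite ler_pdivlMr // /asum mulr_suml.
apply: le_trans (HM N.+1).
pose H (b : multinom m) := (b i)%:R * (`|c b| * (r / 2) ^+ mdeg b).
rewrite [leLHS](_ : _ = \sum_(a : bmultinom m N) H (mnm_add a (mnm1 i))); last first.
  apply: eq_bigr => a _ /=; rewrite /H mnmDE mnm1E eqxx addn1 /dcoef normrM normr_nat.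
  by rewrite mdegD mdeg1 addn1 exprSr -!mulrA.
rewrite -(bsum_shift (H := H)); last by move=> b; rewrite /H => ->; rewrite mul0r.
apply: ler_sum => b _; rewrite /H mulrCA ler_wpM2l // expr_div_n mulrA mulrAC ler_piMl ?exprn_ge0 //.
  exact: ltW.
rewrite ler_pdivrMr ?exprn_gt0 // mul1r -natrX ler_nat (leq_trans (le_exp2_pred _)) //.
rewrite leq_exp2l // (leq_trans (leq_pred _)) // mdegE (bigD1 i) //= leq_addr //.
Qed.

Lemma expansionD f c r : has_expansion f c r ->
  (forall x, `|x| < r / 2 -> derivable f x evec) /\
  has_expansion ('D_evec f) (dcoef c) (r / 2).
Proof.
move=> [r0 [M HM] Hf].
have s0 : 0 < r / 2 by rewrite divr_gt0.
have HM' := dcoef_asum r0 HM.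
have [g [_ _ Hg]] := expansion_exists s0 HM'.
have main x : `|x| < r / 2 -> (fun h => h^-1 *: (f (h *: evec + x) - f x)) @ 0^' --> g x.
  move=> xs; pose B := 2 * M / (r / 2) ^+ 2.
  have key t : `|x| + `|t| <= r / 2 -> `|f (x + t *: evec) - f x - t * g x| <= `|t| ^+ 2 * B.
    move=> xts.
    have sr : r / 2 < r by rewrite ltr_pdivrMr // ltr_pMr // ltr1n.
    have xr : `|x| < r by rewrite (lt_trans xs).
    have xtr : `|x + t *: evec| < r.
      rewrite (le_lt_trans _ sr) // (le_trans _ xts) // (le_trans (ler_normD _ _)) //.
      rewrite lerD // normrZ ler_piMr // norm_le_coord // => j.
      by rewrite mxE eqxx; case: eqP => _ /=; rewrite ?normr1 ?normr0.
    have H1 : (psum c N.+1 (x + t *: evec) - psum c N.+1 x - t * psum (dcoef c) N x)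
        @[N --> \oo] --> (f (x + t *: evec) - f x - t * g x : C).
      apply: cvgB; last by apply: cvgMr; exact: Hg.
      by apply: cvgB; rewrite (cvg_shiftS (fun N => psum c N _)); exact: Hf.
    apply: (cvg_norm_le H1) => N.
    rewrite /B mulrA ler_pdivlMr ?exprn_gt0 // mulrC dcoef_sum /psum mulr_sumr -!sumrB.
    apply: (le_trans (ler_wpM2l _ (ler_norm_sum _ _ _))); first by rewrite exprn_ge0 // ltW.
    apply: (@le_trans _ _ (`|t| ^+ 2 * (2 * asum c N.+1 r))); last first.
      by rewrite ler_wpM2l ?exprn_ge0 // ler_wpM2l.
    rewrite /asum !mulr_sumr; apply: ler_sum => b _.
    rewrite [X in `|X|](_ : _ = c b * (mono (x + t *: evec) b - mono x b -
      t * ((b i)%:R * mono x (mnm_sub b (mnm1 i))))); last by ring.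
    rewrite normrM mulrCA (mulrCA 2) (mulrCA (`|t| ^+ 2)) ler_wpM2l //.
    rewrite (_ : r ^+ mdeg b = (r / 2 *+ 2) ^+ mdeg b); last first.
      by rewrite -[_ *+ 2]mulr_natr divfK.
    by apply: mono_quot_bound => //; exact: ltW.
  have B0 : 0 <= B.
    rewrite /B divr_ge0 ?exprn_ge0 ?(ltW s0) // mulr_ge0 //.
    by apply: le_trans (HM 0%N); rewrite asum_ge0 // ltW.
  apply/cvgrPdist_lt => e e0.
  have d0 : 0 < e / (B + 1) by rewrite divr_gt0 // ltr_wpDl.
  have d1 : 0 < r / 2 - `|x| by rewrite subr_gt0.
  near=> h.
  have h0 : h != 0 by near: h; exact: nbhs_dnbhs_neq.
  have hd : `|h| < e / (B + 1) by near: h; exact: dnbhs0_lt.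
  have hx : `|h| < r / 2 - `|x| by near: h; exact: dnbhs0_lt.
  have := key h; rewrite addrC -lerBrDr => /(_ (ltW hx)).
  rewrite (addrC x) => K.
  have -> : g x - h^-1 *: (f (h *: evec + x) - f x) =
      - (h^-1 * (f (h *: evec + x) - f x - h * g x)).
    by rewrite mulrBr mulKf // opprB.
  rewrite normrN normrM normfV ltr_pdivrMl ?normr_gt0 //.
  apply: (le_lt_trans K); rewrite expr2 -mulrA ltr_pM2l ?normr_gt0 //.
  rewrite (le_lt_trans (_ : _ <= `|h| * (B + 1))) ?ler_wpM2l ?lerDl //.
  by rewrite -ltr_pdivlMr // ltr_wpDl.
have mainv x : `|x| < r / 2 -> 'D_evec f x = g x.
  by move=> xs; apply: cvg_lim; [exact: norm_hausdorff|exact: main].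
split.
  by move=> x xs; apply/cvg_ex; exists (g x); exact: main.
split; [exact: s0|by exists (M / (r / 2))|] => x xs.
by rewrite mainv //; exact: Hg.
Unshelve. all: by end_near. Qed.

End Derivative.

Section Pullback.
Variable n : nat.

Definition mnmL (a : multinom m) : multinom (m + n) :=
  Multinom [tuple (if fintype.split j is inl k then a k else 0%N) | j < m + n].

Definition mnmlsub (e : multinom (m + n)) : multinom m :=
  Multinom [tuple e (lshift n j) | j < m].

Definition ecoef c (e : multinom (m + n)) : C :=
  if e == mnmL (mnmlsub e) then c (mnmlsub e) else 0.

Lemma mnmLl a j : mnmL a (lshift n j) = a j.
Proof. by rewrite /mnmL multinomE tnth_mktuple (unsplitK (inl j)). Qed.

Lemma mnmLr a j : mnmL a (rshift m j) = 0%N.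
Proof. by rewrite /mnmL multinomE tnth_mktuple (unsplitK (inr j)). Qed.

Lemma mnmLK : cancel mnmL mnmlsub.
Proof. by move=> a; apply/mnmP => j; rewrite /mnmlsub multinomE tnth_mktuple mnmLl. Qed.

Lemma mdegL a : mdeg (mnmL a) = mdeg a.
Proof.
rewrite !mdegE big_split_ord /= [X in (_ + X)%N]big1 ?addn0.
  by apply: eq_bigr => j _; rewrite mnmLl.
by move=> j _; rewrite mnmLr.
Qed.

Lemma monoL (x : 'rV[C]_(m + n)) a : mono x (mnmL a) = mono (lsubmx x) a.
Proof.
rewrite /mono big_split_ord /= [X in _ * X]big1 ?mulr1.
  by apply: eq_bigr => j _; rewrite mnmLl mxE.
by move=> j _; rewrite mnmLr expr0.
Qed.

Lemma bsum_ecoef (V : nmodType) (H : multinom (m + n) -> V) N :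
  (forall e : multinom (m + n), e != mnmL (mnmlsub e) -> H e = 0) ->
  \sum_(e : bmultinom (m + n) N) H e = \sum_(a : bmultinom m N) H (mnmL a).
Proof.
move=> H0; rewrite (bigID (fun e : bmultinom (m + n) N => bmnm e == mnmL (mnmlsub e))) /=.
rewrite addrC big1 ?add0r; last by move=> e /H0.
have hP (a : bmultinom m N) : (mdeg (mnmL a) < N)%N by rewrite mdegL bmdeg.
pose h (a : bmultinom m N) : bmultinom (m + n) N := BMultinom (hP a).
rewrite (reindex_omap h (fun e => insub (mnmlsub (bmnm e)))) /=; last first.
  move=> e /eqP eE; rewrite insubT /=.
    by rewrite -mdegL -eE bmdeg.
  by move=> eN; congr Some; apply/val_inj => /=; rewrite -eE.
apply/eq_big => [a|//]; rewrite mnmLK eqxx /=.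
by apply/eqP; case: insubP => [b _ bE|]; [congr Some; apply/val_inj|rewrite bmdeg].
Qed.

Lemma expansion_pull f c r : has_expansion f c r ->
  has_expansion (fun x : 'rV[C]_(m + n) => f (lsubmx x)) (ecoef c) r.
Proof.
move=> [r0 [M HM] Hf].
have E a : ecoef c (mnmL a) = c a by rewrite /ecoef mnmLK eqxx.
split; first exact: r0.
  exists M => N; apply: le_trans (HM N); rewrite /asum.
  rewrite (bsum_ecoef (H := fun e => `|ecoef c e| * r ^+ mdeg e)).
    by under eq_bigr do rewrite E mdegL.
  by move=> e /negbTE eE; rewrite /ecoef eE normr0 mul0r.
move=> x xr; have -> : (fun N => psum (ecoef c) N x) = (fun N => psum c N (lsubmx x)).
  apply/funext => N; rewrite /psum.
  rewrite (bsum_ecoef (H := fun e => ecoef c e * mono x e)).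
    by under eq_bigr do rewrite E monoL.
  by move=> e /negbTE eE; rewrite /ecoef eE mul0r.
apply: Hf; apply: le_lt_trans xr; apply: norm_le_coord => // j.
by rewrite mxE coord_le_norm.
Qed.

End Pullback.
End PowerSeries2.

Section HoloRing.
Variables (R : realType) (m : nat).
Local Notation C := R[i].

Definition hol_pred : {pred 'rV[C]_m -> C} := fun f => `[< analytic0 f >].

Lemma analytic0_mono k (a : multinom m) : analytic0 (fun x : 'rV[C]_m => k * mono x a).
Proof. by eexists; exists 1; apply: expansion_mono. Qed.

Lemma mono0 (x : 'rV[C]_m) : mono x mnm0 = 1.
Proof. by rewrite /mono big1 // => i _; rewrite mnm0E expr0. Qed.

Lemma mono1 (x : 'rV[C]_m) i : mono x (mnm1 i) = x 0 i.
Proof.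
rewrite /mono (bigD1 i) //= mnm1E eqxx expr1 big1 ?mulr1 // => j ji.
by rewrite mnm1E eq_sym (negbTE ji) expr0.
Qed.

Lemma analytic0_cst (k : C) : analytic0 (fun _ : 'rV[C]_m => k).
Proof.
rewrite (_ : (fun _ => k) = (fun x : 'rV[C]_m => k * mono x mnm0)).
  exact: analytic0_mono.
by apply/funext => x; rewrite mono0 mulr1.
Qed.

Lemma analytic0_coord i : analytic0 (fun x : 'rV[C]_m => x 0 i).
Proof.
rewrite (_ : (fun _ => _) = (fun x : 'rV[C]_m => 1 * mono x (mnm1 i))).
  exact: analytic0_mono.
by apply/funext => x; rewrite mono1 mul1r.
Qed.

Lemma hol_subring_closed : subring_closed hol_pred.
Proof.
split.
- exact/asboolP/analytic0_cst.
- move=> f g /asboolP[c [r fc]] /asboolP[d [s gd]]; apply/asboolP.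
  have [t [t0 tr ts]] := common_radius (let: And3 r0 _ _ := fc in r0) (let: And3 r0 _ _ := gd in r0).
  exists (fun a => c a - d a), t; apply: expansionB.
    exact: expansion_shrink tr fc.
  exact: expansion_shrink ts gd.
- move=> f g /asboolP[c [r fc]] /asboolP[d [s gd]]; apply/asboolP.
  have [t [t0 tr ts]] := common_radius (let: And3 r0 _ _ := fc in r0) (let: And3 r0 _ _ := gd in r0).
  exists (conv c d), t; apply: expansionM.
    exact: expansion_shrink tr fc.
  exact: expansion_shrink ts gd.
Qed.

HB.instance Definition _ := GRing.isSubringClosed.Build ('rV[C]_m -> C) hol_pred hol_subring_closed.

Record hol := Hol { hol_fun :> 'rV[C]_m -> C; _ : hol_fun \in hol_pred }.
HB.instance Definition _ := [isSub for hol_fun].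
HB.instance Definition _ := [Choice of hol by <:].
HB.instance Definition _ := [SubChoice_isSubComNzRing of hol by <:].

Lemma holP (f : hol) : analytic0 f.
Proof. by case: f => f fP; exact/asboolP. Qed.

Definition mkhol (f : 'rV[C]_m -> C) (fP : analytic0 f) : hol := Hol (asboolT fP).

Definition vanish : {pred hol} := fun f => `[< \forall x \near (0 : 'rV[C]_m), f x = 0 >].

Lemma vanish_idealr : idealr_closed vanish.
Proof.
split.
- by apply/asboolP; near=> x.
- apply/asboolP => /nbhs_singleton /eqP; apply/negP; exact: oner_neq0.
- move=> a f g /asboolP f0 /asboolP g0; apply/asboolP.
  near=> x; rewrite -[LHS]/(a x * f x + g x).
  by rewrite (near f0 x) // (near g0 x) // mulr0 addr0.
Unshelve. all: by end_near. Qed.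

HB.instance Definition _ := isIdealr.Build hol vanish vanish_idealr.

(* Germs at 0 of holomorphic functions on C^m: two functions have the same
   germ iff they agree on a neighbourhood of 0. *)
Definition germ : Type := {ideal_quot vanish}.
HB.instance Definition _ := GRing.ComNzRing.on germ.

HB.instance Definition _ := EqQuotient.on germ.

Definition germ_of (f : 'rV[C]_m -> C) (fP : analytic0 f) : germ :=
  \pi_germ (mkhol fP).

Lemma eq_germ (f g : hol) :
  (\pi_germ f = \pi_germ g) <-> (\forall x \near (0 : 'rV[C]_m), f x = g x).
Proof.
have H : (\pi_germ f == \pi_germ g) = (f - g \in vanish).
  exact/esym/(@Quotient.idealrBE hol vanish f g).
split=> [/eqP|fg].
  rewrite H => /asboolP fg; near=> x.
  by apply/eqP; rewrite -subr_eq0; apply/eqP; near: x.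
apply/eqP; rewrite H; apply/asboolP; near=> x.
by rewrite -[LHS]/(f x - g x) (near fg x) // subrr.
Unshelve. all: by end_near. Qed.

Definition germ_cst (k : C) : germ := germ_of (analytic0_cst k).

Definition germ_coord (i : 'I_m) : germ := germ_of (analytic0_coord i).

Lemma analytic0_derive (i : 'I_m) (f : 'rV[C]_m -> C) :
  analytic0 f -> analytic0 ('D_(evec R i) f).
Proof. by move=> [c [r /(expansionD i)[_ H]]]; exists (dcoef i c), (r / 2). Qed.

(* i-th partial derivative of a germ, computed on a representative;
   [germ_derE] shows that the choice is irrelevant. *)
Definition germ_der (i : 'I_m) (h : germ) : germ :=
  germ_of (analytic0_derive i (holP (repr h))).

Lemma germ_derE i (f : hol) :
  germ_der i (\pi_germ f) = germ_of (analytic0_derive i (holP f)).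
Proof.
apply/eq_germ => /=.
have /eq_germ fg : \pi_germ (repr (\pi_germ f)) = \pi_germ f by rewrite reprK.
by have := near_join fg; apply: filterS => x; exact: near_eq_derive.
Qed.

End HoloRing.

Section Pull.
Variables (R : realType) (m n : nat).
Local Notation C := R[i].

Lemma analytic0_pull (f : 'rV[C]_m -> C) : analytic0 f ->
  analytic0 (fun x : 'rV[C]_(m + n) => f (lsubmx x)).
Proof. by move=> [c [r /(expansion_pull n) H]]; exists (ecoef c), r. Qed.

(* C^m x C^n is 'rV_(m + n), with first projection lsubmx: this is the
   inclusion of the germs on C^m into the germs on C^m x C^n. *)
Definition germ_pull (h : germ R m) : germ R (m + n) :=
  germ_of (analytic0_pull (holP (repr h))).

Lemma germ_pullE (f : hol R m) :
  germ_pull (\pi_(germ R m) f) = germ_of (analytic0_pull (holP f)).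
Proof.
apply/eq_germ => /=.
have /eq_germ fg : \pi_(germ R m) (repr (\pi_(germ R m) f)) = \pi_(germ R m) f.
  by rewrite reprK.
have cl : continuous (fun x : 'rV[C]_(m + n) => lsubmx x).
  move=> x A /nbhs_ballP[e e0 Ae]; apply/nbhs_ballP; exists e => // y [_ xy].
  by apply: Ae; split => // i j; rewrite !mxE; exact: xy.
have l0 : lsubmx (0 : 'rV[C]_(m + n)) = 0 by apply/matrixP => i j; rewrite !mxE.
apply: (cl 0 [set y | repr (\pi_(germ R m) f) y = f y]).
by rewrite l0; exact: fg.
Qed.

End Pull.

Section FreeDivisor.
Variables (R : realType) (m : nat).
Local Notation C := R[i].
Local Notation A := (germ R m).

Definition derivation (D : A -> A) : Prop :=
  [/\ forall f g, D (f + g) = D f + D g,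
      forall (k : C) f, D (germ_cst m k * f) = germ_cst m k * D f &
      forall f g, D (f * g) = D f * g + f * D g].

Definition log_derivations (h : A) : set (A -> A^o) :=
  [set D | derivation D /\ exists a : A, D h = a * h].

Definition squarefree (h : A) : Prop :=
  forall a b : A, h = a ^+ 2 * b -> exists u : A, a * u = 1.

End FreeDivisor.

(* The basis b is not assumed finite. *)
Definition free_submodule (A : nzRingType) (V : lmodType A) (P : set V) : Prop :=
  exists (I : choiceType) (b : I -> V),
    [/\ forall i, P (b i),
        forall v, P v -> exists (s : seq I) (a : I -> A), v = \sum_(i <- s) a i *: b i &
        forall (s : seq I) (a : I -> A), uniq s ->
          \sum_(i <- s) a i *: b i = 0 -> forall i, i \in s -> a i = 0].

Definition free_divisor (R : realType) (m : nat) (h : germ R m) : Prop :=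
  [/\ h != 0, squarefree h & free_submodule (log_derivations h)].

Definition ideal_gen (A : comNzRingType) (I : finType) (g : I -> A) : set A :=
  [set f | exists a : I -> A, f = \sum_i a i * g i].

Definition jacobian_ideal (R : realType) (m : nat) (h : germ R m) : set (germ R m) :=
  ideal_gen (fun i : 'I_m => germ_der i h).

(* (J_h, h) *)
Definition tjurina_ideal (R : realType) (m : nat) (h : germ R m) :
    set (germ R m) :=
  ideal_gen (fun o : option 'I_m => if o is Some i then germ_der i h else h).

(* the j-th coordinate on the second factor of C^m x C^n *)
Definition ycoord (R : realType) (m n : nat) (j : 'I_n) : germ R (m + n) :=
  germ_coord R (rshift m j).

(* Main.v *)
Require Import Defs.
From HB Require Import structures.
From mathcomp Require Import all_boot all_order all_algebra ring_quotient fraction.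
From mathcomp Require Import complex ring lra zify.
From mathcomp Require Import all_classical all_reals interval_inference.
From mathcomp Require Import topology normedtype derive sequences.
From mathcomp Require mpoly.
Import -(notations) mpoly.
Import numFieldNormedType.Exports.
Import Order.TTheory GRing.Theory Num.Theory.

Set Implicit Arguments.
Unset Strict Implicit.
Unset Printing Implicit Defensive.

Local Open Scope classical_set_scope.
Local Open Scope ring_scope.
Local Open Scope complex_scope.
Local Open Scope quotient_scope.

(** Let [O] be the ring of germs on C^m, [P] the ring of germs on C^m x C^n, and
    [f] the form [sum_i g_i y_i]. Logarithmic derivations of [h] preserve the ideal
    [I = (J_h, h)], since their commutators with the partial derivatives are
    derivations ([log_preserves_tjurina]). Hence a basis of [Der (- log h)] lifts to
    derivations of [P] that annihilate [f]. Together with the Euler field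
    [sum_i y_i d/dy_i] and a basis of the syzygies of [g], read as vertical fields,
    these lifts form a basis of [Der (- log (h f))] ([lift_span],
    [lift_independent]). Three facts are behind this.

    First, the syzygies of [g] are free. For the generators [dh/dx_1, .., dh/dx_m, h]
    of [I] the module of syzygies is [Der (- log h)] itself
    ([log_derivations_basis]), and over a local ring freeness of the syzygies does
    not depend on the generators ([basis_change]). A basis over [O] remains one over
    [P] ([basis_pull]): coefficient by coefficient in [y] this is linear algebra,
    and the quotients met on the way converge by the division theorem ([dvd_pull]).

    Second, [h f] divides [D (h f)] only if [h] divides [D h], that is, [f] is a
    nonzerodivisor modulo [h] ([form_regular]). By McCoy's argument this follows
    from [(h) : I = (h)], and so does the squarefreeness of [h f]
    ([squarefree_form]).

    Third, [(h) : I = (h)] for squarefree [h] ([jacobian_saturated]). After a linear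
    change of coordinates and Weierstrass preparation, [h] is a polynomial [w] in
    the last variable, and it suffices that [w] is prime to its derivative. A common
    factor would give a square factor of [w] over the field of fractions. A monic
    factor of [w] has bounded coefficients, because its roots are among those of
    [w]; and a bounded quotient of germs is a germ ([bounded_dvd]). So [h] itself
    would have a square factor.

    A germ is handled through its Taylor coefficients [gcoef], which determine it.
    The analytic input is one division theorem, for a germ with an initial monomial
    ([germ_division]). It gives the units, the absence of zero divisors, the
    Weierstrass theorems and the convergence in [dvd_pull]. *)

(** * Convergence and uniqueness of power series *)

Section Multinomials.
Variable m : nat.
Implicit Types (a : multinom m).

Lemma mnm_neq0 a : a != mnm0 -> exists i, a i != 0%N.
Proof.
move=> a0; apply/existsP; rewrite -negb_forall; apply: contraNN a0 => /forallP a0.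
by apply/eqP/mnmP => i; rewrite mnm0E; apply/eqP.
Qed.

Lemma mnm_sub1K a i : (0 < a i)%N -> mnm_add (mnm_sub a (mnm1 i)) (mnm1 i) = a.
Proof. by move=> ai; apply: submK; apply/mnm_lepP => j; rewrite mnm1E; case: eqP => // <-. Qed.

Lemma mdeg_sub1 a i : (0 < a i)%N -> mdeg a = (mdeg (mnm_sub a (mnm1 i))).+1.
Proof. by move=> ai; rewrite -[in LHS](mnm_sub1K ai) mdegD mdeg1 addn1. Qed.

End Multinomials.

Section Coefficients.
Variables (R : realType) (m : nat).
Local Notation C := R[i].
Implicit Types (c d : multinom m -> C) (f g : 'rV[C]_m -> C).

(** A nonzero multi-index is the sum of a basis vector and a smaller one, so the
    partial sums satisfy [S N.+1 <= 1 + m * s * S N]. *)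
Lemma geo_bsum (s : C) N : 0 <= s -> m%:R * s <= 2^-1 ->
  \sum_(a : bmultinom m N) s ^+ mdeg a <= 2.
Proof.
move=> s0 ms; elim: N => [|N IH].
  by rewrite big1 // => a; have := bmdeg a.
pose H (i : 'I_m) (a : multinom m) : C := if a i == 0%N then 0 else s ^+ mdeg a.
have H0 i a : 0 <= H i a by rewrite /H; case: ifP => // _; rewrite exprn_ge0.
have E i : \sum_(a : bmultinom m N.+1) H i a = s * \sum_(a : bmultinom m N) s ^+ mdeg a.
  rewrite (bsum_shift (i := i) (H := H i)); last by move=> b; rewrite /H => ->.
  rewrite mulr_sumr; apply: eq_bigr => a _.
  by rewrite /H mnmDE mnm1E eqxx addn1 /= mdegD mdeg1 addn1 exprS.
apply: (@le_trans _ _ (\sum_(a : bmultinom m N.+1) ((a == mnm0 :> multinom m)%:R + \sum_i H i a))).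
  apply: ler_sum => a _; case: (eqVneq (a : multinom m) mnm0) => [->|a0].
    by rewrite mdeg0 expr0 lerDl sumr_ge0.
  rewrite add0r; have [i ai] := mnm_neq0 a0.
  by rewrite (bigD1 i) //= {1}/H (negbTE ai) lerDl sumr_ge0.
rewrite big_split /= exchange_big /=.
under [X in _ + X]eq_bigr do rewrite E.
rewrite sumr_const card_ord -[X in _ + X]mulr_natl.
have -> : \sum_(a : bmultinom m N.+1) ((a : multinom m) == mnm0)%:R = 1 :> C.
  have z : (mdeg (mnm0 : multinom m) < N.+1)%N by rewrite mdeg0.
  rewrite (bigD1 (BMultinom z)) //= eqxx big1 ?addr0 // => a.
  by rewrite bmeqP /= => /negbTE ->.
rewrite mulrA (_ : 2 = 1 + 1 :> C) // lerD2l.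
apply: (@le_trans _ _ (2^-1 * 2)); last by rewrite mulVf.
by rewrite ler_pM ?mulr_ge0 // sumr_ge0 // => a _; rewrite exprn_ge0.
Qed.

Lemma asum_term c r M : 0 < r -> (forall N, asum c N r <= M) ->
  forall a, `|c a| * r ^+ mdeg a <= M.
Proof.
move=> r0 HM a; apply: le_trans (HM (mdeg a).+1).
have aN : (mdeg a < (mdeg a).+1)%N by [].
rewrite /asum (bigD1 (BMultinom aN)) //= lerDl sumr_ge0 // => b _.
by rewrite mulr_ge0 // exprn_ge0 // ltW.
Qed.

(** Bounded terms suffice for absolute convergence on a smaller polydisc; this is
    how the germs below are constructed from their coefficients. *)
Lemma expansion_of_bounded c r M : 0 < r -> (forall a, `|c a| * r ^+ mdeg a <= M) ->
  exists f s, has_expansion f c s.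
Proof.
move=> r0 HM; pose s : C := (2 * m.+1%:R)^-1.
have s0 : 0 < s by rewrite invr_gt0 mulr_gt0 // ltr0n.
have [||f Hf] := @expansion_exists R m c (r * s) (M * 2).
- by rewrite mulr_gt0.
- move=> N; apply: (@le_trans _ _ (\sum_(a : bmultinom m N) M * s ^+ mdeg a)).
    apply: ler_sum => a _; rewrite exprMn mulrA ler_wpM2r // exprn_ge0 // ltW //.
  rewrite -mulr_sumr ler_wpM2l ?geo_bsum //; last first.
  + rewrite /s invfM mulrC -mulrA ler_piMr ?invr_ge0 //.
    by rewrite mulrC ler_pdivrMr ?ltr0n // mul1r ler_nat.
  + exact: ltW.
  by apply: le_trans (HM mnm0); rewrite mulr_ge0 // exprn_ge0 // ltW.
- by exists f, (r * s).
Qed.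

Lemma near_ball (r : C) (P : 'rV[C]_m -> Prop) : 0 < r ->
  (forall x, `|x| < r -> P x) -> \forall x \near (0 : 'rV[C]_m), P x.
Proof.
move=> r0 HP; apply/nbhs_normP; exists r => // x /=.
by rewrite /ball_ /= sub0r normrN; exact: HP.
Qed.

Lemma near_ball_ex (P : 'rV[C]_m -> Prop) : (\forall x \near (0 : 'rV[C]_m), P x) ->
  exists r, 0 < r /\ forall x, `|x| < r -> P x.
Proof.
move/nbhs_normP => [r /= r0 H]; exists r; split=> // x xr; apply: H.
by rewrite /ball_ /= sub0r normrN.
Qed.

Lemma mono_at0 a : mono (0 : 'rV[C]_m) a = (a == mnm0)%:R.
Proof.
case: (eqVneq a mnm0) => [->|a0]; first exact: mono0.
have [i ai] := mnm_neq0 a0.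
by rewrite /mono (bigD1 i) //= mxE expr0n (negbTE ai) mul0r.
Qed.

Lemma expansion_at0 f c r : has_expansion f c r -> f 0 = c mnm0.
Proof.
move=> [r0 _ Hf].
have := Hf 0; rewrite normr0 => /(_ r0) H.
apply/esym; suff: psum c N 0 @[N --> \oo] --> c mnm0.
  by move=> H'; apply: (cvg_unique _ H' H); exact: norm_hausdorff.
apply: cvg_near_cst; exists 1%N => // N /= N0.
have z : (mdeg (mnm0 : multinom m) < N)%N by rewrite mdeg0.
rewrite /psum (bigD1 (BMultinom z)) //= mono_at0 eqxx mulr1 big1 ?addr0 // => a.
by rewrite bmeqP /= => /negbTE az; rewrite mono_at0 az mulr0.
Qed.

(** The Taylor coefficients are the iterated derivatives at the origin, up to
    factorials, so a function with zero germ has zero coefficients. *)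
Lemma expansion_eq0 f c r : has_expansion f c r ->
  (\forall x \near (0 : 'rV[C]_m), f x = 0) -> forall a, c a = 0.
Proof.
move=> fc f0 a; move Ea : (mdeg a) => k.
elim: k a f c r fc f0 Ea => [|k IH] a f c r fc f0 Ea.
  move/eqP: Ea; rewrite mdeg_eq0 => /eqP ->.
  by rewrite -(expansion_at0 fc); exact: (nbhs_singleton f0).
have [|i ai] := @mnm_neq0 m a; first by apply: contra_eq_neq Ea => ->; rewrite mdeg0.
rewrite -lt0n in ai.
have [_ dc] := expansionD i fc.
have d0 : \forall x \near (0 : 'rV[C]_m), ('D_(evec R i) f) x = 0.
  have := near_join f0; apply: filterS => x fx.
  transitivity (('D_(evec R i) (cst (0 : C))) x); last by rewrite derive_cst.
  exact: near_eq_derive.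
have dk : mdeg (mnm_sub a (mnm1 i)) = k by apply/eqP; rewrite -eqSS -mdeg_sub1 // Ea.
have := IH _ _ _ _ dc d0 dk; rewrite /dcoef mnm_sub1K // => /eqP.
by rewrite mulf_eq0 pnatr_eq0 => /eqP.
Qed.

End Coefficients.

(** * Taylor coefficients of germs *)

Section GermEval.
Variables (R : realType) (m : nat).
Local Notation C := R[i].
Local Notation A := (germ R m).
Local Notation pi := (\pi_(germ R m)).
Implicit Types (c d : multinom m -> C) (g h : A).

Definition gev g : 'rV[C]_m -> C := repr g.

Lemma gev_exp_ex g : exists c, exists r, has_expansion (gev g) c r.
Proof. by have [c [r H]] := holP (repr g); exists c, r. Qed.

End GermEval.

(** Locked, so that unification never compares two germs through their
    representatives. *)
HB.lock Definition gcoef (R : realType) (m : nat) (g : germ R m) : multinom m -> R[i] :=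
  projT1 (cid (gev_exp_ex g)).

Section GermCoef.
Variables (R : realType) (m : nat).
Local Notation C := R[i].
Local Notation A := (germ R m).
Local Notation pi := (\pi_(germ R m)).
Implicit Types (c d : multinom m -> C) (g h : A).

Lemma gcoef_exp g : exists r, has_expansion (gev g) (gcoef g) r.
Proof. by rewrite gcoef.unlock; exact: (projT2 (cid (gev_exp_ex g))). Qed.

Lemma gevK g : pi (repr g) = g. Proof. by rewrite reprK. Qed.

Lemma gev_pi (f : hol R m) : \forall x \near (0 : 'rV[C]_m), gev (pi f) x = f x.
Proof. by apply/eq_germ; rewrite reprK. Qed.

Lemma gev_eq g (f : hol R m) : g = pi f -> \forall x \near (0 : 'rV[C]_m), gev g x = f x.
Proof. by move=> ->; exact: gev_pi. Qed.

Lemma expansion_uniq f f' c c' r r' : has_expansion f c r -> has_expansion f' c' r' ->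
  (\forall x \near (0 : 'rV[C]_m), f x = f' x) -> c =1 c'.
Proof.
move=> fc fc' ff' a.
have [t [t0 tr ts]] := common_radius (let: And3 r0 _ _ := fc in r0) (let: And3 r0 _ _ := fc' in r0).
have H := expansionB (expansion_shrink t0 tr fc) (expansion_shrink t0 ts fc').
apply/eqP; rewrite -subr_eq0; apply/eqP; apply: (expansion_eq0 H _ a).
by apply: filterS ff' => x E; rewrite -[LHS]/(f x - f' x) E subrr.
Qed.

Lemma gcoefE (f : hol R m) c r : has_expansion f c r -> gcoef (pi f) =1 c.
Proof.
move=> fc; have [s H] := gcoef_exp (pi f).
exact: expansion_uniq H fc (gev_pi f).
Qed.

Lemma gcoef_inj g h : gcoef g =1 gcoef h -> g = h.
Proof.
move=> gh; have [r H] := gcoef_exp g; have [s H'] := gcoef_exp h.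
rewrite -(gevK g) -(gevK h); apply/eq_germ.
have [t [t0 tr ts]] := common_radius (let: And3 r0 _ _ := H in r0) (let: And3 r0 _ _ := H' in r0).
have [_ _ Hg] := expansion_shrink t0 tr H; have [_ _ Hh] := expansion_shrink t0 ts H'.
apply: (near_ball t0) => x xt.
have E : (fun N => psum (gcoef g) N x) = (fun N => psum (gcoef h) N x).
  by apply/funext => N; apply: eq_bigr => a _; rewrite gh.
have := Hg x xt; rewrite E => {}Hg.
by apply: (cvg_unique _ Hg (Hh x xt)); exact: norm_hausdorff.
Qed.

Lemma germ_of_coef c r M : 0 < r -> (forall a, `|c a| * r ^+ mdeg a <= M) ->
  exists g, gcoef g =1 c.
Proof.
move=> r0 /(expansion_of_bounded r0)[f [s H]].
have fa : analytic0 f by exists c, s.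
by exists (germ_of fa); exact: (gcoefE (f := mkhol fa) H).
Qed.

Lemma gcoef_asum g : exists r M, 0 < r /\ forall N, asum (gcoef g) N r <= M.
Proof. by have [r [r0 [M HM] _]] := gcoef_exp g; exists r, M. Qed.

Lemma piB (f g : hol R m) : pi (f - g) = pi f - pi g.
Proof. exact: rmorphB. Qed.
Lemma piM (f g : hol R m) : pi (f * g) = pi f * pi g.
Proof. exact: rmorphM. Qed.
Lemma piD (f g : hol R m) : pi (f + g) = pi f + pi g.
Proof. exact: rmorphD. Qed.

Lemma gevB g h : \forall x \near (0 : 'rV[C]_m), gev (g - h) x = gev g x - gev h x.
Proof. by have := @gev_eq (g - h) (repr g - repr h); apply; rewrite piB !gevK. Qed.
Lemma gevD g h : \forall x \near (0 : 'rV[C]_m), gev (g + h) x = gev g x + gev h x.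
Proof. by have := @gev_eq (g + h) (repr g + repr h); apply; rewrite piD !gevK. Qed.
Lemma gevM g h : \forall x \near (0 : 'rV[C]_m), gev (g * h) x = gev g x * gev h x.
Proof. by have := @gev_eq (g * h) (repr g * repr h); apply; rewrite piM !gevK. Qed.

Lemma gcoefB g h a : gcoef (g - h) a = gcoef g a - gcoef h a.
Proof.
have [r H] := gcoef_exp g; have [s H'] := gcoef_exp h.
have [t [t0 tr ts]] := common_radius (let: And3 r0 _ _ := H in r0) (let: And3 r0 _ _ := H' in r0).
rewrite -{1}(gevK g) -{1}(gevK h) -piB.
exact: (@gcoefE (repr g - repr h) _ _ (expansionB (expansion_shrink t0 tr H) (expansion_shrink t0 ts H')) a).
Qed.

Lemma gcoefM g h a : gcoef (g * h) a = conv (gcoef g) (gcoef h) a.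
Proof.
have [r H] := gcoef_exp g; have [s H'] := gcoef_exp h.
have [t [t0 tr ts]] := common_radius (let: And3 r0 _ _ := H in r0) (let: And3 r0 _ _ := H' in r0).
rewrite -{1}(gevK g) -{1}(gevK h) -piM.
exact: (@gcoefE (repr g * repr h) _ _ (expansionM (expansion_shrink t0 tr H) (expansion_shrink t0 ts H')) a).
Qed.

Lemma gcoef0 a : gcoef (0 : A) a = 0.
Proof. by have := gcoefB (0 : A) 0 a; rewrite !subrr. Qed.
Lemma gcoefN g a : gcoef (- g) a = - gcoef g a.
Proof. by rewrite -sub0r gcoefB gcoef0 sub0r. Qed.
Lemma gcoefD g h a : gcoef (g + h) a = gcoef g a + gcoef h a.
Proof. by rewrite -{1}(opprK h) gcoefB gcoefN opprK. Qed.
Lemma gcoef_sum (I : Type) (s : seq I) (P : pred I) (F : I -> A) a :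
  gcoef (\sum_(i <- s | P i) F i) a = \sum_(i <- s | P i) gcoef (F i) a.
Proof. by apply: (big_morph (fun g => gcoef g a)) => [x y|]; rewrite ?gcoefD ?gcoef0. Qed.

Lemma gcoef_germ_of (f : 'rV[C]_m -> C) (fP : analytic0 f) c r :
  has_expansion f c r -> gcoef (germ_of fP) =1 c.
Proof. exact: (gcoefE (f := mkhol fP)). Qed.

Lemma gcoef_cst (k : C) a : gcoef (germ_cst m k) a = k * (a == mnm0)%:R.
Proof.
apply: (@gcoef_germ_of _ _ (fun a => k * (a == mnm0)%:R) 1).
rewrite (_ : (fun _ => k) = (fun x : 'rV[C]_m => k * mono x mnm0)); first exact: expansion_mono.
by apply/funext => x; rewrite mono0 mulr1.
Qed.

Lemma germ_cst1 : germ_cst m (1 : C) = 1 :> A.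
Proof.
have -> : 1 = pi 1 :> A by rewrite [RHS]rmorph1.
by apply/eq_germ; near=> x.
Unshelve. all: by end_near. Qed.

Lemma gcoef1 a : gcoef (1 : A) a = (a == mnm0)%:R.
Proof. by rewrite -germ_cst1 gcoef_cst mul1r. Qed.

Lemma gcoef_coord (i : 'I_m) a : gcoef (germ_coord R i) a = (a == mnm1 i)%:R.
Proof.
rewrite (@gcoef_germ_of _ _ (fun a => 1 * (a == mnm1 i)%:R) 1) ?mul1r //.
rewrite (_ : (fun x => _) = (fun x : 'rV[C]_m => 1 * mono x (mnm1 i))); first exact: expansion_mono.
by apply/funext => x; rewrite mono1 mul1r.
Qed.

Lemma gcoef_der (i : 'I_m) g a : gcoef (germ_der i g) a = (a i).+1%:R * gcoef g (mnm_add a (mnm1 i)).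
Proof.
have [r H] := gcoef_exp g; have [_ H'] := expansionD i H.
exact: (gcoef_germ_of _ H' a).
Qed.

Definition mle (a b : multinom m) := [forall i, a i <= b i]%N.

Lemma mleP (a b : multinom m) : reflect (forall i, a i <= b i)%N (mle a b).
Proof. exact: (iffP forallP). Qed.

Lemma mle_subK (a b : multinom m) : mle a b -> mnm_add a (mnm_sub b a) = b.
Proof. by move=> /mleP ab; apply/mnmP => i; rewrite mnmDE mnmBE subnKC. Qed.

Lemma mle_addr (a b : multinom m) : mle a (mnm_add a b).
Proof. by apply/mleP => i; rewrite mnmDE leq_addr. Qed.

Lemma mle_mdeg (a b : multinom m) : mle a b -> (mdeg a <= mdeg b)%N.
Proof. by move=> /mle_subK <-; rewrite mdegD leq_addr. Qed.

Lemma mnmDC (a b : multinom m) : mnm_add a b = mnm_add b a.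
Proof. exact: addmC. Qed.

Lemma conv1E c d e N : (mdeg e < N)%N ->
  conv c d e = \sum_(a : bmultinom m N | mle a e) c a * d (mnm_sub e a).
Proof.
move=> eN; rewrite (convE _ _ eN) (bigID (fun a : bmultinom m N => mle a e)) /= addrC big1 ?add0r.
  apply: eq_bigr => a ae.
  have bN : (mdeg (mnm_sub e a) < N)%N by apply: leq_ltn_trans eN; exact: mdegB.
  rewrite (bigD1 (BMultinom bN)) /=; last by rewrite mle_subK.
  rewrite big1 ?addr0 // => b /andP[/eqP eE]; rewrite bmeqP /= => /negP[].
  by rewrite eE; apply/eqP/mnmP => i; rewrite mnmBE mnmDE addKn.
move=> a ae; rewrite big1 // => b /eqP eE.
by case/negP: ae; rewrite eE mle_addr.
Qed.

Lemma convC c d : conv c d =1 conv d c.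
Proof.
move=> e; rewrite !(convE _ _ (leqnn _)) (exchange_big_dep xpredT) //=; apply: eq_bigr => b _.
by apply: eq_big => [a|a _]; [rewrite mnmDC|rewrite mulrC].
Qed.

Lemma conv_mono k (u : multinom m) d e :
  conv (fun a => k * (a == u)%:R) d e = if mle u e then k * d (mnm_sub e u) else 0.
Proof.
rewrite (conv1E _ _ (leqnn _)); case: ifPn => ue.
  have uN : (mdeg u < (mdeg e).+1)%N by rewrite ltnS mle_mdeg.
  rewrite (bigD1 (BMultinom uN)) //= eqxx mulr1 big1 ?addr0 // => a /andP[_].
  by rewrite bmeqP /= => /negbTE ->; rewrite mulr0 mul0r.
rewrite big1 // => a ae; case: eqP => [E|]; last by rewrite mulr0 mul0r.
by rewrite -E ae in ue.
Qed.

Lemma gcoef_cstM (k : C) g a : gcoef (germ_cst m k * g) a = k * gcoef g a.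
Proof.
rewrite gcoefM (_ : gcoef (germ_cst m k) = fun a => k * (a == mnm0)%:R); last first.
  by apply/funext => b; rewrite gcoef_cst.
rewrite conv_mono ifT; last by apply/mleP => i; rewrite mnm0E.
by congr (_ * gcoef g _); apply/mnmP => i; rewrite mnmBE mnm0E subn0.
Qed.

Lemma gcoef_coordM (i : 'I_m) g a : gcoef (germ_coord R i * g) a =
  if (0 < a i)%N then gcoef g (mnm_sub a (mnm1 i)) else 0.
Proof.
rewrite gcoefM (_ : gcoef (germ_coord R i) = fun a => 1 * (a == mnm1 i)%:R); last first.
  by apply/funext => b; rewrite gcoef_coord mul1r.
rewrite conv_mono mul1r (_ : mle _ _ = (0 < a i)%N) //.
apply/mleP/idP => [/(_ i)|ai j]; rewrite mnm1E ?eqxx //.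
by case: eqP => // <-.
Qed.

Lemma gcoefM0 g h : gcoef (g * h) mnm0 = gcoef g mnm0 * gcoef h mnm0.
Proof.
rewrite gcoefM (conv1E _ _ (leqnn _)).
have z : (mdeg (mnm0 : multinom m) < (mdeg (mnm0 : multinom m)).+1)%N by [].
rewrite (bigD1 (BMultinom z)) /=; last by apply/mleP.
rewrite big1 ?addr0; first by congr (_ * gcoef h _); apply/mnmP => i; rewrite mnmBE !mnm0E.
move=> a /andP[/mleP a0]; rewrite bmeqP /= => /eqP[].
by apply/mnmP => i; have := a0 i; rewrite mnm0E leqn0 => /eqP.
Qed.

Lemma germ_der_is_derivation i : derivation (@germ_der R m i).
Proof.
have ders (f : hol R m) : \forall x \near (0 : 'rV[C]_m), derivable f x (evec R i).
  have [c [r H]] := holP f; have [D _] := expansionD i H.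
  by apply: (near_ball _ D); rewrite divr_gt0 //; case: H.
have key (f g k : hol R m) : (\forall x \near (0 : 'rV[C]_m),
    'D_(evec R i) f x = 'D_(evec R i) g x + k x) ->
    germ_der i (pi f) = germ_der i (pi g) + pi k.
  by move=> H; rewrite !germ_derE /germ_of -piD; apply/eq_germ.
split.
- by move=> f g; apply: gcoef_inj => a; rewrite !(gcoefD, gcoef_der) mulrDr.
- by move=> k f; apply: gcoef_inj => a; rewrite !(gcoef_cstM, gcoef_der) mulrCA.
- move=> f g; rewrite -(gevK f) -(gevK g) -piM !germ_derE /germ_of -!piM -piD; apply/eq_germ.
  have := ders (repr g); have := ders (repr f).
  apply: filterS2 => x df dg.
  have sw (a b a' b' : C) : a * b + a' * b' = b' * a' + a * b.
    by rewrite addrC (mulrC a').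
  exact: etrans (deriveM df dg) (sw _ _ _ _).
Qed.

End GermCoef.

(** * Division by a germ with an initial monomial *)

Section Weights.
Variables (m : nat).
Implicit Types (a b : multinom m) (l : 'I_m -> nat).

Definition wt l a := (\sum_i l i * a i)%N.

Lemma wtD l a b : wt l (mnm_add a b) = (wt l a + wt l b)%N.
Proof. by rewrite -big_split; apply: eq_bigr => i _; rewrite mnmDE mulnDr. Qed.

Lemma mdeg_le_wt l a : (forall i, 0 < l i)%N -> (mdeg a <= wt l a)%N.
Proof. by move=> l0; rewrite mdegE; apply: leq_sum => i _; rewrite leq_pmull. Qed.

Lemma wt_le_mdeg l a : (wt l a <= (\sum_i l i) * mdeg a)%N.
Proof.
rewrite big_distrl; apply: leq_sum => i _; rewrite leq_mul2l mdegE (bigD1 i) //=.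
by rewrite leq_addr orbT.
Qed.

Lemma radix_inj k B (u v : nat -> nat) : (forall i, u i < B)%N -> (forall i, v i < B)%N ->
  (\sum_(i < k) u i * B ^ i = \sum_(i < k) v i * B ^ i)%N -> forall i, (i < k)%N -> u i = v i.
Proof.
elim: k u v => // k IH u v uB vB; rewrite !big_ord_recl !expn0 !muln1.
have E (w : nat -> nat) : (\sum_(i < k) w (bump 0 i) * B ^ bump 0 i = (\sum_(i < k) w i.+1 * B ^ i) * B)%N.
  by rewrite big_distrl; apply: eq_bigr => i _; rewrite /= /bump add1n expnSr mulnA.
rewrite !E => H.
have H0 : u 0%N = v 0%N.
  by have := congr1 (modn^~ B) H; rewrite (addnC (u 0%N)) (addnC (v 0%N)) !modnMDl !modn_small.
have B0 : (0 < B)%N by apply: leq_ltn_trans (uB 0%N).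
have HS : (\sum_(i < k) u i.+1 * B ^ i = \sum_(i < k) v i.+1 * B ^ i)%N.
  by apply/eqP; rewrite -(eqn_pmul2r B0) -(eqn_add2l (u 0%N)); apply/eqP; rewrite H H0.
by case=> [|i] // ik; exact: (IH _ _ (fun i => uB i.+1) (fun i => vB i.+1) HS).
Qed.

End Weights.

Section Division.
Variables (R : realType) (m : nat).
Local Notation C := R[i].
Local Notation A := (germ R m).
Implicit Types (c f q : multinom m -> C) (a b e : multinom m) (l : 'I_m -> nat).

(** For the weights [l], the monomial [e] is the only one of least weight in [f]. *)
Definition initial f l e := [/\ forall i, (0 < l i)%N, f e != 0 &
  forall a, a != e -> f a != 0 -> (wt l e < wt l a)%N].

(** The lowest-weight coefficient of [q * f] at the product of the initial
    monomials is a product of nonzero numbers. *)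
Lemma conv_initial f l e q b : initial f l e -> q b != 0 ->
  exists b', conv f q (mnm_add e b') != 0.
Proof.
move=> [_ fe fmin] qb.
have exw : exists n, `[< exists b, q b != 0 /\ wt l b = n >].
  by exists (wt l b); apply/asboolP; exists b.
have [n /asboolP[b0 [qb0 bn]] nmin] := ex_minnP exw.
exists b0; rewrite (conv1E _ _ (leqnn _)).
have eN : (mdeg e < (mdeg (mnm_add e b0)).+1)%N by rewrite ltnS mle_mdeg ?mle_addr.
rewrite (bigD1 (BMultinom eN)) /=; last exact: mle_addr.
have -> : mnm_sub (mnm_add e b0) e = b0 by rewrite mnmDC; exact: addmK.
rewrite big1 ?addr0 ?mulf_neq0 // => a /andP[ae]; rewrite bmeqP /= => aNe.
case: (eqVneq (f a) 0) => [->|fa]; first by rewrite mul0r.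
have := fmin _ aNe fa; have := congr1 (wt l) (mle_subK ae); rewrite !wtD bn => E lt.
case: (eqVneq (q (mnm_sub (mnm_add e b0) a)) 0) => [->|qa]; first by rewrite mulr0.
have : (n <= wt l (mnm_sub (mnm_add e b0) a))%N.
  by apply: nmin; apply/asboolP; eexists; split; [exact: qa|].
lia.
Qed.

Section Quotient.
Variables (f c : multinom m -> C) (l : 'I_m -> nat) (e : multinom m).
Hypothesis fi : initial f l e.

(** Comparing the coefficients of the monomials divisible by [e] in
    [c = quot * f + r] gives this recursion: the terms with [a != e] involve [quot]
    at smaller weight only, and [n] bounds the weight. *)
Fixpoint quot_rec (n : nat) (b : multinom m) : C :=
  if n isn't n'.+1 then 0 else
  (c (mnm_add e b) -
   \sum_(a : bmultinom m (mdeg (mnm_add e b)).+1 |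
      [&& mle a (mnm_add e b), (a : multinom m) != e & f a != 0])
      f a * quot_rec n' (mnm_sub (mnm_add e b) a)) / f e.

Definition quot b := quot_rec (wt l b).+1 b.

Lemma quot_wt a b : mle a (mnm_add e b) -> a != e -> f a != 0 ->
  (wt l (mnm_sub (mnm_add e b) a) < wt l b)%N.
Proof.
move=> ae aNe fa; have [_ _ /(_ _ aNe fa)] := fi.
have := congr1 (wt l) (mle_subK ae); rewrite !wtD; lia.
Qed.

Lemma quot_recE n b : (wt l b < n)%N -> quot_rec n b = quot b.
Proof.
have key k : (wt l b < n)%N -> (wt l b < k)%N -> quot_rec n b = quot_rec k b.
  elim: n b k => // n IH b [//|k] bn bk /=; congr ((_ - _) / _).
  apply: eq_bigr => a /and3P[ae aNe fa]; have H := quot_wt ae aNe fa.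
  by rewrite (IH _ k) //; lia.
by move=> bn; exact: key.
Qed.

Lemma quotE b : quot b = (c (mnm_add e b) -
   \sum_(a : bmultinom m (mdeg (mnm_add e b)).+1 |
      [&& mle a (mnm_add e b), (a : multinom m) != e & f a != 0])
      f a * quot (mnm_sub (mnm_add e b) a)) / f e.
Proof.
rewrite {1}/quot /=; congr ((_ - _) / _).
apply: eq_bigr => a /and3P[ae aNe fa]; have H := quot_wt ae aNe fa.
by rewrite quot_recE.
Qed.

Lemma conv_quot b : conv f quot (mnm_add e b) = c (mnm_add e b).
Proof.
have [_ fe _] := fi.
rewrite (conv1E _ _ (leqnn _)).
have eN : (mdeg e < (mdeg (mnm_add e b)).+1)%N by rewrite ltnS mle_mdeg ?mle_addr.
rewrite (bigD1 (BMultinom eN)) /=; last exact: mle_addr.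
have -> : mnm_sub (mnm_add e b) e = b by rewrite mnmDC; exact: addmK.
rewrite [in f e * _]quotE mulrC divfK // -addrA -[RHS]addr0; congr (_ + _).
apply/eqP; rewrite addrC subr_eq0; apply/eqP.
rewrite (bigID (fun a : bmultinom m _ => f a != 0)) /= addrC big1 ?add0r.
  by apply: eq_bigl => a; rewrite bmeqP /= andbA.
by move=> a /andP[_]; rewrite negbK => /eqP ->; rewrite mul0r.
Qed.

(** In the norm weighted by [s], the tail of [f] beyond its initial monomial is at
    most half of that monomial. So, up to division by the size of that monomial, the
    recursion at most doubles the bound [M]. *)
Lemma quot_bound s M : 0 < s -> 
  (forall N, \sum_(a : bmultinom m N | ((a : multinom m) != e) && (f a != 0)) `|f a| * s ^+ wt l a
      <= `|f e| * s ^+ wt l e / 2) ->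
  (forall a, `|c a| * s ^+ wt l a <= M) ->
  forall b, `|quot b| * s ^+ wt l b <= M * 2 / (`|f e| * s ^+ wt l e).
Proof.
move=> s0 fs cM b; have [_ fe _] := fi.
set D := `|f e| * _ in fs *; set M' := M * 2 / D.
have D0 : 0 < D by rewrite mulr_gt0 ?normr_gt0 ?exprn_gt0.
have M0 : 0 <= M by apply: le_trans (cM mnm0); rewrite mulr_ge0 // exprn_ge0 // ltW.
have M'0 : 0 <= M' by exact: divr_ge0 (mulr_ge0 M0 (ler0n _ 2)) (ltW D0).
have M'D : M' * D = M * 2 by rewrite /M' divfK ?gt_eqF.
clearbody M'.
have [n bn] := ubnP (wt l b); elim: n b bn => // n IH b bn.
rewrite -(ler_pM2r D0) M'D.
have -> : `|quot b| * s ^+ wt l b * D = `|quot b * f e| * s ^+ wt l (mnm_add e b).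
  by rewrite wtD exprD (normrM (quot b)) /D mulrACA (mulrC (s ^+ wt l b)).
rewrite quotE divfK //.
apply: (@le_trans _ _ (M + M' * (D / 2))); last first.
  by rewrite mulrA M'D mulfK ?pnatr_eq0 // mulr_natr mulr2n.
apply: le_trans (ler_wpM2r _ (ler_normB _ _)) _; first by rewrite exprn_ge0 // ltW.
rewrite mulrDl lerD //.
apply: le_trans (ler_wpM2r _ (ler_norm_sum _ _ _)) _; first by rewrite exprn_ge0 // ltW.
apply: (@le_trans _ _ (\sum_(a : bmultinom m (mdeg (mnm_add e b)).+1 |
   ((a : multinom m) != e) && (f a != 0)) M' * (`|f a| * s ^+ wt l a))); last first.
  by rewrite -mulr_sumr ler_wpM2l.
rewrite mulr_suml [leRHS]big_mkcond [leLHS]big_mkcond /=; apply: ler_sum => a _.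
case: ifPn => [/and3P[ae aNe fa]|_]; last first.
  by case: ifP => // _; rewrite (mulr_ge0 M'0) // mulr_ge0 // exprn_ge0 // ltW.
have wE : wt l (mnm_add e b) = (wt l a + wt l (mnm_sub (mnm_add e b) a))%N.
  by rewrite -wtD mle_subK.
rewrite aNe fa wE exprD (normrM (f a)) mulrACA mulrC ler_wpM2r //.
  by rewrite mulr_ge0 // exprn_ge0 // ltW.
by apply: IH; have := quot_wt ae aNe fa; lia.
Qed.

End Quotient.

(** Grauert's division theorem for one divisor. For the weights
    [(d + 1, .., d + 1, 1)] and the initial monomial [t ^ d] it is the Weierstrass
    division theorem. *)
Theorem germ_division (f c : A) l e : initial (gcoef f) l e ->
  exists q r : A, c = q * f + r /\ forall a, mle e a -> gcoef r a = 0.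
Proof.
move=> fi; have [l0 fe fmin] := fi.
have [rf Hf] := gcoef_exp f; have [rc Hc] := gcoef_exp c.
have [t1 [t10 t1f t1c]] := common_radius (let: And3 r0 _ _ := Hf in r0) (let: And3 r0 _ _ := Hc in r0).
have [t [t0 tt1 tle1]] := common_radius t10 (ltr01 : (0 : C) < 1).
have [_ [M HM] _] := expansion_shrink t0 (le_trans tt1 t1f) Hf.
have [_ [M0 HM0] _] := expansion_shrink t0 (le_trans tt1 t1c) Hc.
pose D := `|gcoef f e| * t ^+ wt l e.
have D0 : 0 < D by rewrite mulr_gt0 ?normr_gt0 ?exprn_gt0.
have tge0 := ltW t0.
have DM : D <= M.
  apply: le_trans (asum_term t0 HM e); rewrite ler_wpM2l //.
  exact: ler_wiXn2l (mdeg_le_wt _ l0).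
have M_gt0 : 0 < M by apply: lt_le_trans DM.
(* Scaling the radius by [u] gains one factor [u] on each monomial beyond the
   initial one, which brings the tail below half of the initial term. *)
pose u := D / (2 * M).
have u0 : 0 < u by rewrite divr_gt0 // mulr_gt0.
have u1 : u <= 1.
  rewrite ler_pdivrMr ?mulr_gt0 // mul1r (le_trans DM) // ler_peMl ?ltW //.
  by rewrite ltr1n.
pose s := u * t.
have s0 : 0 < s by rewrite mulr_gt0.
have st : s <= t by rewrite ler_piMl // ltW.
have fs N : \sum_(a : bmultinom m N | ((a : multinom m) != e) && (gcoef f a != 0))
    `|gcoef f a| * s ^+ wt l a <= `|gcoef f e| * s ^+ wt l e / 2.
  have -> : `|gcoef f e| * s ^+ wt l e / 2 = u ^+ (wt l e).+1 * M.
    have uM : u * M = D / 2.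
      by rewrite /u invfM mulrA divfK // gt_eqF.
    by rewrite exprSr -(mulrA _ u M) uM /s exprMn /D mulrCA !mulrA.
  apply: le_trans (ler_wpM2l _ (HM N)); last by rewrite exprn_ge0 // ltW.
  rewrite mulr_sumr big_mkcond; apply: ler_sum => a _; case: ifPn => [/andP[ae fa]|_]; last first.
    by rewrite !mulr_ge0 ?exprn_ge0 // ltW.
  rewrite mulrCA ler_wpM2l // exprMn ler_pM ?exprn_ge0 ?(ltW u0) ?(ltW t0) //.
    by apply: ler_wiXn2l; rewrite ?fmin // ltW.
  exact: ler_wiXn2l (mdeg_le_wt _ l0).
have cM a : `|gcoef c a| * s ^+ wt l a <= M0.
  apply: le_trans (asum_term t0 HM0 a); rewrite ler_wpM2l //.
  apply: (@le_trans _ _ (t ^+ wt l a)).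
    by rewrite lerXn2r ?nnegrE // ltW.
  exact: ler_wiXn2l (mdeg_le_wt _ l0).
have qb := quot_bound fi s0 fs cM.
have [|b|q Hq] := @germ_of_coef R m (quot (gcoef f) (gcoef c) l e) (s ^+ (\sum_i l i)%N)
   (M0 * 2 / (`|gcoef f e| * s ^+ wt l e)).
- by rewrite exprn_gt0.
- apply: le_trans (qb b); rewrite ler_wpM2l // -exprM.
  by apply: ler_wiXn2l (wt_le_mdeg _ _); [exact: ltW|exact: le_trans st tle1].
exists q, (c - q * f); split; first by rewrite addrC subrK.
move=> a /mle_subK <-; rewrite gcoefB gcoefM convC (_ : gcoef q = quot (gcoef f) (gcoef c) l e); last exact/funext.
by rewrite conv_quot // subrr.
Qed.

Theorem germ_division_uniq (f q : A) l e : initial (gcoef f) l e ->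
  (forall a, mle e a -> gcoef (q * f) a = 0) -> q = 0.
Proof.
move=> fi H; apply: gcoef_inj => b; rewrite gcoef0; apply/eqP/negPn/negP => qb.
have [b' /negP[]] := conv_initial fi qb.
by rewrite -gcoefM mulrC H ?mle_addr.
Qed.

(** Weights [L + B ^ i], with [L] large and [B] above the order of [f], select the
    monomials of least degree and then separate them by their base [B] digits. *)
Lemma initial_exists (f : A) : f != 0 -> exists l e, initial (gcoef f) l e.
Proof.
move=> f0.
have [a0 fa0] : exists a, gcoef f a != 0.
  apply: contrapT => H; case/eqP: f0; apply: gcoef_inj => a; rewrite gcoef0.
  by apply/eqP/negPn/negP => fa; apply: H; exists a.
pose g := gcoef f.
have exd : exists n, `[< exists b, g b != 0 /\ mdeg b = n >].
  by exists (mdeg a0); apply/asboolP; exists a0.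
have [N /asboolP[{}a0 [{}fa0 aN]] Nmin] := ex_minnP exd.
have {}Nmin a : g a != 0 -> (N <= mdeg a)%N.
  by move=> ga; apply: Nmin; apply/asboolP; exists a.
pose T := (\sum_(i < m) N.+1 ^ i)%N; pose L := (N * T).+1.
pose l (i : 'I_m) := (L + N.+1 ^ i)%N.
have wE a : wt l a = (L * mdeg a + \sum_(i < m) a i * N.+1 ^ i)%N.
  rewrite mdegE big_distrr -big_split; apply: eq_bigr => i _ /=.
  by rewrite mulnDl (mulnC (N.+1 ^ i)%N).
have exw : exists n, `[< exists b, g b != 0 /\ wt l b = n >].
  by exists (wt l a0); apply/asboolP; exists a0.
have [n /asboolP[e [ge en]] nmin] := ex_minnP exw.
have {}nmin a : g a != 0 -> (n <= wt l a)%N.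
  by move=> ga; apply: nmin; apply/asboolP; exists a.
exists l, e; split=> [i||a ane ga]; [by rewrite addn_gt0|by []|].
rewrite ltn_neqAle en nmin // andbT; apply: contraNN ane => /eqP na.
have small b : mdeg b = N -> (\sum_(i < m) b i * N.+1 ^ i <= N * T)%N.
  move=> bN; rewrite big_distrr; apply: leq_sum => i _; rewrite leq_mul2r -bN mdegE (bigD1 i) //=.
  by rewrite leq_addr orbT.
have nle : (n <= L * N + N * T)%N.
  by apply: leq_trans (nmin _ fa0) _; rewrite wE aN leq_add2l small.
have deg b : g b != 0 -> wt l b = n -> mdeg b = N.
  move=> gb bn; apply/eqP; rewrite eqn_leq Nmin // andbT -ltnS.
  by have := bn; rewrite wE /L -(ltn_pmul2l (ltn0Sn (N * T))) mulnS; move: nle; rewrite /L; lia.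
have dN b (i : 'I_m) : mdeg b = N -> (b i < N.+1)%N.
  by move=> <-; rewrite ltnS mdegE (bigD1 i) //= leq_addr.
have da := deg _ ga (esym na); have de := deg _ ge en.
pose ex (b : multinom m) (i : nat) := if insub i is Some j then b (j : 'I_m) else 0%N.
have exE b (i : 'I_m) : ex b i = b i by rewrite /ex valK.
have exN b : mdeg b = N -> forall i, (ex b i < N.+1)%N.
  by move=> bN i; rewrite /ex; case: insubP => // j _ _; exact: dN.
apply/eqP/mnmP => i; rewrite -!exE; apply: (radix_inj (exN _ da) (exN _ de) _ (ltn_ord i)).
under eq_bigr do rewrite exE; under [RHS]eq_bigr do rewrite exE.
by move: na; rewrite -en !wE da de => /addnI.
Qed.

Lemma germ_mul_eq0 (f g : A) : f * g = 0 -> (f == 0) || (g == 0).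
Proof.
move=> fg; case: eqVneq => //= f0; apply/eqP.
have [l [e fi]] := initial_exists f0.
by apply: (germ_division_uniq fi) => a _; rewrite mulrC fg gcoef0.
Qed.

Lemma initial_mnm0 (f : A) : gcoef f mnm0 != 0 -> initial (gcoef f) (fun=> 1%N) mnm0.
Proof.
move=> f0; split=> // a a0 _.
have E b : wt (fun=> 1%N) b = mdeg b :> nat.
  by rewrite mdegE; apply: eq_bigr => i _; rewrite mul1n.
by rewrite !E mdeg0 lt0n mdeg_eq0.
Qed.

Lemma germ_inverse (f : A) : gcoef f mnm0 != 0 -> exists q : A, q * f = 1.
Proof.
move=> /initial_mnm0 fi; have [q [r [E Hr]]] := germ_division 1 fi.
exists q; rewrite E (_ : r = 0) ?addr0 //; apply: gcoef_inj => a; rewrite gcoef0 Hr //.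
by apply/mleP => i; rewrite mnm0E.
Qed.

Lemma germ_inverseE (f q : A) : q * f = 1 -> gcoef f mnm0 != 0.
Proof.
move=> qf; apply/negP => /eqP f0; have := congr1 (fun g => gcoef g mnm0) qf.
by rewrite /= gcoefM0 f0 mulr0 gcoef1 eqxx => /eqP; rewrite eq_sym oner_eq0.
Qed.

End Division.

Section UnitRing.
Variables (R : realType) (m : nat).
Local Notation A := (germ R m).

Definition germ_unit : pred A := fun f => gcoef f mnm0 != 0.

Definition germ_inv (f : A) : A :=
  if pselect (exists q, q * f = 1) is left H then projT1 (cid H) else f.

Lemma germ_mulVr : {in germ_unit, left_inverse 1 germ_inv *%R}.
Proof.
move=> f fU; have H := germ_inverse fU; rewrite /germ_inv; case: pselect => // H'.
exact: (projT2 (cid H')).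
Qed.

Lemma germ_unitPl (f q : A) : q * f = 1 -> germ_unit f.
Proof. exact: germ_inverseE. Qed.

Lemma germ_inv_out : {in [predC germ_unit], germ_inv =1 id}.
Proof.
move=> f; rewrite inE => fU; rewrite /germ_inv; case: pselect => // -[q qf].
by case/negP: fU; exact: germ_inverseE qf.
Qed.

HB.instance Definition _ := GRing.ComNzRing_hasMulInverse.Build A
  germ_mulVr germ_unitPl germ_inv_out.
HB.instance Definition _ := GRing.ComUnitRing_isIntegral.Build A (@germ_mul_eq0 R m).

Lemma germ_unitE (f : A) : (f \is a GRing.unit) = (gcoef f mnm0 != 0).
Proof. by []. Qed.

End UnitRing.

(** * Derivations of the ring of germs *)

Section Derivations.
Variables (R : realType) (m : nat).
Local Notation C := R[i].
Local Notation A := (germ R m).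
Implicit Types (D : A -> A).

Lemma derivationB D f g : derivation D -> D (f - g) = D f - D g.
Proof. by move=> [DD _ _]; apply: (addIr (D g)); rewrite -DD !subrK. Qed.

Lemma derivation0 D : derivation D -> D 0 = 0.
Proof. by move=> dD; have := derivationB 0 0 dD; rewrite !subrr. Qed.

Lemma derivation_sum_arg D (I : Type) (s : seq I) (P : pred I) (F : I -> A) : derivation D ->
  D (\sum_(i <- s | P i) F i) = \sum_(i <- s | P i) D (F i).
Proof. by move=> dD; apply: big_morph => [f g|]; [case: dD|exact: derivation0]. Qed.

Lemma derivation_cst D k : derivation D -> D (germ_cst m k) = 0.
Proof.
move=> [_ DC DM]; have D1 : D 1 = 0.
  by apply: (addrI (D 1)); rewrite addr0; have := DM 1 1; rewrite !mulr1 mul1r.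
by rewrite -[germ_cst m k]mulr1 DC D1 mulr0.
Qed.

Lemma derivation_vec (v : 'I_m -> A) : derivation (fun f => \sum_i v i * germ_der i f).
Proof.
split.
- move=> f g; rewrite -big_split; apply: eq_bigr => i _ /=.
  by have [-> _ _] := germ_der_is_derivation R i; rewrite mulrDr.
- move=> k f; rewrite mulr_sumr; apply: eq_bigr => i _.
  by have [_ -> _] := germ_der_is_derivation R i; rewrite mulrCA.
- move=> f g; rewrite mulr_suml mulr_sumr -big_split; apply: eq_bigr => i _ /=.
  by have [_ _ ->] := germ_der_is_derivation R i; rewrite mulrDr mulrA (mulrCA (v i) f).
Qed.

Lemma derivationDl D D' : derivation D -> derivation D' -> derivation (fun f => D f + D' f).
Proof.
move=> [a b c] [a' b' c']; split=> [f g|k f|f g].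
- by rewrite a a' addrACA.
- by rewrite b b' mulrDr.
- by rewrite c c' mulrDl mulrDr addrACA.
Qed.

Lemma derivationZl k D : derivation D -> derivation (fun f => k * D f).
Proof.
move=> [a b c]; split=> [f g|l f|f g].
- by rewrite a mulrDr.
- by rewrite b mulrCA.
- by rewrite c mulrDr mulrA (mulrCA k).
Qed.

(** Euler's identity, applied degree by degree, writes a germ in terms of its
    constant term and the coordinates. *)
Lemma germ_hadamard (f : A) : exists F : 'I_m -> A,
  f = germ_cst m (gcoef f mnm0) + \sum_i germ_coord R i * F i.
Proof.
have [r [M [r0 HM]]] := gcoef_asum f.
have s0 : 0 < r / 2 by rewrite divr_gt0.
have ex (i : 'I_m) : exists g : A, gcoef g =1 (fun b => dcoef i (gcoef f) b / (mdeg b).+1%:R).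
  apply: (germ_of_coef (r := r / 2) (M := M / (r / 2))) => // a.
  apply: le_trans (asum_term s0 (dcoef_asum i r0 HM) a).
  rewrite ler_wpM2r ?exprn_ge0 ?(ltW s0) // normrM ler_piMr //.
  by rewrite normfV normr_nat invf_le1 ?ltr0n // ler1n.
have /choice[F HF] := ex.
exists F; apply: gcoef_inj => a; rewrite gcoefD gcoef_cst gcoef_sum.
case: (eqVneq a mnm0) => [->|a0].
  by rewrite mulr1 big1 ?addr0 // => i _; rewrite gcoef_coordM mnm0E.
rewrite mulr0 add0r; have da : (mdeg a)%:R != 0 :> C by rewrite pnatr_eq0 mdeg_eq0.
transitivity (\sum_i (a i)%:R * gcoef f a / (mdeg a)%:R).
  by rewrite -mulr_suml -mulr_suml -natr_sum -mdegE mulrAC divff // mul1r.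
apply: eq_bigr => i _; rewrite gcoef_coordM; case: ifPn => [ai|]; last first.
  by rewrite -eqn0Ngt => /eqP ->; rewrite !mul0r.
rewrite HF /dcoef mnm_sub1K // mnmBE mnm1E eqxx subn1 prednK //.
by rewrite (mdeg_sub1 ai).
Qed.

Lemma germ_der_coord i j : germ_der i (germ_coord R j) = (i == j)%:R :> A.
Proof.
apply: gcoef_inj => a; rewrite gcoef_der gcoef_coord.
case: (eqVneq i j) => [->|ij]; last first.
  rewrite (_ : (_ == _) = false) ?mulr0 ?gcoef0 //; apply/negbTE/negP => /eqP/mnmP/(_ i).
  by rewrite mnmDE !mnm1E eqxx (eq_sym j) (negbTE ij) addn1.
rewrite gcoef1; case: (eqVneq a mnm0) => [->|a0].
  by rewrite add0m eqxx mulr1 mnm0E.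
by rewrite -[X in _ == X]add0m eqm_add2r (negbTE a0) mulr0.
Qed.

(** A derivation is determined by its values on the coordinates: one vanishing on
    them raises the order of vanishing without bound. *)
Lemma derivation_vecE D : derivation D ->
  forall f, D f = \sum_i D (germ_coord R i) * germ_der i f.
Proof.
move=> dD f; apply/eqP; rewrite -subr_eq0.
pose E := fun f => D f + (- 1) * (\sum_i D (germ_coord R i) * germ_der i f).
have dE : derivation E.
  by apply: derivationDl => //; apply: derivationZl; exact: derivation_vec.
suff -> : D f - \sum_i D (germ_coord R i) * germ_der i f = E f; last by rewrite /E mulN1r.
have E0 i : E (germ_coord R i) = 0.
  apply/eqP; rewrite /E mulN1r subr_eq0 (bigD1 i) //=; apply/eqP.
  by rewrite germ_der_coord eqxx mulr1 big1 ?addr0 // => j ji; rewrite germ_der_coord (negbTE ji) mulr0.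
have ord N : forall g a, (mdeg a < N)%N -> gcoef (E g) a = 0.
  elim: N => // N IH g a aN; have [F ->] := germ_hadamard g.
  have [ED _ EM] := dE; rewrite ED derivation_cst // add0r derivation_sum_arg // gcoef_sum big1 // => i _.
  rewrite EM E0 mul0r add0r gcoef_coordM; case: ifP => // ai; apply: IH.
  by rewrite -ltnS -mdeg_sub1.
by apply/eqP/gcoef_inj => a; rewrite gcoef0; exact: (ord (mdeg a).+1).
Qed.

End Derivations.

(** * Expansion along the second factor *)

Section Product.
Variables (R : realType) (m n : nat).
Local Notation C := R[i].
Local Notation O := (germ R m).
Local Notation P := (germ R (m + n)).
Local Notation pull := (@germ_pull R m n).
Implicit Types (a : multinom m) (b : multinom n) (e : multinom (m + n)) (u v : O) (F G : P).

Lemma gcoef_pull u e : gcoef (pull u) e = ecoef (gcoef u) e.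
Proof.
have [r H] := gcoef_exp u.
by rewrite -{1}(gevK u) germ_pullE (gcoef_germ_of _ (expansion_pull n H)).
Qed.

Lemma germ_pullB : {morph pull : u v / u - v}.
Proof.
move=> u v; rewrite -(gevK u) -(gevK v) -piB !germ_pullE /germ_of -piB.
by apply/eq_germ; near=> x.
Unshelve. all: by end_near. Qed.

Lemma pull_cst k : pull (germ_cst m k) = germ_cst (m + n) k.
Proof.
rewrite [germ_cst m k]/germ_cst [germ_of _]/germ_of germ_pullE; apply/eq_germ.
by near=> x.
Unshelve. all: by end_near. Qed.

Lemma germ_pullM : monoid_morphism pull.
Proof.
split=> [|u v].
  by rewrite -(germ_cst1 R m) pull_cst germ_cst1.
rewrite -(gevK u) -(gevK v) -piM !germ_pullE /germ_of -piM.
by apply/eq_germ; near=> x.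
Unshelve. all: by end_near. Qed.

HB.instance Definition _ := GRing.isZmodMorphism.Build O P pull germ_pullB.
HB.instance Definition _ := GRing.isMonoidMorphism.Build O P pull germ_pullM.

Definition mpair a b : multinom (m + n) :=
  Multinom [tuple (match fintype.split j with inl k => a k | inr k => b k end) | j < m + n].

Lemma mpairl a b j : mpair a b (lshift n j) = a j.
Proof. by rewrite /mpair multinomE tnth_mktuple (unsplitK (inl j)). Qed.

Lemma mpairr a b j : mpair a b (rshift m j) = b j.
Proof. by rewrite /mpair multinomE tnth_mktuple (unsplitK (inr j)). Qed.

Definition mnmrsub (e : multinom (m + n)) : multinom n :=
  Multinom [tuple e (rshift m j) | j < n].

Lemma mnmlsubE e j : mnmlsub e j = e (lshift n j).
Proof. by rewrite /mnmlsub multinomE tnth_mktuple. Qed.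

Lemma mnmrsubE e j : mnmrsub e j = e (rshift m j).
Proof. by rewrite /mnmrsub multinomE tnth_mktuple. Qed.

Lemma mnm_split_ext e e' : (forall j, e (lshift n j) = e' (lshift n j)) ->
  (forall j, e (rshift m j) = e' (rshift m j)) -> e = e'.
Proof.
move=> Hl Hr; apply/mnmP => j; rewrite -(splitK j).
by case: (fintype.split j) => k /=.
Qed.

Lemma mpairK e : mpair (mnmlsub e) (mnmrsub e) = e.
Proof. by apply: mnm_split_ext => j; rewrite ?mpairl ?mpairr ?mnmlsubE ?mnmrsubE. Qed.

Lemma mnmL_pair a : mnmL n a = mpair a mnm0.
Proof. by apply: mnm_split_ext => j; rewrite ?mnmLl ?mnmLr ?mpairl ?mpairr ?mnm0E. Qed.

Lemma mdeg_pair a b : mdeg (mpair a b) = (mdeg a + mdeg b)%N.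
Proof.
rewrite !mdegE big_split_ord /=; congr (_ + _)%N; apply: eq_bigr => j _; by rewrite ?mpairl ?mpairr.
Qed.

Lemma ycoef_ex b F : exists u : O, gcoef u =1 (fun a => gcoef F (mpair a b)).
Proof.
have [r [M [r0 HM]]] := gcoef_asum F.
apply: (germ_of_coef (r := r) (M := M / r ^+ mdeg b)) => // a.
rewrite ler_pdivlMr ?exprn_gt0 // -mulrA -exprD -mdeg_pair.
exact: (asum_term r0 HM).
Qed.

End Product.

(** The coefficient of [y ^ b] in the expansion of [F] along the second factor;
    locked for the same reason as [gcoef]. *)
HB.lock Definition ycoef (R : realType) (m n : nat) (b : multinom n) (F : germ R (m + n)) : germ R m :=
  projT1 (cid (ycoef_ex b F)).

Section YCoef.
Variables (R : realType) (m n : nat).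
Local Notation C := R[i].
Local Notation O := (germ R m).
Local Notation P := (germ R (m + n)).
Local Notation pull := (@germ_pull R m n).
Implicit Types (a : multinom m) (b : multinom n) (e : multinom (m + n)) (u v : O) (F G : P).

Lemma gcoef_ycoef b F a : gcoef (ycoef b F) a = gcoef F (mpair a b).
Proof. by rewrite ycoef.unlock; exact: (projT2 (cid (ycoef_ex b F))). Qed.

Lemma ycoefD b F G : ycoef b (F + G) = ycoef b F + ycoef b G.
Proof. by apply: gcoef_inj => a; rewrite [RHS]gcoefD !gcoef_ycoef gcoefD. Qed.

Lemma ycoef0 b : ycoef b (0 : P) = 0.
Proof. by apply: gcoef_inj => a; rewrite gcoef_ycoef !gcoef0. Qed.

Lemma ycoef_sum b (I : Type) (s : seq I) (Q : pred I) (H : I -> P) :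
  ycoef b (\sum_(i <- s | Q i) H i) = \sum_(i <- s | Q i) ycoef b (H i).
Proof. by apply: (big_morph (ycoef b)) => [F G|]; rewrite ?ycoefD ?ycoef0. Qed.

Lemma ycoef_inj F G : (forall b, ycoef b F = ycoef b G) -> F = G.
Proof.
move=> H; apply: gcoef_inj => e.
by rewrite -(mpairK e) -!gcoef_ycoef H.
Qed.

Lemma mle_pair a a' b b' : mle (mpair a b) (mpair a' b') = mle a a' && mle b b'.
Proof.
apply/mleP/andP => [H|[/mleP Ha /mleP Hb] j].
  by split; apply/mleP => j; [have := H (lshift n j); rewrite !mpairl|have := H (rshift m j); rewrite !mpairr].
by rewrite -(splitK j); case: (fintype.split j) => k /=; rewrite ?mpairl ?mpairr.
Qed.

Lemma mnm_sub_pair a a' b b' : mnm_sub (mpair a b) (mpair a' b') = mpair (mnm_sub a a') (mnm_sub b b').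
Proof. by apply: mnm_split_ext => j; rewrite !mnmBE ?mpairl ?mpairr mnmBE. Qed.

Lemma mle0 b : mle mnm0 b.
Proof. by apply/mleP => j; rewrite mnm0E. Qed.

Lemma ycoef_pullM b u F : ycoef b (pull u * F) = u * ycoef b F.
Proof.
apply: gcoef_inj => a; rewrite gcoef_ycoef [RHS]gcoefM [LHS]gcoefM.
have aN : (mdeg a < (mdeg (mpair a b)).+1)%N by rewrite mdeg_pair ltnS leq_addr.
rewrite (conv1E _ _ (leqnn _)) (conv1E _ _ aN) [LHS]big_mkcond [RHS]big_mkcond /=.
rewrite (bsum_ecoef (H := fun e => if mle e (mpair a b) then
   gcoef (pull u) e * gcoef F (mnm_sub (mpair a b) e) else 0)); last first.
  by move=> e /negbTE H; rewrite gcoef_pull /ecoef H mul0r if_same.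
apply: eq_bigr => a' _; rewrite mnmL_pair mle_pair mle0 andbT; case: ifP => // _.
rewrite gcoef_ycoef mnm_sub_pair subm0 gcoef_pull /ecoef -mnmL_pair mnmLK eqxx //.
Qed.

Lemma ycoef_pull b u : ycoef b (pull u) = if b == mnm0 then u else 0.
Proof.
apply: gcoef_inj => a; rewrite gcoef_ycoef gcoef_pull /ecoef.
case: (eqVneq b mnm0) => [->|b0]; first by rewrite -mnmL_pair mnmLK eqxx.
rewrite gcoef0 ifF //; apply/negbTE; apply: contraNN b0 => /eqP E.
by apply/eqP/mnmP => j; have := congr1 (fun e => e (rshift m j)) E; rewrite mpairr mnmLr mnm0E.
Qed.

Lemma germ_pull_inj : injective pull.
Proof.
by move=> u v /(congr1 (ycoef mnm0)); rewrite !ycoef_pull eqxx.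
Qed.

Lemma ycoef_yM b i F : ycoef b (ycoord R m i * F) =
  if (0 < b i)%N then ycoef (mnm_sub b (mnm1 i)) F else 0.
Proof.
apply: gcoef_inj => a; rewrite gcoef_ycoef gcoef_coordM mpairr.
case: ifP => _; last by rewrite gcoef0.
rewrite gcoef_ycoef; congr (gcoef F _); apply: mnm_split_ext => j; rewrite mnmBE ?mpairl ?mpairr mnm1E.
  by rewrite eq_rlshift subn0.
by rewrite mnmBE mnm1E eq_rshift.
Qed.

Lemma ycoefM0 F G : ycoef mnm0 (F * G) = ycoef mnm0 F * ycoef mnm0 G.
Proof.
apply: gcoef_inj => a; rewrite gcoef_ycoef [RHS]gcoefM [LHS]gcoefM.
have aN : (mdeg a < (mdeg (mpair a (mnm0 : multinom n))).+1)%N by rewrite mdeg_pair ltnS leq_addr.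
rewrite (conv1E _ _ (leqnn _)) (conv1E _ _ aN) [LHS]big_mkcond [RHS]big_mkcond /=.
rewrite (bsum_ecoef (H := fun e => if mle e (mpair a mnm0) then
   gcoef F e * gcoef G (mnm_sub (mpair a mnm0) e) else 0)); last first.
  move=> e H; case: ifP => // /mleP le; case/eqP: H; rewrite mnmL_pair -{1}(mpairK e); congr mpair.
  apply/mnmP => j; rewrite mnmrsubE mnm0E; apply/eqP; rewrite -leqn0.
  by have := le (rshift m j); rewrite mpairr mnm0E.
apply: eq_bigr => a' _; rewrite mnmL_pair mle_pair mle0 andbT; case: ifP => // _.
by rewrite !gcoef_ycoef mnm_sub_pair subm0.
Qed.

Lemma ycoef_der b i F : ycoef b (germ_der (rshift m i) F) =
  germ_cst m (b i).+1%:R * ycoef (mnm_add b (mnm1 i)) F.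
Proof.
apply: gcoef_inj => a; rewrite gcoef_ycoef gcoef_der mpairr gcoef_cstM gcoef_ycoef.
congr (_ * gcoef F _); apply: mnm_split_ext => j; rewrite mnmDE ?mpairl ?mpairr mnm1E.
  by rewrite eq_rlshift addn0.
by rewrite mnmDE mnm1E eq_rshift.
Qed.

Lemma pull_der i u : germ_der (lshift n i) (pull u) = pull (germ_der i u).
Proof.
apply: ycoef_inj => b; apply: gcoef_inj => a; rewrite gcoef_ycoef gcoef_der mpairl.
have -> : mnm_add (mpair a b) (mnm1 (lshift n i)) = mpair (mnm_add a (mnm1 i)) b.
  apply: mnm_split_ext => j; rewrite mnmDE ?mpairl ?mpairr mnm1E.
    by rewrite mnmDE mnm1E eq_lshift.
  by rewrite eq_lrshift addn0.
rewrite -!gcoef_ycoef !ycoef_pull; case: eqP => _; last by rewrite !gcoef0 mulr0.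
by rewrite gcoef_der.
Qed.

Lemma pull_yder i u : germ_der (rshift m i) (pull u) = 0.
Proof.
apply: ycoef_inj => b; rewrite ycoef_der ycoef_pull ycoef0 ifF ?mulr0 //.
by apply/negP => /eqP/mnmP/(_ i); rewrite mnmDE mnm1E eqxx addn1 mnm0E.
Qed.

Lemma gcoef0_pair F : gcoef F mnm0 = gcoef (ycoef mnm0 F) mnm0.
Proof.
rewrite gcoef_ycoef; congr (gcoef F _).
by apply: mnm_split_ext => j; rewrite ?mpairl ?mpairr !mnm0E.
Qed.

Lemma initial_pull u l a : initial (gcoef u) l a ->
  initial (gcoef (pull u)) (fun j => if fintype.split j is inl k then l k else 1%N) (mnmL n a).
Proof.
move=> [l0 ua umin].
have uE e : gcoef (pull u) e != 0 -> e = mnmL n (mnmlsub e).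
  by rewrite gcoef_pull /ecoef; case: (e =P _) => // _; rewrite eqxx.
have uL a' : gcoef (pull u) (mnmL n a') = gcoef u a' by rewrite gcoef_pull /ecoef mnmLK eqxx.
have wL a' : wt (fun j => if fintype.split j is inl k then l k else 1%N) (mnmL n a') = wt l a'.
  rewrite /wt big_split_ord /= [X in (_ + X)%N]big1 ?addn0.
    by apply: eq_bigr => j _; rewrite (unsplitK (inl j)) mnmLl.
  by move=> j _; rewrite mnmLr muln0.
split=> [j||e ea ue]; [by case: fintype.split|by rewrite uL|].
rewrite (uE _ ue) !wL; apply: umin; last by rewrite -uL -(uE _ ue).
by apply: contraNN ea => /eqP <-; rewrite -(uE _ ue).
Qed.

(** Divisibility by a germ on the first factor can be tested on the coefficients
    along the second factor; the division theorem gives the convergence of the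
    sum of the quotients. *)
Lemma dvd_pull u F : u != 0 -> (forall b, exists q, ycoef b F = q * u) ->
  exists Q, F = Q * pull u.
Proof.
move=> u0 H; have [l [a ui]] := initial_exists u0.
have [Q [r [FE Hr]]] := germ_division F (initial_pull ui).
exists Q; rewrite FE (_ : r = 0) ?addr0 //; apply: ycoef_inj => b; rewrite ycoef0.
have [q qE] := H b.
have rE : ycoef b r = (q - ycoef b Q) * u.
  by rewrite mulrBl -qE FE ycoefD mulrC ycoef_pullM mulrC [X in _ = X - _]addrC addrK.
rewrite rE (_ : q - _ = 0) ?mul0r //.
apply: (germ_division_uniq ui) => a' aa'; rewrite -rE gcoef_ycoef Hr //.
by rewrite mnmL_pair mle_pair aa' mle0.
Qed.

End YCoef.

(** * Shears and regularity in one variable *)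

Section Shear.
Variables (R : realType) (m : nat) (i : 'I_m) (v : 'rV[R[i]]_m).
Local Notation C := R[i].
Local Notation A := (germ R m).
Implicit Types (c : multinom m -> C) (x : 'rV[C]_m) (a b : multinom m).

(** For [v 0 i = 0] this linear automorphism fixes the hyperplane [x 0 i = 0] and
    sends the [i]-th basis vector to its sum with [v], so it carries the [i]-th axis
    to any line transverse to that hyperplane. *)
Definition shear x := x + x 0 i *: v.
Local Notation K := (1 + `|v|).

Let K0 : 0 < K. Proof. by rewrite ltr_pwDl. Qed.

Lemma shear_norm x : `|shear x| <= K * `|x|.
Proof.
rewrite (le_trans (ler_normD _ _)) // mulrDl mul1r lerD // normrZ mulrC ler_wpM2l //.
exact: coord_le_norm.
Qed.

Lemma monoS x a j : mono x (mnm_add a (mnm1 j)) = mono x a * x 0 j.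
Proof. by rewrite monoD mono1. Qed.

(** A monomial becomes a product of linear forms: the degree is kept, and each
    factor multiplies the sum of the norms of the coefficients by at most [K]. *)
Lemma mono_shear_ex a : exists s : seq (C * multinom m),
  [/\ forall p, p \in s -> mdeg p.2 = mdeg a, \sum_(p <- s) `|p.1| <= K ^+ mdeg a &
      forall x, mono (shear x) a = \sum_(p <- s) p.1 * mono x p.2].
Proof.
move Ea : (mdeg a) => k; elim: k a Ea => [|k IH] a Ea.
  move/eqP: Ea; rewrite mdeg_eq0 => /eqP ->.
  exists [:: (1, mnm0)]; split.
  - by move=> p; rewrite inE => /eqP ->; rewrite mdeg0.
  - by rewrite big_seq1 normr1 expr0.
  - by move=> x; rewrite big_seq1 !mono0 mulr1.
have [|j aj] := @mnm_neq0 m a; first by apply: contra_eq_neq Ea => ->; rewrite mdeg0.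
rewrite -lt0n in aj; have aE := esym (mnm_sub1K aj).
have dk : mdeg (mnm_sub a (mnm1 j)) = k by apply/eqP; rewrite -eqSS -mdeg_sub1 // Ea.
have [s [sd sK sE]] := IH _ dk.
exists ([seq (p.1, mnm_add p.2 (mnm1 j)) | p <- s] ++ [seq (p.1 * v 0 j, mnm_add p.2 (mnm1 i)) | p <- s]).
split.
- by move=> p; rewrite mem_cat => /orP[] /mapP[q /sd qd ->] /=; rewrite mdegD mdeg1 qd addn1.
- rewrite big_cat !big_map /= -big_split /=.
  under eq_bigr => p _ do rewrite normrM -[X in X + _]mulr1 -mulrDr.
  rewrite -mulr_suml exprSr ler_pM ?sumr_ge0 ?addr_ge0 // lerD2l.
  exact: coord_le_norm.
- move=> x; rewrite [in LHS]aE monoS sE big_cat !big_map /= !mxE mulrDr !mulr_suml; congr (_ + _).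
    by apply: eq_bigr => p _; rewrite monoS mulrA.
  by apply: eq_bigr => p _; rewrite monoS; ring.
Qed.

Definition shear_seq a := projT1 (cid (mono_shear_ex a)).

Lemma shear_seqP a : [/\ forall p, p \in shear_seq a -> mdeg p.2 = mdeg a,
  \sum_(p <- shear_seq a) `|p.1| <= K ^+ mdeg a &
  forall x, mono (shear x) a = \sum_(p <- shear_seq a) p.1 * mono x p.2].
Proof. exact: (projT2 (cid (mono_shear_ex a))). Qed.

Definition shear_coef c b : C :=
  \sum_(a : bmultinom m (mdeg b).+1) c a * \sum_(p <- shear_seq a | p.2 == b) p.1.

Lemma shear_coefE c b N : (mdeg b < N)%N ->
  shear_coef c b = \sum_(a : bmultinom m N) c a * \sum_(p <- shear_seq a | p.2 == b) p.1.
Proof.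
move=> bN; rewrite /shear_coef (bsum_widen (fun a => c a * \sum_(p <- shear_seq a | p.2 == b) p.1) bN).
rewrite [RHS](bigID (fun a : bmultinom m N => (mdeg a < (mdeg b).+1)%N)) /= [X in _ = _ + X]big1 ?addr0 //.
move=> a ab; rewrite big_seq_cond big1 ?mulr0 // => p /andP[ps /eqP pb].
have [sd _ _] := shear_seqP a.
by move: ab; rewrite -pb (sd _ ps) ltnSn.
Qed.

(** Stated for arbitrary [F] and [G] to serve both the series and its norm. *)
Lemma shear_exchange N (F : multinom m -> C) (G : C * multinom m -> C) :
  \sum_(b : bmultinom m N) \sum_(a : bmultinom m N) F a * \sum_(p <- shear_seq a | p.2 == b) G p =
  \sum_(a : bmultinom m N) F a * \sum_(p <- shear_seq a) G p.
Proof.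
rewrite exchange_big; apply: eq_bigr => a _ /=; rewrite -mulr_sumr; congr (_ * _).
rewrite (exchange_big_dep xpredT) //= big_seq [RHS]big_seq; apply: eq_bigr => p ps.
have [sd _ _] := shear_seqP a.
have pN : (mdeg p.2 < N)%N by rewrite (sd _ ps) bmdeg.
rewrite (bigD1 (BMultinom pN)) //= big1 ?addr0 // => b /andP[/eqP pb].
by rewrite bmeqP /= pb eqxx.
Qed.

Lemma psum_shear c N x : psum (shear_coef c) N x = psum c N (shear x).
Proof.
rewrite /psum; transitivity (\sum_(a : bmultinom m N) c a * \sum_(p <- shear_seq a) p.1 * mono x p.2).
  rewrite -(shear_exchange N c (fun p => p.1 * mono x p.2)); apply: eq_bigr => b _.
  rewrite (shear_coefE c (bmdeg b)) mulr_suml; apply: eq_bigr => a _.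
  by rewrite -mulrA mulr_suml; congr (_ * _); apply: eq_bigr => p /eqP ->.
apply: eq_bigr => a _; congr (_ * _).
by have [_ _ ->] := shear_seqP a.
Qed.

Lemma expansion_shear f c r : has_expansion f c r ->
  has_expansion (f \o shear) (shear_coef c) (r / K).
Proof.
move=> [r0 [M HM] Hf]; have rK : 0 < r / K by rewrite divr_gt0.
have rK0 := ltW rK.
split; first exact: rK.
- exists M => N; apply: le_trans (HM N); rewrite /asum.
  apply: (@le_trans _ _ (\sum_(a : bmultinom m N) `|c a| * \sum_(p <- shear_seq a) `|p.1| * (r / K) ^+ mdeg p.2)).
    rewrite -(shear_exchange N (fun a => `|c a|) (fun p => `|p.1| * (r / K) ^+ mdeg p.2)).
    apply: ler_sum => b _; rewrite (shear_coefE c (bmdeg b)).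
    apply: le_trans (ler_wpM2r _ (ler_norm_sum _ _ _)) _; first by rewrite exprn_ge0.
    rewrite mulr_suml; apply: ler_sum => a _; rewrite normrM -mulrA ler_wpM2l //.
    apply: le_trans (ler_wpM2r _ (ler_norm_sum _ _ _)) _; first by rewrite exprn_ge0.
    by rewrite mulr_suml; apply: ler_sum => p /eqP ->.
  apply: ler_sum => a _; rewrite ler_wpM2l //.
  have [sd sK _] := shear_seqP a.
  rewrite big_seq (eq_bigr (fun p => `|p.1| * (r / K) ^+ mdeg a)); last by move=> p /sd ->.
  rewrite -big_seq -mulr_suml (le_trans (ler_wpM2r _ sK)) ?exprn_ge0 //.
  by rewrite -exprMn mulrC divfK // gt_eqF.
- move=> x xr; rewrite (_ : (fun N => _) = (fun N => psum c N (shear x))); last first.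
    by apply/funext => N; exact: psum_shear.
  apply: Hf; apply: le_lt_trans (shear_norm x) _.
  by rewrite mulrC -ltr_pdivlMr.
Qed.

Lemma analytic0_shear (f : 'rV[C]_m -> C) : analytic0 f -> analytic0 (f \o shear).
Proof. by move=> [c [r H]]; exists (shear_coef c), (r / K); exact: expansion_shear. Qed.

Lemma near_shear (Q : 'rV[C]_m -> Prop) : (\forall x \near (0 : 'rV[C]_m), Q x) ->
  \forall x \near (0 : 'rV[C]_m), Q (shear x).
Proof.
move=> /near_ball_ex[r [r0 HQ]]; apply: (@near_ball R m (r / K)) => [|x xr]; first by rewrite divr_gt0.
by apply/HQ/(le_lt_trans (shear_norm x)); rewrite mulrC -ltr_pdivlMr.
Qed.

Definition germ_shear (g : A) : A := germ_of (analytic0_shear (holP (repr g))).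

Lemma germ_shearE (f : hol R m) :
  germ_shear (\pi_(germ R m) f) = germ_of (analytic0_shear (holP f)).
Proof.
apply/eq_germ => /=; apply: (near_shear (Q := fun x => repr (\pi_(germ R m) f) x = f x)).
exact: gev_pi.
Qed.

Lemma gev_shear g : \forall x \near (0 : 'rV[C]_m), gev (germ_shear g) x = gev g (shear x).
Proof. exact: gev_pi. Qed.

Lemma gcoef_shear g : gcoef (germ_shear g) =1 shear_coef (gcoef g).
Proof.
have [r H] := gcoef_exp g.
exact: (gcoef_germ_of _ (expansion_shear H)).
Qed.

Lemma germ_shear_cst k : germ_shear (germ_cst m k) = germ_cst m k.
Proof.
rewrite [germ_cst m k]/germ_cst [germ_of _]/germ_of germ_shearE; apply/eq_germ.
by near=> x.
Unshelve. all: by end_near. Qed.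

Lemma germ_shearB : {morph germ_shear : u v / u - v}.
Proof.
move=> u w; rewrite -(gevK u) -(gevK w) -piB !germ_shearE /germ_of -piB.
by apply/eq_germ; near=> x.
Unshelve. all: by end_near. Qed.

Lemma germ_shearM : monoid_morphism germ_shear.
Proof.
split=> [|u w]; first by rewrite -germ_cst1 germ_shear_cst.
rewrite -(gevK u) -(gevK w) -piM !germ_shearE /germ_of -piM.
by apply/eq_germ; near=> x.
Unshelve. all: by end_near. Qed.

HB.instance Definition _ := GRing.isZmodMorphism.Build A A germ_shear germ_shearB.
HB.instance Definition _ := GRing.isMonoidMorphism.Build A A germ_shear germ_shearM.

End Shear.

Section ShearTheory.
Variables (R : realType) (m : nat) (i : 'I_m).
Local Notation C := R[i].
Local Notation A := (germ R m).
Implicit Types (v : 'rV[C]_m).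

Lemma shearK v : v 0 i = 0 -> cancel (shear i (- v)) (shear i v).
Proof. by move=> vi x; rewrite /shear !mxE vi oppr0 mulr0 addr0 scalerN subrK. Qed.

Lemma germ_shearK v : v 0 i = 0 -> cancel (germ_shear i v) (germ_shear i (- v)).
Proof.
move=> vi g; rewrite -(gevK g) germ_shearE [germ_of _]/germ_of germ_shearE.
by apply/eq_germ; near=> x; rewrite /= shearK.
Unshelve. all: by end_near. Qed.

Lemma germ_shearVK v : v 0 i = 0 -> cancel (germ_shear i (- v)) (germ_shear i v).
Proof.
move=> vi; have := @germ_shearK (- v); rewrite opprK; apply.
by rewrite mxE vi oppr0.
Qed.

Definition regular (f : A) (d : nat) :=
  gcoef f (mnm_muln (mnm1 i) d) != 0 /\ forall j, (j < d)%N -> gcoef f (mnm_muln (mnm1 i) j) = 0.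

Lemma mulm1E d j : mnm_muln (mnm1 i) d j = ((i == j) * d)%N.
Proof. by rewrite mulmnE mnm1E. Qed.

(** The weight [d + 1] on the other variables makes every monomial containing one of
    them heavier than the [d]-th power of [x_i]. *)
Lemma regular_initial f d : regular f d ->
  initial (gcoef f) (fun j => if j == i then 1%N else d.+1) (mnm_muln (mnm1 i) d).
Proof.
move=> [fd fj]; split=> [j||a ad fa]; [by case: ifP|by []|].
have -> : wt (fun j => if j == i then 1%N else d.+1) (mnm_muln (mnm1 i) d) = d.
  rewrite /wt (bigD1 i) //= eqxx mulm1E eqxx !mul1n big1 ?addn0 // => j ji.
  by rewrite mulm1E (eq_sym i) (negbTE ji) muln0.
case: (pselect (exists2 j, j != i & a j != 0%N)) => [[j ji aj]|H].
  rewrite /wt (bigD1 j) //= (ifN _ _ ji); move: aj; nia.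
have aE : a = mnm_muln (mnm1 i) (a i).
  apply/mnmP => j; rewrite mulm1E (eq_sym i); case: eqVneq => [->|ji]; first by rewrite mul1n.
  by apply/eqP/negPn/negP => aj; apply: H; exists j.
rewrite /wt (bigD1 i) //= eqxx mul1n.
have : (d <= a i)%N.
  by rewrite leqNgt; apply/negP => /fj; rewrite -aE => /eqP; apply/negP.
suff : d != a i by lia.
by apply: contraNneq ad => ->; rewrite -aE.
Qed.

(** If [f] vanished on every line through the origin transverse to the hyperplane
    [x_i = 0], then [f * x_i] would vanish. The sheared series has a
    radius of convergence that shrinks when the line approaches the hyperplane, so
    its partial sums, which on the [i]-th axis are those of [f] on the line, are
    compared instead of its sum. *)
Lemma regular_exists (f : A) : f != 0 ->
  exists v d, v 0 i = 0 /\ regular (germ_shear i v f) d.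
Proof.
move=> f0; apply: contrapT => H.
have [r Hf] := gcoef_exp f; have [r0 _ Hc] := Hf.
have coef0 v j : v 0 i = 0 -> gcoef (germ_shear i v f) (mnm_muln (mnm1 i) j) = 0.
  move=> vi; apply/eqP/negPn/negP => cj; apply: H.
  have ex : exists j, gcoef (germ_shear i v f) (mnm_muln (mnm1 i) j) != 0 by exists j.
  have [d cd dmin] := ex_minnP ex; exists v, d; split=> //; split=> // k kd.
  by apply/eqP/negPn/negP => /dmin; rewrite leqNgt kd.
have fx0 (x : 'rV[C]_m) : `|x| < r -> x 0 i != 0 -> gev f x = 0.
  move=> xr xi; pose v := (x 0 i)^-1 *: x - evec R i.
  have vi : v 0 i = 0 by rewrite !mxE !eqxx mulVf // subrr.
  have sx : shear i v (x 0 i *: evec R i) = x.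
    rewrite /shear !mxE !eqxx mulr1 -scalerDr addrC subrK scalerA divff // scale1r //.
  have p0 N : psum (gcoef f) N x = 0.
    rewrite -sx -psum_shear /psum big1 // => a _; rewrite -gcoef_shear.
    case: (pselect (exists2 j, j != i & a j != 0%N)) => [[j ji aj]|Ha].
      by rewrite /mono (bigD1 j) //= !mxE eqxx (negbTE ji) mulr0 expr0n (negbTE aj) mul0r mulr0.
    have -> : (a : multinom m) = mnm_muln (mnm1 i) (a i).
      apply/mnmP => j; rewrite mulm1E (eq_sym i); case: eqVneq => [->|ji]; first by rewrite mul1n.
      by apply/eqP/negPn/negP => aj; apply: Ha; exists j.
    by rewrite coef0 // mul0r.
  have := Hc x xr; rewrite (_ : (fun N => _) = (fun=> 0)); last by apply/funext => N.
  by move=> H0; apply: (cvg_unique _ H0); [exact: norm_hausdorff|exact: cvg_cst].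
have fX : f * germ_coord R i = 0.
  rewrite -(gevK f) -piM -[RHS](rmorph0 \pi_(germ R m)); apply/eq_germ.
  apply: (near_ball r0) => x xr; rewrite -[LHS]/(gev f x * x 0 i).
  by case: (eqVneq (x 0 i) 0) => [->|xi]; [rewrite mulr0|rewrite fx0 // mul0r].
have := germ_mul_eq0 fX; rewrite (negbTE f0) /= => /eqP X0.
have := gcoef_coord R i (mnm1 i); rewrite X0 gcoef0 eqxx => /eqP.
by rewrite eq_sym oner_eq0.
Qed.

End ShearTheory.

(** * Estimates for complex polynomials and for germs *)

Section ComplexPoly.
Variable (R : realType).
Local Notation C := R[i].
Implicit Types (p q w r : {poly C}) (e M : C).

Lemma poly_bounded p e : 0 <= e -> exists2 B, 0 <= B & forall t, `|t| <= e -> `|p.[t]| <= B.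
Proof.
move=> e0; exists (\sum_(j < size p) `|p`_j| * e ^+ j).
  by rewrite sumr_ge0 // => j _; rewrite mulr_ge0 ?exprn_ge0.
move=> t te; rewrite horner_coef (le_trans (ler_norm_sum _ _ _)) //.
by apply: ler_sum => j _; rewrite normrM normrX ler_wpM2l // lerXn2r ?nnegrE.
Qed.

Lemma poly_lipschitz p e z : 0 <= e -> `|z| <= e ->
  exists2 B, 0 <= B & forall t, `|t| <= e -> `|p.[t] - p.[z]| <= `|t - z| * B.
Proof.
move=> e0 ze; have : root (p - p.[z]%:P) z by rewrite rootE !hornerE subrr.
move=> /factor_theorem[q qE]; have [B B0 HB] := poly_bounded q e0; exists B => // t te.
have -> : p.[t] - p.[z] = (p - p.[z]%:P).[t] by rewrite !hornerE.
by rewrite qE !hornerE normrM mulrC ler_wpM2l // HB.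
Qed.

(** A root of the bounding polynomial is a root of [r]; after division of both by
    the linear factor the bound persists, at that root itself by continuity. *)
Lemma dvdp_bounded (rs : seq C) r e M : 0 < e -> 0 <= M -> (forall z, z \in rs -> `|z| < e) ->
  (forall t, `|t| <= e -> `|r.[t]| <= M * `|(\prod_(z <- rs) ('X - z%:P)).[t]|) ->
  \prod_(z <- rs) ('X - z%:P) %| r.
Proof.
move=> e0 M0; elim: rs r => [|z rs IH] r rse H; first by rewrite big_nil dvd1p.
have ze : `|z| < e by apply: rse; rewrite mem_head.
have : root r z.
  rewrite rootE -normr_le0 (le_trans (H _ (ltW ze))) // big_cons hornerM !hornerE subrr mul0r normr0 mulr0 //.
move=> /factor_theorem[r1 rE]; rewrite big_cons rE mulrC dvdp_mul2r ?polyXsubC_eq0 //.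
apply: IH => [y ys|t te]; first by apply: rse; rewrite inE ys orbT.
set w := \prod_(y <- rs) _.
have off s : `|s| <= e -> s != z -> `|r1.[s]| <= M * `|w.[s]|.
  move=> se sz; have := H s se; rewrite rE big_cons !hornerM !hornerE !normrM mulrCA mulrC.
  by rewrite ler_pM2l // normr_gt0 subr_eq0.
case: (eqVneq t z) => [->|]; last exact: off.
have [B B0 HB] := poly_lipschitz r1 (ltW e0) (ltW ze).
have [B' B'0 HB'] := poly_lipschitz w (ltW e0) (ltW ze).
apply/ler_addgt0Pr => x x0.
(* the bound at [z] is the limit of the bounds at [z + y], for [y] tending to zero *)
pose T := B + M * B' + 1.
have T0 : 0 < T by rewrite ltr_wpDl // addr_ge0 // mulr_ge0.
have [y [y0 yx ye]] : exists y : C, [/\ 0 < y, y <= x / T & y <= e - `|z|].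
  by apply: common_radius; rewrite ?divr_gt0 ?subr_gt0.
have yn : `|y| = y by rewrite gtr0_norm.
have se : `|z + y| <= e by rewrite (le_trans (ler_normD _ _)) // yn -lerBrDl.
have sz : z + y != z by rewrite -subr_eq0 addrC addKr gt_eqF.
have d : z + y - z = y by rewrite addrC addKr.
apply: (@le_trans _ _ (`|r1.[z + y]| + y * B)).
  rewrite -{1}(subrK r1.[z + y] r1.[z]) addrC (le_trans (ler_normD _ _)) // lerD2l distrC.
  by have := HB _ se; rewrite d yn.
apply: (@le_trans _ _ (M * (`|w.[z]| + y * B') + y * B)).
  rewrite lerD2r (le_trans (off _ se sz)) // ler_wpM2l //.
  rewrite -{1}(subrK w.[z] w.[z + y]) addrC (le_trans (ler_normD _ _)) // lerD2l.
  by have := HB' _ se; rewrite d yn.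
rewrite mulrDr -addrA lerD2l (le_trans _ (_ : y * T <= x)) //; last by rewrite -ler_pdivlMr.
rewrite /T !mulrDr mulr1 [leLHS]addrC mulrCA lerDl ltW //.
Qed.

Lemma closed_roots p : p \is monic -> exists rs : seq C, p = \prod_(z <- rs) ('X - z%:P).
Proof.
move=> /monicP p1; have [rs pE] := closed_field_poly_normal p.
by exists rs; rewrite pE p1 scale1r.
Qed.

Lemma coef_prod_bound (rs : seq C) : (forall z, z \in rs -> `|z| <= 1) ->
  forall j, `|(\prod_(z <- rs) ('X - z%:P))`_j| <= 2 ^+ size rs.
Proof.
elim: rs => [|z rs IH] rs1 j.
  by rewrite big_nil coef1 expr0; case: eqP => _; rewrite ?normr1 ?normr0.
have {}IH : forall j, `|(\prod_(z <- rs) ('X - z%:P))`_j| <= 2 ^+ size rs.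
  by apply: IH => y ys; apply: rs1; rewrite inE ys orbT.
rewrite big_cons mulrBl coefB coefXM coefCM exprSr mulr_natr mulr2n.
rewrite (le_trans (ler_normB _ _)) // lerD //.
  by case: eqP => _ //; rewrite normr0 exprn_ge0.
by rewrite normrM -[leRHS]mul1r ler_pM // rs1 // mem_head.
Qed.

(** At a point of norm at least [e] the leading term exceeds the sum of the others. *)
Lemma small_roots (d : nat) w e : 0 < e -> e <= 1 -> size w = d.+1 -> w \is monic ->
  (forall j, (j < d)%N -> `|w`_j| <= e ^+ d / d.+1%:R) -> forall z, root w z -> `|z| < e.
Proof.
move=> e0 e1 sw wm wj z; rewrite rootE horner_coef sw big_ord_recr /=.
have -> : w`_d = 1 by have := monicP wm; rewrite /lead_coef sw.
rewrite mul1r addrC addr_eq0 => /eqP zd.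
rewrite real_ltNge ?realE ?normr_ge0 ?(ltW e0) //; apply/negP => ez.
have z0 : 0 < `|z| by apply: lt_le_trans ez.
have : `|z| ^+ d <= \sum_(j < d) `|z| ^+ d / d.+1%:R.
  have zdE : `|z| ^+ d = `|\sum_(i < d) w`_i * z ^+ i| by rewrite -normrX zd normrN.
  rewrite {1}zdE (le_trans (ler_norm_sum _ _ _)) //; apply: ler_sum => j _.
  rewrite normrM (le_trans (ler_wpM2r _ (wj _ (ltn_ord j)))) // mulrAC ler_wpM2r //.
  have -> : `|z| ^+ d = `|z| ^+ (d - j) * `|z| ^+ j by rewrite -exprD subnK // ltnW.
  rewrite normrX ler_wpM2r ?exprn_ge0 //.
  rewrite (@le_trans _ _ (e ^+ (d - j))) //.
    by apply: ler_wiXn2l => //; [exact: ltW|exact: leq_subr].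
  by rewrite lerXn2r ?nnegrE // ltW.
rewrite sumr_const card_ord -[leRHS]mulr_natr -mulrA -[leLHS]mulr1 ler_pM2l ?exprn_gt0 //.
by rewrite mulrC ler_pdivlMr ?ltr0n // mul1r ler_nat ltnn.
Qed.

End ComplexPoly.

Section NearZero.
Variables (R : realType) (m : nat).
Local Notation C := R[i].
Local Notation A := (germ R m).

Lemma gev_bounded (g : A) : exists2 B : C, 0 <= B & \forall x \near (0 : 'rV[C]_m), `|gev g x| <= B.
Proof.
have [r [r0 [M HM] Hg]] := gcoef_exp g; exists M.
  by apply: le_trans (HM 0%N); apply: asum_ge0; exact: ltW.
apply: (near_ball r0) => x xr; apply: (cvg_norm_le (Hg x xr)) => N.
apply: le_trans (HM N); rewrite /psum (le_trans (ler_norm_sum _ _ _)) //.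
by apply: ler_sum => a _; rewrite normrM ler_wpM2l // mono_norm // ltW.
Qed.

Lemma gev_sum n (F : 'I_n -> A) :
  \forall x \near (0 : 'rV[C]_m), gev (\sum_i F i) x = \sum_i gev (F i) x.
Proof.
elim: n F => [|n IH] F.
  have -> : \sum_i F i = 0 by rewrite big_ord0.
  have := @gev_eq R m 0 0 (esym (rmorph0 _)); apply: filterS => x ->.
  by rewrite big_ord0.
have -> : \sum_i F i = \sum_(i < n) F (widen_ord (leqnSn n) i) + F ord_max by rewrite big_ord_recr.
have := gevD (\sum_(i < n) F (widen_ord (leqnSn n) i)) (F ord_max).
have := IH (fun i => F (widen_ord (leqnSn n) i)).
by apply: filterS2 => x E1 E2; rewrite big_ord_recr /= E2 E1.
Qed.

Lemma gev_cst (k : C) : \forall x \near (0 : 'rV[C]_m), gev (germ_cst m k) x = k.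
Proof. exact: gev_pi. Qed.

Lemma gev_coord i : \forall x \near (0 : 'rV[C]_m), gev (germ_coord R i) x = x 0 i.
Proof. exact: gev_pi. Qed.

Lemma near_ord N (P : nat -> 'rV[C]_m -> Prop) :
  (forall j, \forall x \near (0 : 'rV[C]_m), P j x) ->
  \forall x \near (0 : 'rV[C]_m), forall j, (j < N)%N -> P j x.
Proof.
move=> H; elim: N => [|N IH]; first by near=> x.
apply: filterS2 IH (H N) => x I IN j; rewrite ltnS leq_eqVlt => /orP[/eqP -> //|]; exact: I.
Unshelve. all: by end_near. Qed.

Lemma gev_small (g : A) : gcoef g mnm0 = 0 -> forall e : C, 0 < e ->
  \forall x \near (0 : 'rV[C]_m), `|gev g x| <= e.
Proof.
move=> g0 e e0; have [F gE] := germ_hadamard g.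
have {}gE : g = \sum_i germ_coord R i * F i.
  rewrite {1}gE g0 (_ : germ_cst m 0 = 0) ?add0r //.
  by apply: gcoef_inj => a; rewrite gcoef_cst mul0r gcoef0.
have bF i : exists B, 0 <= B /\ \forall x \near (0 : 'rV[C]_m), `|gev (germ_coord R i * F i) x| <= `|x| * B.
  have [B B0 HB] := gev_bounded (F i); exists B; split=> //.
  have H1 := gevM (germ_coord R i) (F i); have H2 := gev_coord i.
  near=> x; rewrite (near H1 x) // (near H2 x) // normrM ler_pM ?coord_le_norm //.
  by near: x.
have /choice[B HB] := bF.
pose S : C := 1 + \sum_i B i.
have S0 : 0 < S by rewrite ltr_pwDl // sumr_ge0 // => i _; case: (HB i).
have H1 := gev_sum (fun i => germ_coord R i * F i).
have H2 : \forall x \near (0 : 'rV[C]_m), forall i, `|gev (germ_coord R i * F i) x| <= `|x| * B i.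
  have := @near_ord m (fun j x => forall i : 'I_m, val i = j -> `|gev (germ_coord R i * F i) x| <= `|x| * B i).
  have K j : \forall x \near (0 : 'rV[C]_m), forall i : 'I_m, val i = j -> `|gev (germ_coord R i * F i) x| <= `|x| * B i.
    case: (ltnP j m) => jm; last by near=> x => i ij; have := ltn_ord i; rewrite [X in (X < _)%N]ij ltnNge jm.
    have [_] := HB (Ordinal jm); apply: filterS => x Hx i ij.
    by have -> : i = Ordinal jm by apply/val_inj.
  by move=> /(_ K); apply: filterS => x Hx i; apply: (Hx i).
have H3 : \forall x \near (0 : 'rV[C]_m), `|x| < e / S.
  by apply: (@near_ball R m (e / S)); rewrite // divr_gt0.
near=> x; have -> : gev g x = \sum_i gev (germ_coord R i * F i) x by rewrite {1}gE; near: x.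
rewrite (le_trans (ler_norm_sum _ _ _)) // (@le_trans _ _ (`|x| * S)) //.
  rewrite /S mulrDr mulr1 mulr_sumr ler_wpDl // ler_sum // => i _; move: i; near: x; exact: H2.
by rewrite -ler_pdivlMr // ltW //; near: x.
Unshelve. all: by end_near. Qed.

Definition germ_at0 (g : A) : C := gcoef g mnm0.

Lemma germ_at0B : {morph germ_at0 : u v / u - v}.
Proof. by move=> u v; rewrite /germ_at0 gcoefB. Qed.

Lemma germ_at0M : monoid_morphism germ_at0.
Proof. by split=> [|u v]; rewrite /germ_at0 ?gcoef1 ?eqxx ?gcoefM0. Qed.

HB.instance Definition _ := GRing.isZmodMorphism.Build A C germ_at0 germ_at0B.
HB.instance Definition _ := GRing.isMonoidMorphism.Build A C germ_at0 germ_at0M.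

Lemma germ_natr_neq0 n : (0 < n)%N -> n%:R != 0 :> A.
Proof.
move=> n0; apply/eqP => /(congr1 germ_at0); rewrite rmorph_nat rmorph0 => /eqP.
by rewrite pnatr_eq0 -leqn0 leqNgt n0.
Qed.

End NearZero.

(** * Weierstrass preparation and bounded quotients *)

Section LastVariable.
Variables (R : realType) (k : nat).
Local Notation C := R[i].
Local Notation O := (germ R k).
Local Notation A := (germ R (k + 1)).
Implicit Types (p q r w : {poly O}) (f g h : A).

Definition last_ord : 'I_(k + 1) := rshift k ord0.
Local Notation t := (ycoord R k (ord0 : 'I_1)).
Local Notation deg1 := (mnm_muln (mnm1 (ord0 : 'I_1))).

Lemma multinom1E (b : multinom 1) : b = deg1 (b ord0).
Proof. by apply/mnmP => j; rewrite mulm1E (ord1 j) eqxx mul1n. Qed.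

Lemma deg1_eq0 j : (deg1 j == mnm0) = (j == 0%N).
Proof.
apply/eqP/eqP => [/mnmP/(_ ord0)|->]; first by rewrite mulm1E eqxx mul1n mnm0E.
by apply/mnmP => l; rewrite mulm1E muln0.
Qed.

(** The last variable is treated as a second factor of dimension one, so that the
    coefficients of a polynomial in it are recovered by [ycoef]. *)
Definition poly_germ p : A := (map_poly (@germ_pull R k 1) p).[t].

Lemma poly_germB : {morph poly_germ : p q / p - q}.
Proof. by move=> p q; rewrite /poly_germ rmorphB hornerD hornerN. Qed.

Lemma poly_germM : monoid_morphism poly_germ.
Proof. by split=> [|p q]; rewrite /poly_germ ?rmorph1 ?hornerC // rmorphM hornerM. Qed.

HB.instance Definition _ := GRing.isZmodMorphism.Build {poly O} A poly_germ poly_germB.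
HB.instance Definition _ := GRing.isMonoidMorphism.Build {poly O} A poly_germ poly_germM.

Lemma poly_germX : poly_germ 'X = t.
Proof. by rewrite /poly_germ map_polyX hornerX. Qed.

Lemma ycoef_tX j l : ycoef (deg1 j) (t ^+ l) = (j == l)%:R :> O.
Proof.
elim: l j => [|l IH] j.
  rewrite expr0 -(rmorph1 (@germ_pull R k 1)) ycoef_pull deg1_eq0.
  by case: (j == 0)%N.
rewrite exprS ycoef_yM mulm1E eqxx mul1n; case: j => [|j] //=.
have -> : mnm_sub (deg1 j.+1) (mnm1 ord0) = deg1 j.
  by apply/mnmP => i; rewrite mnmBE !mulm1E mnm1E (ord1 i) eqxx !mul1n subn1.
by rewrite IH eqSS.
Qed.

Lemma ycoef_poly j p : ycoef (deg1 j) (poly_germ p) = p`_j.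
Proof.
rewrite /poly_germ horner_coef ycoef_sum (size_map_inj_poly (@germ_pull_inj R k 1)) ?rmorph0 //.
rewrite -[in RHS](coefK p) coef_poly.
rewrite (eq_bigr (fun i : 'I_(size p) => if i == j :> nat then p`_j else 0)); last first.
  move=> i _; rewrite coef_map ycoef_pullM ycoef_tX eq_sym.
  by case: eqP => [->|]; rewrite ?mulr1 ?mulr0.
case: ifPn => jp; first by rewrite (bigD1 (Ordinal jp)) //= eqxx big1 ?addr0 // => i /negbTE; rewrite -val_eqE /= => ->.
rewrite big1 // => i _; case: eqP => // ij; move: jp; by rewrite -ij ltn_ord.
Qed.

Lemma poly_germ_inj : injective poly_germ.
Proof. by move=> p q E; apply/polyP => j; rewrite -!ycoef_poly E. Qed.

Lemma poly_germ_surj f d : (forall j, (d <= j)%N -> ycoef (deg1 j) f = 0) ->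
  exists2 p, f = poly_germ p & (size p <= d)%N.
Proof.
move=> H; exists (\poly_(j < d) ycoef (deg1 j) f); last exact: size_poly.
apply: ycoef_inj => b; rewrite (multinom1E b) ycoef_poly coef_poly; case: ltnP => // /H //.
Qed.

Lemma poly_germ_der p : germ_der last_ord (poly_germ p) = poly_germ p^`().
Proof.
apply: ycoef_inj => b; rewrite (multinom1E b) ycoef_der ycoef_poly coef_deriv.
have -> : mnm_add (deg1 (b ord0)) (mnm1 ord0) = deg1 (b ord0).+1.
  by apply/mnmP => i; rewrite mnmDE !mulm1E mnm1E (ord1 i) eqxx !mul1n addn1.
rewrite ycoef_poly mulm1E eqxx mul1n; apply: gcoef_inj => a; rewrite gcoef_cstM.
move: (p`_(b ord0).+1) => u; elim: (b ord0).+1 => [|n IH]; first by rewrite mul0r mulr0n gcoef0.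
by rewrite -natr1 mulrDl mul1r IH -gcoefD -mulrSr.
Qed.

Lemma pure_pair j : mnm_muln (mnm1 last_ord) j = mpair mnm0 (deg1 j).
Proof.
apply: mnm_split_ext => i; rewrite ?mpairl ?mpairr !mulm1E /last_ord ?eq_rshift ?eq_rlshift //.
by rewrite mnm0E.
Qed.

Lemma regular_division f d (c : A) : regular last_ord f d ->
  exists (q : A) r, c = q * f + poly_germ r /\ (size r <= d)%N.
Proof.
move=> /regular_initial fi; have [q [r [cE Hr]]] := germ_division c fi.
have [j dj|p pE ps] := @poly_germ_surj r d; last by exists q, p; rewrite -pE.
apply: gcoef_inj => a; rewrite gcoef_ycoef gcoef0 Hr // pure_pair mle_pair mle0 /=.
by apply/mleP => i; rewrite !mulm1E leq_mul2l dj orbT.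
Qed.

Lemma regular_division_uniq f d (q : A) r : regular last_ord f d ->
  poly_germ r = q * f -> (size r <= d)%N -> r = 0.
Proof.
move=> fd rE rd; have fi := regular_initial fd.
suff q0 : q = 0 by apply: poly_germ_inj; rewrite rE q0 mul0r rmorph0.
apply: (germ_division_uniq fi) => a; rewrite -rE -(mpairK a) pure_pair mle_pair => /andP[_ /mleP /(_ ord0)].
rewrite mulm1E eqxx mul1n => da; rewrite -gcoef_ycoef (multinom1E (mnmrsub a)) ycoef_poly.
by rewrite nth_default ?gcoef0 // (leq_trans rd).
Qed.

Lemma regular_mul f d (q : A) j : regular last_ord f d -> (j <= d)%N ->
  gcoef (f * q) (mnm_muln (mnm1 last_ord) j) =
  if j == d then gcoef f (mnm_muln (mnm1 last_ord) d) * gcoef q mnm0 else 0.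
Proof.
move=> [fd fj] jd; rewrite gcoefM (conv1E _ _ (leqnn _)).
set P := mnm_muln (mnm1 last_ord).
have PE a : mle a (P j) -> exists2 l, (l <= j)%N & a = P l.
  move=> /mleP H; exists (a last_ord).
    by have := H last_ord; rewrite mulm1E eqxx mul1n.
  apply/mnmP => i; have := H i; rewrite !mulm1E; case: eqP => [->|_]; first by rewrite !mul1n.
  by rewrite !mul0n leqn0 => /eqP.
have vanish a : mle a (P j) -> a != P d -> gcoef f a = 0.
  move=> /PE[l lj ->] H; apply: fj; rewrite ltn_neqAle (leq_trans lj) // andbT.
  by apply: contraNneq H => ->.
case: eqVneq => [jE|jNd]; last first.
  rewrite big1 // => a aj; rewrite vanish ?mul0r //.
  have [l lj ->] := PE _ aj; apply: contraNneq jNd => /mnmP/(_ last_ord).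
  by rewrite !mulm1E eqxx !mul1n => le; apply/eqP; lia.
have dN : (mdeg (P d) < (mdeg (P j)).+1)%N by rewrite jE.
rewrite (bigD1 (BMultinom dN)) /=; last by rewrite jE; apply/mleP.
rewrite big1 ?addr0; last by move=> a /andP[aj]; rewrite bmeqP /= => aNd; rewrite vanish ?mul0r.
by congr (_ * gcoef q _); rewrite jE; apply/mnmP => i; rewrite mnmBE subnn mnm0E.
Qed.

Definition weierstrass w d :=
  [/\ w \is monic, size w = d.+1 & forall j, (j < d)%N -> gcoef w`_j mnm0 = 0].

Lemma weierstrass_regular w d : weierstrass w d -> regular last_ord (poly_germ w) d.
Proof.
move=> [wm ws wj]; split=> [|j jd]; rewrite pure_pair -gcoef_ycoef ycoef_poly; last exact: wj.
by have := monicP wm; rewrite /lead_coef ws /= => ->; rewrite gcoef1 eqxx oner_neq0.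
Qed.

(** Divide [t ^ d] by [f], say [t ^ d = q * f + r]. At the origin of the other
    variables [q * f] has order [d] in [t], so there [r] vanishes and [q] does not. *)
Lemma weierstrass_preparation f d : regular last_ord f d ->
  exists (u : A) w, [/\ u \is a GRing.unit, weierstrass w d & poly_germ w = u * f].
Proof.
move=> fd; have [q [r [tE rd]]] := regular_division (t ^+ d) fd.
pose w := 'X^d - r.
have wE : poly_germ w = q * f by rewrite rmorphB rmorphXn /= poly_germX tE addrK.
have coefw j : gcoef w`_j mnm0 = gcoef (f * q) (mnm_muln (mnm1 last_ord) j).
  by rewrite mulrC -wE pure_pair -gcoef_ycoef ycoef_poly.
have rd1 : (size r < size ('X^d : {poly O}))%N by rewrite size_polyXn ltnS.
have ws : size w = d.+1 by rewrite size_polyDl ?size_polyXn // size_polyN ltnS.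
have wm : w \is monic.
  by rewrite monicE lead_coefDl ?size_polyN ?size_polyXn ?ltnS // lead_coefXn.
exists q, w; split=> //.
  have := coefw d; rewrite (regular_mul _ fd) // eqxx.
  have -> : w`_d = 1 by have := monicP wm; rewrite /lead_coef ws.
  rewrite gcoef1 eqxx germ_unitE => E; apply/eqP => q0; move/eqP: E.
  by rewrite q0 mulr0 oner_eq0.
split=> // j jd; rewrite coefw (regular_mul _ fd) 1?ltnW //.
by case: eqP => // E; rewrite E ltnn in jd.
Qed.

Definition poly_at (x : 'rV[C]_k) p : {poly C} := \poly_(j < size p) gev p`_j x.

Lemma near_prod (Q : 'rV[C]_(k + 1) -> Prop) : (\forall x \near (0 : 'rV[C]_(k + 1)), Q x) ->
  exists e : C, [/\ 0 < e, e <= 1 & forall x (s : C), `|x| <= e -> `|s| <= e ->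
    Q (row_mx x (const_mx s))].
Proof.
move=> /near_ball_ex[r [r0 HQ]].
have r20 : 0 < r / 2 by rewrite divr_gt0.
have [e [e0 e1 er]] := common_radius (ltr01 : (0 : C) < 1) r20.
exists e; split=> // x s xe se; apply: HQ.
apply: (@le_lt_trans _ _ e); last by rewrite (le_lt_trans er) // ltr_pdivrMr // ltr_pMr // ltr1n.
apply: norm_le_coord; first exact: ltW.
move=> j; rewrite -(splitK j); case: (fintype.split j) => l /=; rewrite ?row_mxEl ?row_mxEr ?mxE //.
exact: le_trans (coord_le_norm _ _) xe.
Qed.

Lemma gev_pull (g : O) : \forall x \near (0 : 'rV[C]_(k + 1)), gev (germ_pull 1 g) x = gev g (lsubmx x).
Proof. exact: gev_pi. Qed.

Lemma gev_tX l : \forall x \near (0 : 'rV[C]_(k + 1)), gev (t ^+ l) x = x 0 last_ord ^+ l.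
Proof.
elim: l => [|l IH].
  have H := @gev_cst R (k + 1) 1; rewrite germ_cst1 in H.
  by apply: filterS H => x Hx; rewrite expr0.
rewrite exprS; have := gevM t (t ^+ l); have := @gev_coord R _ last_ord.
move=> H1 H2; near=> x; rewrite (near H2 x) // (near H1 x) // exprS (near IH x) //.
Unshelve. all: by end_near. Qed.

Lemma gev_poly p : exists e : C, [/\ 0 < e, e <= 1 & forall x (s : C), `|x| <= e -> `|s| <= e ->
    gev (poly_germ p) (row_mx x (const_mx s)) = (poly_at x p).[s]].
Proof.
have pE : poly_germ p = \sum_(j < size p) germ_pull 1 p`_j * t ^+ j.
  rewrite /poly_germ horner_coef (size_map_inj_poly (@germ_pull_inj R k 1)) ?rmorph0 //.
  by apply: eq_bigr => j _; rewrite coef_map.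
have H1 := gev_sum (fun j : 'I_(size p) => germ_pull 1 p`_j * t ^+ j).
have H2 : \forall X \near (0 : 'rV[C]_(k + 1)), forall j, (j < size p)%N ->
    gev (germ_pull 1 p`_j * t ^+ j) X = gev p`_j (lsubmx X) * X 0 last_ord ^+ j.
  apply: near_ord => j; have E1 := gevM (germ_pull 1 p`_j) (t ^+ j).
  have E2 := gev_pull p`_j; have E3 := gev_tX j.
  by near=> X; rewrite (near E1 X) // (near E2 X) // (near E3 X).
have [|e [e0 e1 He]] := @near_prod (fun X => gev (poly_germ p) X =
    \sum_(j < size p) gev p`_j (lsubmx X) * X 0 last_ord ^+ j).
  apply: filterS2 H1 H2 => X E1 E2; rewrite {1}pE E1; apply: eq_bigr => j _.
  by rewrite E2.
exists e; split=> // x s xe se; rewrite He // /poly_at horner_poly; apply: eq_bigr => j _.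
by rewrite row_mxKl row_mxEr mxE.
Unshelve. all: by end_near. Qed.

Lemma germ_eq0 m (g : germ R m) : (\forall x \near (0 : 'rV[C]_m), gev g x = 0) -> g = 0.
Proof.
by move=> H; rewrite -(gevK g) -[RHS](rmorph0 \pi_(germ R m)); apply/eq_germ.
Qed.

(** Let [w] be the Weierstrass polynomial of [f] and [r] the remainder of [g]. Near
    the origin all roots of [w] are small, so [r] has them all with multiplicity by
    [dvdp_bounded]; being of smaller degree, it is zero. *)
Lemma bounded_dvd_regular f g d M : regular last_ord f d -> 0 <= M ->
  (\forall X \near (0 : 'rV[C]_(k + 1)), `|gev g X| <= M * `|gev f X|) ->
  exists s : A, g = s * f.
Proof.
move=> fd M0 gf; have [u [w [uU [wm ws wj] wE]]] := weierstrass_preparation fd.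
have [s [r [gE rd]]] := regular_division g fd.
exists s; suff r0 : r = 0 by rewrite gE r0 rmorph0 addr0.
have [Bs Bs0 Hs] := gev_bounded s; have [Bu Bu0 Hu] := gev_bounded u^-1.
pose M' := (M + Bs) * Bu.
have M'0 : 0 <= M' by rewrite mulr_ge0 ?addr_ge0.
have rw : \forall X \near (0 : 'rV[C]_(k + 1)), `|gev (poly_germ r) X| <= M' * `|gev (poly_germ w) X|.
  have E1 : \forall X \near (0 : 'rV[C]_(k + 1)), gev g X - gev s X * gev f X = gev (poly_germ r) X.
    have rE : poly_germ r = g - s * f by rewrite gE addrC addKr.
    have H1 := gevB g (s * f); have H2 := gevM s f.
    by near=> X; rewrite rE (near H1 X) // (near H2 X).
  have E2 : \forall X \near (0 : 'rV[C]_(k + 1)), gev f X = gev u^-1 X * gev (poly_germ w) X.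
    have fE : f = u^-1 * poly_germ w by rewrite wE mulKr.
    by have H1 := gevM u^-1 (poly_germ w); near=> X; rewrite {1}fE (near H1 X).
  near=> X; rewrite -(near E1 X) //.
  apply: (@le_trans _ _ ((M + Bs) * `|gev f X|)).
    rewrite (le_trans (ler_normB _ _)) // mulrDl lerD //; first by near: X.
    by rewrite normrM ler_wpM2r //; near: X.
  rewrite /M' -mulrA ler_wpM2l ?addr_ge0 // (near E2 X) // normrM ler_wpM2r //.
  by near: X.
have [e1 [e10 e11 H1]] := near_prod rw.
have [e2 [e20 e21 H2]] := gev_poly r.
have [e3 [e30 e31 H3]] := gev_poly w.
have [e4 [e40 e41 e42]] := common_radius e10 e20.
have [e [e0 ee4 ee3]] := common_radius e40 e30.
have ee1 := le_trans ee4 e41; have ee2 := le_trans ee4 e42.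
have eone : e <= 1 := le_trans ee1 e11.
have small : \forall x \near (0 : 'rV[C]_k), forall j, (j < d)%N -> `|gev w`_j x| <= e ^+ d / d.+1%:R.
  have := @near_ord R k d (fun j x => (j < d)%N -> `|gev w`_j x| <= e ^+ d / d.+1%:R).
  have K j : \forall x \near (0 : 'rV[C]_k), (j < d)%N -> `|gev w`_j x| <= e ^+ d / d.+1%:R.
    case: (ltnP j d) => jd; last by near=> x.
    have eps0 : 0 < e ^+ d / d.+1%:R by rewrite divr_gt0 ?exprn_gt0 // ltr0n.
    by apply: filterS (gev_small (wj _ jd) eps0) => x Hx _.
  by move=> /(_ K); apply: filterS => x Hx j jd; apply: Hx.
have wd : w`_d = 1 by have := monicP wm; rewrite /lead_coef ws.
have one : \forall x \near (0 : 'rV[C]_k), gev w`_d x = 1.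
  by have H := @gev_cst R k 1; rewrite wd -germ_cst1.
have xe : \forall x \near (0 : 'rV[C]_k), `|x| <= e.
  by apply: (near_ball e0) => x /ltW.
have zero : \forall x \near (0 : 'rV[C]_k), poly_at x r = 0.
  near=> x.
  have w1 : gev w`_d x = 1 by near: x.
  have sw : size (poly_at x w) = d.+1.
    by rewrite /poly_at ws size_poly_eq // w1 oner_neq0.
  have mw : poly_at x w \is monic.
    by rewrite monicE /lead_coef sw coef_poly ws ltnSn w1.
  have [rs wrs] := closed_roots mw.
  have dv : poly_at x w %| poly_at x r.
    rewrite wrs; apply: (dvdp_bounded e0 M'0) => [z zrs|s' se].
      apply: (small_roots e0 eone sw mw) => [j jd|]; last by rewrite wrs root_prod_XsubC.
      rewrite coef_poly ws ltnS (ltnW jd); move: j jd; near: x; exact: small.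
    have xe' : `|x| <= e by near: x.
    rewrite -wrs -H2 ?(le_trans _ ee2) // -H3 ?(le_trans _ ee3) //.
    by apply: H1; rewrite (le_trans _ ee1).
  apply/eqP; apply: contraTT dv => r0; apply/negP => /(dvdp_leq r0); rewrite sw => lt.
  by have := leq_trans lt (leq_trans (size_poly _ _) rd); rewrite ltnn.
apply/polyP => j; rewrite coef0; case: (ltnP j (size r)) => jr; last exact: nth_default.
apply: germ_eq0; apply: filterS zero => x /(congr1 (fun p : {poly C} => p`_j)).
by rewrite coef_poly jr coef0.
Unshelve. all: by end_near. Qed.

End LastVariable.

Section Bounded.
Variable (R : realType).
Local Notation C := R[i].

Lemma bounded_dvd_last k (f g : germ R (k + 1)) (M : C) : f != 0 -> 0 <= M ->
  (\forall X \near (0 : 'rV[C]_(k + 1)), `|gev g X| <= M * `|gev f X|) ->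
  exists s, g = s * f.
Proof.
move=> f0 M0 gf; have [v [d [vi fd]]] := regular_exists (last_ord k) f0.
have [|s sE] := bounded_dvd_regular (g := germ_shear (last_ord k) v g) fd M0.
  have H1 := gev_shear (last_ord k) v f; have H2 := gev_shear (last_ord k) v g.
  have H3 := @near_shear R _ (last_ord k) v _ gf.
  by near=> X; rewrite (near H1 X) // (near H2 X) //; near: X.
exists (germ_shear (last_ord k) (- v) s).
by rewrite -[LHS](germ_shearK vi) sE rmorphM /= germ_shearK.
Unshelve. all: by end_near. Qed.

(** This plays the part of the integral closedness of the ring of germs. *)
Theorem bounded_dvd m (f g : germ R m) (M : C) : f != 0 -> 0 <= M ->
  (\forall X \near (0 : 'rV[C]_m), `|gev g X| <= M * `|gev f X|) ->
  exists s, g = s * f.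
Proof.
case: m f g => [|m] f g; last by move: f g; rewrite -addn1 => f g; exact: bounded_dvd_last.
move=> f0 _ _; suff fU : f \is a GRing.unit by exists (g / f); rewrite divrK.
rewrite germ_unitE; apply: contraNneq f0 => f0; apply/eqP/gcoef_inj => a.
by rewrite gcoef0 -f0; congr gcoef; apply/mnmP; case.
Qed.

End Bounded.

(** * Squarefree germs and the ideal of their derivatives *)

(** Over a domain of characteristic zero, a polynomial with a common factor with
    its derivative has a square factor, up to a constant: with [G] that common
    factor and [w = Q * G], a [G] prime to [Q] would divide its own derivative. *)
Lemma square_factor (O : idomainType) (w : {poly O}) :
  (forall n, (0 < n)%N -> n%:R != 0 :> O) -> w != 0 -> ~~ coprimep w w^`() ->
  exists k (A B : {poly O}), [/\ k != 0, (1 < size A)%N & k *: w = A ^+ 2 * B].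
Proof.
move=> char0 w0 ncop; pose G := gcdp w w^`().
have G0 : G != 0 by rewrite gcdp_eq0 negb_and w0.
have sG : (1 < size G)%N.
  by move: ncop; rewrite coprimep_def ltn_neqAle eq_sym size_poly_gt0 G0 andbT.
have /Pdiv.WeakIdomain.dvdpP[[k1 Q] /= k10 wE] : G %| w by exact: dvdp_gcdl.
have G'0 : G^`() != 0.
  apply/eqP => /polyP/(_ (size G).-2); rewrite coef_deriv coef0.
  have -> : (size G).-2.+1 = (size G).-1 by move: sG; lia.
  rewrite -mulr_natr => /eqP; rewrite mulf_eq0 (negbTE (char0 _ _)) // ?orbF; last by move: sG; lia.
  by rewrite -lead_coefE lead_coef_eq0 (negbTE G0).
have ncopGQ : ~~ coprimep G Q.
  apply/negP => cop.
  have GwE : G %| k1 *: w^`() by rewrite dvdpZr // dvdp_gcdr.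
  have dE : k1 *: w^`() = Q^`() * G + Q * G^`() by rewrite -derivZ wE derivM.
  have : G %| Q * G^`().
    by move: GwE; rewrite dE dvdp_addr // dvdp_mull.
  rewrite Gauss_dvdpr // => /(dvdp_leq G'0); rewrite leqNgt => /negP[].
  exact: lt_size_deriv.
pose A := gcdp G Q.
have A0 : A != 0 by rewrite gcdp_eq0 negb_and G0.
have sA : (1 < size A)%N.
  by move: ncopGQ; rewrite coprimep_def ltn_neqAle eq_sym size_poly_gt0 A0 andbT.
have /Pdiv.WeakIdomain.dvdpP[[kA G1] /= kA0 GE] : A %| G by exact: dvdp_gcdl.
have /Pdiv.WeakIdomain.dvdpP[[kB Q1] /= kB0 QE] : A %| Q by exact: dvdp_gcdr.
exists (kA * kB * k1), A, (G1 * Q1); split=> //; first by rewrite !mulf_neq0.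
transitivity ((kA *: G) * (kB *: Q)); last by rewrite GE QE expr2; ring.
by rewrite -scalerA wE -!mul_polyC polyCM; ring.
Qed.

(* the degrees in an equality of products [p ^ 2 * q] can only drop together *)
Lemma factor_degrees (n1 n2 n3 n4 d : nat) : (0 < n1)%N -> (0 < n2)%N ->
  d.+1 = (n3.-1 + n3.-1 + n4)%N -> (n2 <= n4)%N -> (n1 <= n3)%N ->
  d.+1 = (n1 + (n1 + n2).-1).-1 -> n1 = n3.
Proof. lia. Qed.

Section Weierstrass.
Variables (R : realType) (k : nat).
Local Notation C := R[i].
Local Notation O := (germ R k).
Local Notation A := (germ R (k + 1)).
Implicit Types (p q r w : {poly O}) (f g h : A).

Lemma poly_atM p q : \forall x \near (0 : 'rV[C]_k), poly_at x (p * q) = poly_at x p * poly_at x q.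
Proof.
pose N := (size p + size q + size (p * q)%R)%N.
have coefE s : \forall x \near (0 : 'rV[C]_k), forall j, (j < N)%N -> (poly_at x s)`_j = gev s`_j x.
  apply: near_ord => j; case: (ltnP j (size s)) => js.
    by near=> x; rewrite coef_poly js.
  have := @gev_eq R k 0 0 (esym (rmorph0 _)); apply: filterS => x E.
  by rewrite coef_poly ltnNge js /= nth_default.
have sumE : \forall x \near (0 : 'rV[C]_k), forall j, (j < N)%N ->
    gev (p * q)`_j x = \sum_(l < j.+1) gev p`_l x * gev q`_(j - l) x.
  apply: near_ord => j.
  have H1 := gev_sum (fun l : 'I_j.+1 => p`_l * q`_(j - l)).
  have H2 : \forall x \near (0 : 'rV[C]_k), forall l, (l < j.+1)%N ->
      gev (p`_l * q`_(j - l)) x = gev p`_l x * gev q`_(j - l) x.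
    by apply: near_ord => l; exact: gevM.
  apply: filterS2 H1 H2 => x E1 E2; rewrite coefM E1; apply: eq_bigr => l _.
  exact: E2.
have Hp := coefE p; have Hq := coefE q; have Hpq := coefE (p * q).
near=> x; apply/polyP => j; case: (ltnP j N) => jN; last first.
  rewrite coef_poly ltnNge (leq_trans _ jN) ?leq_addl //= nth_default //.
  apply: leq_trans jN; rewrite /N (leq_trans (size_polyMleq _ _)) // (leq_trans (leq_pred _)) //.
  by rewrite (leq_trans _ (leq_addr _ _)) // leq_add // size_poly.
have -> : (poly_at x (p * q))`_j = gev (p * q)`_j x by move: j jN; near: x.
have -> : gev (p * q)`_j x = \sum_(l < j.+1) gev p`_l x * gev q`_(j - l) x by move: j jN; near: x.
rewrite coefM; apply: eq_bigr => l _; congr (_ * _); apply/esym.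
  have : (l < N)%N by rewrite (leq_trans _ jN) // ltn_ord.
  by move: (l : nat); near: x.
have : (j - l < N)%N by rewrite (leq_ltn_trans (leq_subr _ _)).
by move: (j - l)%N; near: x.
Unshelve. all: by end_near. Qed.

Lemma weierstrass_neq0 w d : weierstrass w d -> w != 0.
Proof. by move=> [wm _ _]; rewrite monic_neq0. Qed.

(** The roots of [p] at a point are roots of the Weierstrass polynomial, hence
    bounded. So the quotients of the coefficients of [p] by the leading one are
    bounded, and [bounded_dvd] applies. *)
Lemma lead_coef_dvd w d (c : O) p q : weierstrass w d -> c != 0 ->
  c *: w = p ^+ 2 * q -> forall j, exists s, p`_j = s * lead_coef p.
Proof.
move=> ww c0 wE j; have [wm ws wj] := ww; have w0 := weierstrass_neq0 ww.
have cw0 : c *: w != 0 by rewrite -mul_polyC mulf_neq0 ?polyC_eq0.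
have [p0 q0] : p != 0 /\ q != 0.
  by move: cw0; rewrite wE mulf_eq0 expf_eq0 /= negb_or => /andP[].
have a0 : lead_coef p != 0 by rewrite lead_coef_eq0.
have sE : d.+1 = ((size p).-1 + (size p).-1 + size q)%N.
  have := congr1 (fun p : {poly O} => size p) wE; rewrite size_scale // ws => ->.
  rewrite expr2 -mulrA size_mul ?mulf_neq0 // size_mul //.
  rewrite -!size_poly_gt0 in p0 q0.
  by move: p0 q0; case: (size p) => // n _; case: (size q) => // l _; lia.
have small : \forall x \near (0 : 'rV[C]_k), forall j, (j < d)%N -> `|gev w`_j x| <= 1 ^+ d / d.+1%:R.
  have := @near_ord R k d (fun j x => (j < d)%N -> `|gev w`_j x| <= 1 ^+ d / d.+1%:R).
  have K i : \forall x \near (0 : 'rV[C]_k), (i < d)%N -> `|gev w`_i x| <= 1 ^+ d / d.+1%:R.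
    case: (ltnP i d) => id; last by near=> x.
    have eps0 : 0 < 1 ^+ d / d.+1%:R :> C by rewrite divr_gt0 ?exprn_gt0 // ltr0n.
    by apply: filterS (gev_small (wj _ id) eps0) => x Hx _.
  by move=> /(_ K); apply: filterS => x Hx i id; apply: Hx.
have wd : w`_d = 1 by have := monicP wm; rewrite /lead_coef ws.
have one : \forall x \near (0 : 'rV[C]_k), gev w`_d x = 1.
  by have H := @gev_cst R k 1; rewrite wd -germ_cst1.
have H1 := poly_atM c%:P w; have H2 := poly_atM p (p * q); have H3 := poly_atM p q.
have H4 := gevM c p`_j; have H5 := gevM c (lead_coef p).
have H0 := @gev_eq R k 0 0 (esym (rmorph0 _)).
have [|||s sE'] := @bounded_dvd R k (c * lead_coef p) (c * p`_j) (2 ^+ (size p).-1).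
- by rewrite mulf_neq0.
- by rewrite exprn_ge0.
- near=> x; rewrite (near H4 x) // (near H5 x) //.
  case: (eqVneq (gev c x) 0) => [->|cx]; first by rewrite !mul0r normr0 mulr0.
  have w1 : gev w`_d x = 1 by near: x.
  have sw : size (poly_at x w) = d.+1.
    by rewrite /poly_at ws size_poly_eq // w1 oner_neq0.
  have mw : poly_at x w \is monic.
    by rewrite monicE /lead_coef sw coef_poly ws ltnSn w1.
  have cE : poly_at x c%:P = (gev c x)%:P.
    apply/polyP => i; rewrite coef_poly coefC size_polyC c0.
    by case: i => [|i] //=; rewrite coefC.
  have wxE : gev c x *: poly_at x w = poly_at x p * (poly_at x p * poly_at x q).
    by rewrite -mul_polyC -cE -(near H1 x) // mul_polyC wE expr2 -mulrA (near H2 x) // (near H3 x).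
  have cwx0 : gev c x *: poly_at x w != 0 by rewrite -mul_polyC mulf_neq0 ?polyC_eq0 ?monic_neq0.
  have [px0 qx0] : poly_at x p != 0 /\ poly_at x q != 0.
    by move: cwx0; rewrite wxE !mulf_eq0 !negb_or => /and3P[].
  have spx : size (poly_at x p) = size p.
    have := congr1 (fun p : {poly C} => size p) wxE; rewrite size_scale // sw.
    rewrite size_mul ?mulf_neq0 // size_mul //.
    have : (size (poly_at x p) <= size p)%N by exact: size_poly.
    have : (size (poly_at x q) <= size q)%N by exact: size_poly.
    rewrite -!size_poly_gt0 in px0 qx0; move: px0 qx0 sE.
    exact: factor_degrees.
  have [rs pE] := closed_field_poly_normal (poly_at x p).
  have lE : lead_coef (poly_at x p) = gev (lead_coef p) x.
    by rewrite /lead_coef spx coef_poly prednK ?leqnn // size_poly_gt0.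
  have rs1 z : z \in rs -> `|z| <= 1.
    move=> zrs; apply/ltW/(small_roots ltr01 (lexx _) sw mw) => [i id|].
      by rewrite coef_poly ws ltnS (ltnW id); move: i id; near: x; exact: small.
    have : root (gev c x *: poly_at x w) z.
      by rewrite wxE rootM pE rootZ ?root_prod_XsubC ?zrs // lead_coef_eq0.
    by rewrite rootZ.
  have srs : size rs = (size p).-1.
    have := congr1 (fun p : {poly C} => size p) pE; rewrite spx size_scale ?lead_coef_eq0 //.
    by rewrite size_prod_XsubC => ->.
  rewrite !normrM mulrCA ler_wpM2l //.
  case: (ltnP j (size p)) => jp; last first.
    by rewrite nth_default // (near H0 x) // normr0 mulr_ge0 // exprn_ge0.
  have -> : gev p`_j x = (poly_at x p)`_j by rewrite coef_poly jp.
  by rewrite pE coefZ lE normrM mulrC -srs ler_wpM2r // coef_prod_bound.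
- by exists s; apply: (mulfI c0); rewrite sE' mulrCA.
Unshelve. all: by end_near. Qed.

Lemma poly_germ_at0 p : germ_at0 (poly_germ p) = (map_poly (@germ_at0 R k) p).[0].
Proof.
rewrite horner_coef0 coef_map /= /germ_at0 gcoef0_pair -ycoef_poly; congr (gcoef (ycoef _ _) _).
Qed.

(** Otherwise [w] has a square factor by [square_factor], which may be taken monic by
    [lead_coef_dvd]. At the origin it divides a power of the variable, so it vanishes
    there and is not a unit. *)
Lemma weierstrass_coprime w d : weierstrass w d -> squarefree (poly_germ w) ->
  coprimep w w^`().
Proof.
move=> ww sqf; apply/negPn/negP => ncop; have [wm ws wj] := ww.
have w0 := weierstrass_neq0 ww.
have [c [p [q [c0 sp wE]]]] := square_factor (@germ_natr_neq0 R k) w0 ncop.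
have /choice[s sE] := lead_coef_dvd ww c0 wE.
have p0 : p != 0 by rewrite -size_poly_gt0 (leq_trans _ sp).
have a0 : lead_coef p != 0 by rewrite lead_coef_eq0.
pose p1 := \poly_(j < size p) s j.
have pE : p = lead_coef p *: p1.
  apply/polyP => j; rewrite coefZ coef_poly; case: ltnP => jp; first by rewrite sE mulrC.
  by rewrite mulr0 nth_default.
have sp1 : size p1 = size p by rewrite [in RHS]pE size_scale.
have p1m : p1 \is monic.
  rewrite monicE; apply/eqP/(mulfI a0).
  by rewrite mulr1 -lead_coefZ -pE.
pose P := p1 ^+ 2.
have Pm : P \is monic by rewrite monic_exp.
have rE := Pdiv.RingMonic.rdivp_eq Pm w.
set Q := Pdiv.Ring.rdivp w P in rE; set r := Pdiv.Ring.rmodp w P in rE.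
have r0 : r = 0.
  apply/eqP; apply: contraT => r0.
  have rP : (size r < size P)%N by rewrite Pdiv.Ring.ltn_rmodp monic_neq0.
  have E : c *: r = (lead_coef p ^+ 2 *: q - c *: Q) * P.
    have -> : c *: r = c *: w - c *: (Q * P) by rewrite {1}rE scalerDr addrC addKr.
    by rewrite wE {1}pE exprZn mulrBl -!scalerAl (mulrC q).
  have cr0 : c *: r != 0 by rewrite -mul_polyC mulf_neq0 ?polyC_eq0.
  have Pr : P %| c *: r by rewrite E dvdp_mull.
  by have := dvdp_leq cr0 Pr; rewrite size_scale // leqNgt rP.
have wPE : w = p1 ^+ 2 * Q by rewrite {1}rE r0 addr0 mulrC.
have [|v vE] := sqf (poly_germ p1) (poly_germ Q); first by rewrite {1}wPE rmorphM rmorphXn.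
have w0E : map_poly (@germ_at0 R k) w = 'X^d.
  apply/polyP => j; rewrite coef_map coefXn /=; case: (ltngtP j d) => jd.
  - by rewrite /germ_at0 wj.
  - by rewrite nth_default ?rmorph0 // ws.
  - by rewrite jd; have := monicP wm; rewrite /lead_coef ws /= => ->; rewrite rmorph1.
have : size (map_poly (@germ_at0 R k) p1) != 1%N.
  have -> : size (map_poly (@germ_at0 R k) p1) = size p1.
    by apply: size_poly_eq; rewrite -/(lead_coef p1) (monicP p1m) rmorph1 oner_neq0.
  by rewrite sp1 neq_ltn sp orbT.
move=> /closed_rootP[z zr].
have : root ('X^d : {poly C}) z.
  rewrite -w0E wPE rmorphM rmorphXn /= rootM; apply/orP; left.
  by rewrite rootE horner_exp (rootP zr) expr0n.
rewrite /root hornerXn expf_eq0 => /andP[_ /eqP z0].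
have := congr1 (@germ_at0 R (k + 1)) vE; rewrite rmorphM rmorph1 /= poly_germ_at0 -z0 (rootP zr) mul0r => /eqP.
by rewrite eq_sym oner_eq0.
Qed.

(** With [w] the Weierstrass polynomial of [h] and [r] the remainder of [c], the
    hypothesis says that [w] divides [r * w'], so [w] divides [r], which is of
    smaller degree. *)
Lemma jacobian_saturated_regular h (c : A) d : regular (last_ord k) h d -> squarefree h ->
  (exists e, c * germ_der (last_ord k) h = e * h) -> exists e, c = e * h.
Proof.
move=> hd sqf [e0 e0E]; have [u [w [uU ww wE]]] := weierstrass_preparation hd.
have [wm ws wj] := ww.
have sqfw : squarefree (poly_germ w).
  move=> a b ab; apply: (sqf a (u^-1 * b)).
  by rewrite mulrCA -ab wE mulKr.
have cop := weierstrass_coprime ww sqfw.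
have rw := weierstrass_regular ww.
have [s [r [cE rd]]] := regular_division c rw.
suff r0 : r = 0 by exists (s * u); rewrite cE r0 rmorph0 addr0 wE mulrA.
have [z zE] : exists z, poly_germ (r * w^`()) = z * poly_germ w.
  have [_ _ DM] := germ_der_is_derivation R (last_ord k).
  exists (c * germ_der (last_ord k) u * u^-1 + e0 - s * poly_germ w^`()).
  have hE : h = u^-1 * poly_germ w by rewrite wE mulKr.
  have cw : c * poly_germ w^`() = (c * germ_der (last_ord k) u * u^-1 + e0) * poly_germ w.
    rewrite -poly_germ_der wE DM mulrDr (mulrCA c u) e0E mulrDl; congr (_ + _); last exact: mulrCA.
    by rewrite -(mulrA _ u^-1) mulKr // mulrA.
  by rewrite (rmorphM _ r) mulrBl -cw cE mulrDl (mulrAC s) [X in X - _]addrC addrK.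
have rE := Pdiv.RingMonic.rdivp_eq wm (r * w^`()).
set Q := Pdiv.Ring.rdivp _ _ in rE; set r' := Pdiv.Ring.rmodp _ _ in rE.
have r'0 : r' = 0.
  apply: (regular_division_uniq rw (q := z - poly_germ Q)).
    have r'E : r' = r * w^`() - Q * w by rewrite [X in X - _]rE [X in X - _]addrC addrK.
    by rewrite r'E (poly_germB (r * w^`()) (Q * w)) zE mulrBl (poly_germM R k).2.
  by rewrite -ltnS -ws Pdiv.Ring.ltn_rmodp monic_neq0.
have : w %| r * w^`() by rewrite rE r'0 addr0 dvdp_mull.
rewrite Gauss_dvdpl // => wr; apply/eqP; apply: contraLR rd => r0.
by have := dvdp_leq r0 wr; rewrite ws -ltnNge.
Qed.

End Weierstrass.

Section Saturation.
Variable R : realType.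

Lemma jacobian_saturated_last k (h c : germ R (k + 1)) : h != 0 -> squarefree h ->
  (forall D, derivation D -> exists e, c * D h = e * h) -> exists e, c = e * h.
Proof.
move=> h0 sqf H; set i := last_ord k.
have [v [d [vi hd]]] := regular_exists i h0.
have ST : cancel (germ_shear i v) (germ_shear i (- v)) := germ_shearK vi.
have TS : cancel (germ_shear i (- v)) (germ_shear i v) := germ_shearVK vi.
have [|| e eE] := jacobian_saturated_regular (c := germ_shear i v c) hd.
- move=> a b ab; have [|u uE] := sqf (germ_shear i (- v) a) (germ_shear i (- v) b).
    by rewrite -rmorphXn -rmorphM /= -ab ST.
  by exists (germ_shear i v u); rewrite -[a]TS -rmorphM /= uE rmorph1.
- have [a b c'] := germ_der_is_derivation R i.
  have [|e eE] := H (fun f => germ_shear i (- v) (germ_der i (germ_shear i v f))).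
    split=> [f g|l f|f g]; first by rewrite !rmorphD /= a rmorphD.
      by rewrite !rmorphM /= germ_shear_cst b rmorphM /= germ_shear_cst.
    by rewrite !rmorphM /= c' rmorphD !rmorphM /= !ST.
  exists (germ_shear i v e); rewrite -[germ_der _ _]TS -rmorphM -rmorphM /=; congr germ_shear; exact: eE.
by exists (germ_shear i (- v) e); rewrite -[LHS]ST eE rmorphM; congr (_ * _); exact: ST.
Qed.

(** Geometrically, no component of a reduced hypersurface [h = 0] lies in the zero
    set of the derivatives of [h]. The hypothesis on all derivations is invariant
    under changes of coordinates, so [h] may be taken regular. *)
Theorem jacobian_saturated m (h c : germ R m) : h != 0 -> squarefree h ->
  (forall D, derivation D -> exists e, c * D h = e * h) -> exists e, c = e * h.
Proof.
case: m h c => [|m] h c; last by move: h c; rewrite -addn1 => h c; exact: jacobian_saturated_last.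
move=> h0 _ _; suff hU : h \is a GRing.unit by exists (c / h); rewrite divrK.
rewrite germ_unitE; apply: contraNneq h0 => h0; apply/eqP/gcoef_inj => a.
by rewrite gcoef0 -h0; congr gcoef; apply/mnmP; case.
Qed.

End Saturation.

(** * The generic combination of the generators *)

Section Dvd.
Variables (A : comNzRingType) (h : A).

Definition divides (x : A) := exists q, x = q * h.

Lemma divides0 : divides 0. Proof. by exists 0; rewrite mul0r. Qed.
Lemma dividesD x y : divides x -> divides y -> divides (x + y).
Proof. by move=> [p ->] [q ->]; exists (p + q); rewrite mulrDl. Qed.
Lemma dividesMl y x : divides x -> divides (y * x).
Proof. by move=> [p ->]; exists (y * p); rewrite mulrA. Qed.
Lemma dividesN x : divides x -> divides (- x).
Proof. by move=> [p ->]; exists (- p); rewrite mulNr. Qed.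
Lemma divides_sum (I : Type) (s : seq I) (P : pred I) (F : I -> A) :
  (forall i, P i -> divides (F i)) -> divides (\sum_(i <- s | P i) F i).
Proof. by move=> H; apply: big_ind => //; [exact: divides0|exact: dividesD]. Qed.

(** Lower the exponents one at a time: if all are positive, each [c * g j] satisfies
    the hypothesis with the exponent of [g j] decreased. *)
Lemma saturated_powers n (g : 'I_n -> A) :
  (forall c, (forall i, divides (c * g i)) -> divides c) ->
  forall (e : 'I_n -> nat) c, (forall i, divides (g i ^+ e i * c)) -> divides c.
Proof.
move=> sat e; move Ee : (\sum_i e i)%N => N; elim: N e Ee => [|N IH] e Ee c H.
  case: n g sat e Ee H => [|n] g sat e Ee H; first by apply: sat => -[].
  have e0 : e ord0 = 0%N by apply/eqP; have := Ee; rewrite big_ord_recl => /eqP; rewrite addn_eq0 => /andP[].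
  by have := H ord0; rewrite e0 expr0 mul1r.
case: (pselect (exists i, e i = 0%N)) => [[i ei]|He].
  by have := H i; rewrite ei expr0 mul1r.
apply: sat => j; have ej : (0 < e j)%N by rewrite lt0n; apply/eqP => ej; apply: He; exists j.
pose e' i := (e i - (i == j))%N.
apply: (IH e') => [|i]; last first.
  rewrite /e'; case: eqVneq => [->|_]; last first.
    by rewrite subn0 mulrA mulrC; apply: dividesMl; exact: H.
  have -> : g j ^+ (e j - 1) * (c * g j) = g j ^+ e j * c; last exact: H.
  by rewrite subn1 -[in RHS](prednK ej) exprSr mulrA mulrAC.
move: Ee; rewrite (bigD1 j) //= [X in _ -> X = _](bigD1 j) //= /e' eqxx subn1.
rewrite [X in _ -> (_ + X)%N = _](eq_bigr e); first by move: ej; lia.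
by move=> i /negbTE ->; rewrite subn0.
Qed.

End Dvd.

Section GenericForm.
Variables (R : realType) (m n : nat).
Local Notation C := R[i].
Local Notation O := (germ R m).
Local Notation P := (germ R (m + n)).
Local Notation pull := (@germ_pull R m n).
Variables (g : 'I_n -> O) (h : O).

Definition generic_form : P := \sum_(i < n) pull (g i) * ycoord R m i.
Local Notation f := generic_form.

Lemma ycoef_formM b (u : P) : ycoef b (f * u) =
  \sum_i if (0 < b i)%N then g i * ycoef (mnm_sub b (mnm1 i)) u else 0.
Proof.
rewrite /generic_form mulr_suml ycoef_sum; apply: eq_bigr => i _.
by rewrite -mulrA ycoef_pullM ycoef_yM; case: ifP; rewrite ?mulr0.
Qed.

Lemma ycoef_form0 : ycoef mnm0 f = 0.
Proof.
by rewrite -[f]mulr1 ycoef_formM big1 // => i _; rewrite mnm0E.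
Qed.

Lemma ycoef_form1 i : ycoef (mnm1 i) f = g i.
Proof.
rewrite -[f]mulr1 ycoef_formM (bigD1 i) //= mnm1E eqxx /= big1 ?addr0.
  rewrite -(rmorph1 pull) ycoef_pull (_ : mnm_sub _ _ = mnm0) ?eqxx ?mulr1 //.
  by apply/mnmP => j; rewrite mnmBE subnn mnm0E.
by move=> j ji; rewrite mnm1E eq_sym (negbTE ji).
Qed.

Hypothesis h0 : h != 0.
Hypothesis sat : forall c, (forall i, divides h (c * g i)) -> divides h c.

(** McCoy's argument. Modulo [h], the relations between the coefficients [U b] of [u]
    express [g i * U b] by coefficients with a larger share of [y i] in the exponent.
    Hence a power of each [g i] kills [U b], and so [h] divides [U b]. *)
Lemma form_regular (u : P) : divides (pull h) (f * u) -> divides (pull h) u.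
Proof.
move=> [v uv]; apply: (dvd_pull h0) => b.
have rel (b' : multinom n) : divides h (\sum_i if (0 < b' i)%N then g i * ycoef (mnm_sub b' (mnm1 i)) u else 0).
  by exists (ycoef b' v); rewrite -ycoef_formM uv mulrC ycoef_pullM mulrC.
have push i N : forall b' : multinom n, (mdeg b' <= b' i + N)%N -> divides h (g i ^+ N.+1 * ycoef b' u).
  elim: N => [|N IH] b' bN.
    have := rel (mnm_add b' (mnm1 i)); rewrite (bigD1 i) //= mnmDE mnm1E eqxx addn1 addmK.
    rewrite big1 ?addr0 // => j ji; rewrite ifF // mnmDE mnm1E eq_sym (negbTE ji) addn0.
    apply/negbTE; rewrite -eqn0Ngt; move: bN; rewrite mdegE (bigD1 i) //= addn0 (bigD1 j) //=; lia.
  have := rel (mnm_add b' (mnm1 i)); rewrite (bigD1 i) //= mnmDE mnm1E eqxx addn1 addmK.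
  move=> /(dividesMl (g i ^+ N.+1)); rewrite mulrDr => H.
  have -> : g i ^+ N.+2 * ycoef b' u = g i ^+ N.+1 * (g i * ycoef b' u).
    by rewrite exprSr mulrA.
  rewrite -[X in divides h X](addrK (g i ^+ N.+1 * (\sum_(j | j != i)
    if (0 < mnm_add b' (mnm1 i) j)%N then g j * ycoef (mnm_sub (mnm_add b' (mnm1 i)) (mnm1 j)) u else 0))).
  apply: dividesD => //; apply: dividesN; rewrite mulr_sumr; apply: divides_sum => j ji.
  case: ifPn => bj; last by rewrite mulr0; exact: divides0.
  rewrite mulrCA; apply: dividesMl; apply: IH.
  have := mdeg_sub1 bj; rewrite mdegD mdeg1 mnmBE mnmDE !mnm1E eqxx (negbTE ji).
  by move: bN; lia.
apply: (saturated_powers sat (e := fun=> (mdeg b).+1)) => i.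
by apply: push; rewrite leq_addl.
Qed.

(** If [p ^ 2] divides [h * f], the linear terms in [y] show that [p0 ^ 2] divides all
    [h * g i], where [p0] is [p] on the zero section. Then [h ^ 2 = p0 ^ 2 * c], and
    [c * g i] is divisible by [h]; so [c = e * h] and [h = p0 ^ 2 * e]. *)
Lemma squarefree_form (a : 'I_n -> O) : squarefree h -> h = \sum_i a i * g i ->
  squarefree (pull h * f).
Proof.
move=> sqf hE p q E; pose p0 := ycoef mnm0 p.
have key i : h * g i = ycoef mnm0 (germ_der (rshift m i) (p ^+ 2 * q)).
  rewrite -E ycoef_der ycoef_pullM mnm0E germ_cst1 mul1r add0m ycoef_form1 //.
have der2 i : germ_der (rshift m i) (p ^+ 2 * q) =
    p * (q * (germ_der (rshift m i) p *+ 2) + p * germ_der (rshift m i) q).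
  by have [_ _ DM] := germ_der_is_derivation R (rshift m i); rewrite expr2 !DM; ring.
have p00 : p0 != 0.
  apply/eqP => p00; case/eqP: h0; rewrite hE big1 // => i _.
  have : h * g i == 0 by rewrite key der2 ycoefM0 -/p0 p00 mul0r.
  by rewrite mulf_eq0 (negbTE h0) /= => /eqP ->; rewrite mulr0.
have q00 : ycoef mnm0 q = 0.
  have : p0 ^+ 2 * ycoef mnm0 q == 0.
    by rewrite expr2 -mulrA -!ycoefM0 mulrA -expr2 -E ycoef_pullM ycoef_form0 mulr0.
  by rewrite mulf_eq0 expf_eq0 (negbTE p00) /= => /eqP.
have hg i : h * g i = p0 ^+ 2 * ycoef mnm0 (germ_der (rshift m i) q).
  by rewrite key der2 ycoefM0 ycoefD !ycoefM0 q00 mul0r add0r mulrA.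
pose c := \sum_i a i * ycoef mnm0 (germ_der (rshift m i) q).
have hh : h * h = p0 ^+ 2 * c.
  by rewrite {2}hE /c !mulr_sumr; apply: eq_bigr => i _; rewrite mulrCA hg mulrCA.
have [e cE] : divides h c.
  apply: sat => i; exists (ycoef mnm0 (germ_der (rshift m i) q)).
  apply: (mulfI h0); rewrite mulrCA hg; by rewrite mulrA (mulrC c) -hh -mulrA (mulrC h (ycoef _ _)).
have hE' : h = p0 ^+ 2 * e by apply: (mulfI h0); rewrite hh cE mulrA [RHS]mulrC.
have [u pu] := sqf _ _ hE'.
have pU : p \is a GRing.unit.
  by rewrite germ_unitE gcoef0_pair; apply: (germ_inverseE (q := u)); rewrite mulrC.
by exists p^-1; rewrite mulrV.
Qed.

End GenericForm.

(** * Free modules of syzygies *)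

Section Fractions.
Variable A : idomainType.
Local Notation F := {fraction A}.

Lemma fraction_numden (x : F) : exists n d : A, d != 0 /\ x * FracField.tofrac d = FracField.tofrac n.
Proof.
elim/quotW: x => r; exists (\n_r), (\d_r); split; first exact: denom_ratioP.
rewrite [_ * _]piE !piE; apply/eqmodP; rewrite /= FracField.equivfE /FracField.mulf.
by rewrite !numden_Ratio ?mulf_neq0 ?oner_neq0 ?denom_ratioP // mulr1 mulr1 mulrC.
Qed.

Lemma common_denominator (I : finType) (x : I -> F) :
  exists d : A, d != 0 /\ exists y : I -> A, forall i, x i * FracField.tofrac d = FracField.tofrac (y i).
Proof.
have /choice[n /choice[d H]] := fun i => fraction_numden (x i).
have d0 i : d i != 0 by case: (H i).
exists (\prod_i d i); split; first by apply/prodf_neq0.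
exists (fun i => n i * \prod_(j | j != i) d j) => i.
by rewrite (bigD1 i) //= !rmorphM /= mulrA; case: (H i) => _ ->.
Qed.

(** The rows stay independent over the field of fractions; [d] is a common
    denominator of the entries of an inverse there. *)
Lemma independent_left_inverse (K J : finType) (S : K -> J -> A) :
  (forall t : K -> A, (forall j, \sum_k t k * S k j = 0) -> forall k, t k = 0) ->
  (#|K| <= #|J|)%N /\
  exists d (L : J -> K -> A), d != 0 /\ forall k l, \sum_j S k j * L j l = d * (k == l)%:R.
Proof.
move=> ind.
pose M : 'M[F]_(#|K|, #|J|) := \matrix_(i, j) FracField.tofrac (S (enum_val i) (enum_val j)).
have rf : row_free M.
  rewrite -kermx_eq0; apply/eqP/row_matrixP => i; rewrite row0.
  set u := row i (kermx M).
  have uM : u *m M = 0 by apply/sub_kermxP; exact: row_sub.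
  have [d [d0 [y yE]]] := common_denominator (fun l => u 0 l).
  have y0 : forall k, y (enum_rank k) = 0.
    apply: ind => j; apply/eqP; rewrite -tofrac_eq0 rmorph_sum; apply/eqP.
    have := congr1 (fun B : 'rV[F]_(#|J|) => B 0 (enum_rank j)) uM; rewrite !mxE => E.
    transitivity (FracField.tofrac d * \sum_l u 0 l * M l (enum_rank j)); last by rewrite E mulr0.
    rewrite mulr_sumr [RHS](reindex (@enum_rank K)) /=; last by apply: onW_bij; exact: enum_rank_bij.
    by apply: eq_bigr => k _; rewrite rmorphM /= -yE !mxE !enum_rankK mulrA (mulrC (FracField.tofrac d)).
  apply/rowP => l; rewrite [RHS]mxE; apply/eqP.
  have := yE l; rewrite -(enum_valK l) y0 rmorph0 => /eqP.
  by rewrite mulf_eq0 tofrac_eq0 (negbTE d0) orbF enum_valK.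
split; first by have := rank_leq_col M; rewrite (eqP rf).
have [d [d0 [y yE]]] := common_denominator (fun ij : 'I_(#|J|) * 'I_(#|K|) => pinvmx M ij.1 ij.2).
exists d, (fun j l => y (enum_rank j, enum_rank l)); split=> // k l.
apply/eqP; rewrite -tofrac_eq rmorph_sum; apply/eqP.
have := congr1 (fun B : 'M[F]_(#|K|) => B (enum_rank k) (enum_rank l)) (mulmxVp rf); rewrite !mxE => E.
transitivity (FracField.tofrac d * \sum_j M (enum_rank k) j * pinvmx M j (enum_rank l)); last first.
  by rewrite E rmorphM /= rmorph_nat (inj_eq enum_rank_inj).
rewrite mulr_sumr [RHS](reindex (@enum_rank J)) /=; last by apply: onW_bij; exact: enum_rank_bij.
by apply: eq_bigr => j _; rewrite rmorphM /= -yE /= [M _ _]mxE !enum_rankK mulrA mulrC.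
Qed.

End Fractions.

Section Bases.
Variable A : comNzRingType.
Implicit Types (J K : finType).

(** Vectors are functions on a finite type, so that two families of generators are
    put together by a sum of index types. *)
Definition is_basis J K (N : (J -> A) -> Prop) (S : K -> J -> A) :=
  [/\ forall k, N (S k),
      forall b, N b -> exists t : K -> A, forall j, b j = \sum_k t k * S k j &
      forall t : K -> A, (forall j, \sum_k t k * S k j = 0) -> forall k, t k = 0].

Definition has_basis J (N : (J -> A) -> Prop) := exists (K : finType) (S : K -> J -> A), is_basis N S.

Definition syzygy J (g b : J -> A) := \sum_j b j * g j = 0.

Lemma has_basis_iff J (N N' : (J -> A) -> Prop) : (forall b, N b <-> N' b) ->
  has_basis N -> has_basis N'.
Proof.
by move=> NN [K [S [SN Sgen Sind]]]; exists K, S; split=> // [k|b /NN]; [exact/NN|exact: Sgen].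
Qed.

Lemma sum_delta J (i : J) (F : J -> A) : \sum_j (j == i)%:R * F j = F i.
Proof. by rewrite (bigD1 i) //= eqxx mul1r big1 ?addr0 // => j /negbTE ->; rewrite mul0r. Qed.

(** Each adjoined combination contributes one free basis element, the relation that
    defines it. *)
Lemma basis_adjoin (J1 J2 : finType) (g1 : J1 -> A) (V : J2 -> J1 -> A) :
  has_basis (syzygy g1) ->
  has_basis (syzygy (fun j : J1 + J2 => match j with inl i => g1 i | inr l => \sum_i V l i * g1 i end)).
Proof.
move=> [K [S [Ssyz Sgen Sind]]].
pose T (k : K + J2) (j : J1 + J2) : A := match k, j with
  | inl k, inl i => S k i
  | inl k, inr _ => 0
  | inr l, inl i => - V l i
  | inr l, inr l' => (l == l')%:R end.
have sumL (t : K + J2 -> A) i : \sum_k t k * T k (inl i) =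
    \sum_k t (inl k) * S k i - \sum_l t (inr l) * V l i.
  by rewrite big_sumType /= -sumrN; congr (_ + _); apply: eq_bigr => l _; rewrite mulrN.
have sumR (t : K + J2 -> A) l : \sum_k t k * T k (inr l) = t (inr l).
  rewrite big_sumType /= big1 ?add0r => [|k _]; last by rewrite mulr0.
  by rewrite (eq_bigr (fun i => (i == l)%:R * t (inr i))) ?sum_delta // => i _; rewrite mulrC.
exists (K + J2)%type, T; split.
- case=> [k|l]; rewrite /syzygy big_sumType /=.
    by rewrite [X in _ + X]big1 ?addr0 => [|l _]; [exact: Ssyz|rewrite mul0r].
  rewrite (eq_bigr (fun i => - (V l i * g1 i))); last by move=> i _; rewrite mulNr.
  rewrite sumrN [X in _ + X](eq_bigr (fun l' => (l' == l)%:R * \sum_i V l' i * g1 i)).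
    by rewrite sum_delta addNr.
  by move=> l' _; rewrite eq_sym.
- move=> b; rewrite /syzygy big_sumType /= => bs.
  have [|t tE] := Sgen (fun i => b (inl i) + \sum_l b (inr l) * V l i).
    rewrite /syzygy -[RHS]bs (eq_bigr (fun i => b (inl i) * g1 i + \sum_l b (inr l) * V l i * g1 i)).
      rewrite big_split /=; congr (_ + _); rewrite exchange_big /=; apply: eq_bigr => l _.
      by rewrite mulr_sumr; apply: eq_bigr => i _; rewrite mulrA.
    by move=> i _; rewrite mulrDl mulr_suml.
  exists (fun k => match k with inl k => t k | inr l => b (inr l) end) => -[i|l].
    by rewrite sumL -tE addrK.
  by rewrite sumR.
- move=> t t0; have tr l : t (inr l) = 0 by rewrite -(sumR t l) t0.
  case=> [k|l //]; apply: (Sind (fun k => t (inl k))) => i.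
  have := t0 (inl i); rewrite sumL [X in _ - X]big1 ?subr0 // => l _; by rewrite tr mul0r.
Qed.

End Bases.

Section LocalRemoval.
Variables (R : realType) (m : nat).
Local Notation O := (germ R m).

(** Over a local ring, splitting off a rank one free summand on which a
    coordinate takes the value [1] leaves a free module: one basis element has
    an invertible coordinate and serves as a pivot. *)
Lemma basis_remove (J : finType) (N : (J -> O) -> Prop) (e : J) (v : J -> O) :
  (forall b c k, N b -> N c -> N (fun j => b j - k * c j)) ->
  N v -> v e = 1 -> has_basis N -> has_basis (fun b => N b /\ b e = 0).
Proof.
move=> NB Nv ve [K [S [SN Sgen Sind]]].
have [t tE] := Sgen v Nv.
have [k0 pU] : exists k0, S k0 e \is a GRing.unit.
  apply: contrapT => H; have := congr1 (@germ_at0 R m) (tE e).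
  rewrite ve rmorph1 rmorph_sum big1 => [/eqP|k _]; first by rewrite oner_eq0.
  rewrite rmorphM /= (_ : germ_at0 (S k e) = 0) ?mulr0 //.
  by apply/eqP/negPn/negP => Sk; apply: H; exists k; rewrite germ_unitE.
pose c k := S k e / S k0 e.
pose K' := {k | k != k0}.
pose S' (x : K') j := S (val x) j - c (val x) * S k0 j.
have sumK (F : K -> O) : \sum_(x : K') F (val x) = \sum_(k | k != k0) F k.
  by rewrite (big_sub (mem [pred k | k != k0])).
have split_sum (t' : K -> O) j : \sum_k t' k * S k j =
    \sum_(x : K') t' (val x) * S' x j + (t' k0 + \sum_(x : K') t' (val x) * c (val x)) * S k0 j.
  rewrite (bigD1 k0) //= mulrDl addrCA; congr (_ + _).
  rewrite mulr_suml -big_split /= -(sumK (fun k => t' k * S k j)); apply: eq_bigr => x _.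
  by rewrite mulrBr mulrA subrK.
have S'e x : S' x e = 0 by rewrite /S' /c divrK // subrr.
exists K', S'; split.
- by move=> x; split=> //; apply: NB.
- move=> b [/Sgen[t' t'E] be]; exists (fun x => t' (val x)) => j.
  rewrite t'E split_sum; set T := t' k0 + _.
  suff -> : T = 0 by rewrite mul0r addr0.
  have := be; rewrite t'E split_sum -/T big1 ?add0r => [/eqP|x _]; last by rewrite S'e mulr0.
  by rewrite mulf_eq0 => /orP[/eqP//|/eqP p0]; move: pU; rewrite p0 unitr0.
- move=> t' t'0 x.
  pose t1 k := if insub k is Some y then t' (y : K') else - \sum_(y : K') t' y * c (val y).
  have t1v y : t1 (val y) = t' y by rewrite /t1 valK.
  have t1k0 : t1 k0 = - \sum_(y : K') t' y * c (val y) by rewrite /t1 insubF // eqxx.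
  rewrite -t1v; apply: Sind => j; rewrite split_sum t1k0.
  rewrite (eq_bigr (fun y => t' y * S' y j)) => [|y _]; last by rewrite t1v.
  rewrite t'0 add0r [X in _ + X](eq_bigr (fun y => t' y * c (val y))) => [|y _]; last by rewrite t1v.
  by rewrite addNr mul0r.
Qed.

(** Schanuel's lemma for two systems of generators of an ideal: adjoin [g2] to [g1],
    then remove the members of [g1], now redundant, one after the other. *)
Lemma basis_change (J1 J2 : finType) (g1 : J1 -> O) (g2 : J2 -> O) V U :
  (forall l, g2 l = \sum_i V l i * g1 i) -> (forall i, g1 i = \sum_l U i l * g2 l) ->
  has_basis (syzygy g1) -> has_basis (syzygy g2).
Proof.
move=> g2E g1E /(basis_adjoin V) H.
pose g (j : J1 + J2) := match j with inl i => g1 i | inr l => g2 l end.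
pose N (s : seq J1) (b : J1 + J2 -> O) := syzygy g b /\ forall i, i \in s -> b (inl i) = 0.
have H0 : has_basis (N [::]).
  apply: has_basis_iff H => b; rewrite /N /syzygy.
  rewrite (eq_bigr (fun j => b j * g j)); first by split=> [|[]].
  by case=> [i|l] _ //=; rewrite g2E.
have step s : has_basis (N s).
  elim: s => [//|i s IH].
  have [iin|inot] := boolP (i \in s).
    apply: has_basis_iff IH => b; split=> -[bs b0]; split=> // l ls.
      by apply: b0; move: ls; rewrite inE => /orP[/eqP ->|].
    by apply: b0; rewrite inE ls orbT.
  pose v (j : J1 + J2) := match j with inl i' => (i' == i)%:R | inr l => - U i l end.
  have NB b c k : N s b -> N s c -> N s (fun j => b j - k * c j).
    move=> [bs b0] [cs c0]; split=> [|l ls]; last by rewrite b0 // c0 // mulr0 subr0.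
    rewrite /syzygy (eq_bigr (fun j => b j * g j - k * (c j * g j))); last first.
      by move=> j _; rewrite mulrBl mulrA.
    by rewrite sumrB -mulr_sumr bs cs mulr0 subr0.
  have Nv : N s v.
    split=> [|l ls]; last by rewrite /v; case: eqP ls inot => // -> ->.
    rewrite /syzygy big_sumType /= sum_delta g1E -big_split big1 //= => l _.
    by rewrite mulNr addrN.
  have ve : v (inl i) = 1 by rewrite /v eqxx.
  apply: has_basis_iff (basis_remove NB Nv ve IH) => b; split.
    by case; case=> bs b0 bi; split=> // l; rewrite inE => /orP[/eqP ->|/b0].
  case=> bs b0; split; last by apply: b0; rewrite mem_head.
  by split=> // l ls; apply: b0; rewrite inE ls orbT.
have [K [S [SN Sgen Sind]]] := step (enum J1).
exists K, (fun k l => S k (inr l)); split.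
- move=> k; have [] := SN k; rewrite /syzygy big_sumType /= big1 ?add0r // => i _.
  by have [_ ->] := SN k; rewrite ?mul0r // mem_enum.
- move=> b bs; have [|t tE] := Sgen (fun j => if j is inr l then b l else 0).
    by split=> //; rewrite /syzygy big_sumType /= big1 ?add0r // => i _; rewrite mul0r.
  by exists t => l; rewrite -(tE (inr l)).
- move=> t t0; apply: Sind => -[i|l]; last exact: t0.
  by rewrite big1 // => k _; have [_ ->] := SN k; rewrite ?mulr0 // mem_enum.
Qed.

End LocalRemoval.

Section BaseChange.
Variables (R : realType) (m n : nat).
Local Notation O := (germ R m).
Local Notation P := (germ R (m + n)).
Local Notation pull := (@germ_pull R m n).

(** Flatness of the germs on the product over the germs on the first factor, in
    the case at hand. Coefficient by coefficient a syzygy is a unique combination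
    of the basis; up to the denominator [d] its coordinates are germs on the
    product, and [dvd_pull] removes the denominator. *)
Lemma basis_pull (J K : finType) (g : J -> O) (S : K -> J -> O) :
  is_basis (syzygy g) S -> is_basis (syzygy (fun j => pull (g j))) (fun k j => pull (S k j)).
Proof.
move=> [Ssyz Sgen Sind]; split.
- move=> k; rewrite /syzygy -[RHS](rmorph0 pull) -(Ssyz k) rmorph_sum.
  by apply: eq_bigr => j _; rewrite rmorphM.
- move=> b bs.
  have [_ [d [L [d0 LE]]]] := independent_left_inverse Sind.
  have bsy be : syzygy g (fun j => ycoef be (b j)).
    rewrite /syzygy -[RHS](ycoef0 R m be) -bs ycoef_sum; apply: eq_bigr => j _.
    by rewrite mulrC -ycoef_pullM mulrC.
  have /choice[t tE] := fun be => Sgen _ (bsy be).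
  pose c l := \sum_j pull (L j l) * b j.
  have cE be l : ycoef be (c l) = t be l * d.
    rewrite /c ycoef_sum (eq_bigr (fun j => \sum_k t be k * (S k j * L j l))); last first.
      by move=> j _; rewrite ycoef_pullM tE mulr_sumr; apply: eq_bigr => k _; rewrite mulrCA (mulrC (L j l)).
    rewrite exchange_big /= (eq_bigr (fun k => (k == l)%:R * (t be k * d))) ?sum_delta //.
    by move=> k _; rewrite -mulr_sumr LE mulrC -mulrA mulrCA (mulrC d).
  have /choice[T TE] : forall l, exists T, c l = T * pull d.
    by move=> l; apply: dvd_pull => // be; exists (t be l).
  have tT be l : ycoef be (T l) = t be l.
    by apply: (mulfI d0); rewrite -ycoef_pullM mulrC -TE cE mulrC.
  exists T => j; apply: ycoef_inj => be; rewrite tE ycoef_sum; apply: eq_bigr => k _.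
  by rewrite [T k * _]mulrC ycoef_pullM tT mulrC.
- move=> T T0 k; apply: ycoef_inj => be; rewrite ycoef0.
  apply: (Sind (fun k => ycoef be (T k))) => j.
  rewrite -[RHS](ycoef0 R m be) -(T0 j) ycoef_sum; apply: eq_bigr => l _.
  by rewrite mulrC -ycoef_pullM mulrC.
Qed.

End BaseChange.

(** * Logarithmic derivations *)

Lemma big_option (V : nmodType) (I : finType) (F : option I -> V) :
  \sum_o F o = F None + \sum_i F (Some i).
Proof.
rewrite (bigD1 None) //=; congr (_ + _).
rewrite (reindex_omap Some id) => [|[i|]] //=.
by apply: eq_bigl => i; rewrite eqxx.
Qed.

Section LogDerivations.
Variables (R : realType) (m : nat).
Local Notation O := (germ R m).
Implicit Types (h : O).

Definition tjurina_gen h (o : option 'I_m) : O := if o is Some i then germ_der i h else h.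

Definition vec_der (v : 'I_m -> O) (f : O) : O := \sum_i v i * germ_der i f.

Lemma vec_der_coord v j : vec_der v (germ_coord R j) = v j.
Proof.
rewrite /vec_der (bigD1 j) //= germ_der_coord eqxx mulr1 big1 ?addr0 // => i ij.
by rewrite germ_der_coord (negbTE ij) mulr0.
Qed.

Lemma syzygy_tjurina h (v : option 'I_m -> O) :
  syzygy (tjurina_gen h) v <-> vec_der (fun i => v (Some i)) h = - v None * h.
Proof.
rewrite /syzygy big_option /= mulNr -[X in _ <-> X = _]/(\sum_i v (Some i) * germ_der i h).
split=> [/eqP|->]; last by rewrite addrN.
by rewrite addrC addr_eq0 => /eqP.
Qed.

(** Logarithmic derivations are the syzygies of the partial derivatives of [h]
    and [h] itself, so a free module of them has a finite basis, of at most [m]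
    elements because [m + 1] vectors of length [m] are dependent. *)
Lemma log_derivations_basis h : h != 0 -> free_submodule (log_derivations h) ->
  has_basis (syzygy (tjurina_gen h)).
Proof.
move=> h0 [I [b [bP bgen bind]]].
have bD i : derivation (b i) by case: (bP i).
have /choice[al alE] : forall i, exists a, b i h = a * h by move=> i; case: (bP i).
have bE i f : b i f = \sum_j b i (germ_coord R j) * germ_der j f := derivation_vecE (bD i) f.
have evalsum (T : Type) (s : seq T) (c : T -> O) (d : T -> O -> O^o) f :
    (\sum_(i <- s) c i *: d i) f = \sum_(i <- s) c i * d i f.
  by elim: s => [|i s IH]; rewrite ?big_nil // !big_cons -IH.
have ind (s : seq I) (t : 'I_(size s) -> O) : uniq s ->
    (forall j, \sum_k t k * b (tnth (in_tuple s) k) (germ_coord R j) = 0) -> forall k, t k = 0.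
  move=> us t0 k.
  pose a i := if insub (index i s) is Some l then t (l : 'I_(size s)) else 0.
  have aE l : a (tnth (in_tuple s) l) = t l.
    rewrite /a (tnth_nth (tnth (in_tuple s) l)) index_uniq //= insubT //= => ls.
    by congr t; apply/val_inj.
  rewrite -aE; apply: (bind s a us); last by rewrite mem_tnth.
  apply/funext => f; rewrite evalsum big_tnth /=.
  rewrite (eq_bigr (fun l => \sum_j t l * b (tnth (in_tuple s) l) (germ_coord R j) * germ_der j f)); last first.
    by move=> l _; rewrite aE bE mulr_sumr; apply: eq_bigr => j _; rewrite mulrA.
  rewrite exchange_big /= big1 // => j _; by rewrite -mulr_suml t0 mul0r.
have bound (s : seq I) : uniq s -> (size s <= m)%N.
  move=> us; have [|+ _] := @independent_left_inverse _ 'I_(size s) 'I_m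
    (fun k j => b (tnth (in_tuple s) k) (germ_coord R j)); first by move=> t; exact: ind.
  by rewrite !card_ord.
have exn : exists n, `[< exists s : seq I, uniq s /\ size s = n >].
  by exists 0%N; apply/asboolP; exists [::].
have bdn n : `[< exists s : seq I, uniq s /\ size s = n >] -> (n <= m)%N.
  by move=> /asboolP[s [us <-]]; exact: bound.
have [N /asboolP[s [us sN]] Nmax] := ex_maxnP exn bdn.
have all_s i : i \in s.
  apply: contrapT => /negP ins.
  have /Nmax : `[< exists s : seq I, uniq s /\ size s = N.+1 >].
    by apply/asboolP; exists (i :: s); rewrite /= ins us sN.
  by rewrite ltnn.
pose e (k : 'I_(size s)) := tnth (in_tuple s) k.
have sum_e i (V : nmodType) (x : V) : \sum_k (if i == e k then x else 0) = x.
  have lt : (index i s < size s)%N by rewrite index_mem.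
  rewrite (bigD1 (Ordinal lt)) //= /e (tnth_nth i) /= nth_index // eqxx big1 ?addr0 // => k ki.
  rewrite ifF //; apply/negbTE; apply: contraNneq ki => iE; apply/eqP/val_inj => /=.
  by rewrite iE (tnth_nth i) /= index_uniq.
exists 'I_(size s), (fun k o => if o is Some j then b (e k) (germ_coord R j) else - al (e k)).
split.
- move=> k; apply/syzygy_tjurina; rewrite opprK -alE.
  by rewrite [RHS]bE.
- move=> v /syzygy_tjurina vh.
  have [|s' [a aE]] := bgen (vec_der (fun i => v (Some i))).
    by split; [exact: derivation_vec|exists (- v None)].
  pose t k := \sum_(i <- s') if i == e k then a i else 0.
  have tE f : vec_der (fun i => v (Some i)) f = \sum_k t k * b (e k) f.
    rewrite aE evalsum.
    rewrite (eq_bigr (fun k => \sum_(i <- s') (if i == e k then a i * b i f else 0))); last first.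
      by move=> k _; rewrite mulr_suml; apply: eq_bigr => i _; case: eqP => [->|]; rewrite ?mul0r.
    by rewrite exchange_big; apply: eq_bigr => i _; rewrite sum_e.
  exists t => -[j|]; first by rewrite -tE vec_der_coord.
  apply: (mulIf h0); rewrite -[LHS]opprK -mulNr -vh tE mulr_suml -sumrN.
  by apply: eq_bigr => k _; rewrite alE mulrN mulNr mulrA.
- move=> t t0; apply: (ind s t us) => j; exact: (t0 (Some j)).
Qed.

Lemma germ_derC i j (f : O) : germ_der i (germ_der j f) = germ_der j (germ_der i f).
Proof.
apply: gcoef_inj => a; rewrite !gcoef_der !mnmDE !mnm1E.
have -> : mnm_add (mnm_add a (mnm1 i)) (mnm1 j) = mnm_add (mnm_add a (mnm1 j)) (mnm1 i).
  by apply/mnmP => l; rewrite !mnmDE addnAC.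
by case: (eqVneq i j) => [->//|ij]; rewrite !addn0 mulrCA.
Qed.

(** The commutator of a logarithmic derivation with a partial derivative shows
    that logarithmic derivations preserve the Tjurina ideal. *)
Lemma log_preserves_tjurina h (v : 'I_m -> O) al x : vec_der v h = al * h ->
  tjurina_ideal h x -> tjurina_ideal h (vec_der v x).
Proof.
have idB y z : tjurina_ideal h y -> tjurina_ideal h z -> tjurina_ideal h (y + z).
  by move=> [a ->] [c ->]; exists (fun o => a o + c o); rewrite -big_split; apply: eq_bigr => o _; rewrite mulrDl.
have idM y z : tjurina_ideal h z -> tjurina_ideal h (y * z).
  by move=> [a ->]; exists (fun o => y * a o); rewrite mulr_sumr; apply: eq_bigr => o _; rewrite mulrA.
have id0 : tjurina_ideal h 0 by exists (fun=> 0); rewrite big1 // => o _; rewrite mul0r.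
have idg o : tjurina_ideal h (tjurina_gen h o).
  exists (fun o' => (o' == o)%:R); rewrite sum_delta //.
have idS (T : Type) (s : seq T) F : (forall k, tjurina_ideal h (F k)) -> tjurina_ideal h (\sum_(k <- s) F k).
  by move=> HF; apply: big_ind.
move=> vh [a ->]; have dv := derivation_vec v; rewrite -/(vec_der v) in dv.
rewrite (derivation_sum_arg _ _ _ dv); apply: (idS _ _) => o.
have [_ _ vM] := dv; rewrite vM; apply: (idB _ _); first exact/idM/idg.
apply: (idM _ _); case: o => [j|]; last by rewrite vh; apply/idM/(idg None).
have [_ _ jM] := germ_der_is_derivation R j.
have : germ_der j (vec_der v h) = \sum_i germ_der j (v i) * germ_der i h + vec_der v (germ_der j h).
  rewrite /vec_der (derivation_sum_arg _ _ _ (germ_der_is_derivation R j)) -big_split.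
  by apply: eq_bigr => i _; rewrite jM (germ_derC j i).
move/eqP; rewrite addrC -subr_eq => /eqP <-; apply: (idB _ _).
  by rewrite vh jM; apply: (idB _ _); [apply/idM/(idg None)|apply/idM/(idg (Some j))].
rewrite -mulN1r; apply: (idM _ _); apply: (idS _ _) => i; exact/idM/(idg (Some i)).
Qed.

End LogDerivations.

(** * Logarithmic derivations of the product *)

Section FreeSubmodule.
Variables (A : nzRingType) (V : lmodType A) (Q : set V) (K : finType) (b : K -> V).

Lemma finite_free_submodule : (forall k, Q (b k)) ->
  (forall v, Q v -> exists a : K -> A, v = \sum_k a k *: b k) ->
  (forall a : K -> A, \sum_k a k *: b k = 0 -> forall k, a k = 0) ->
  free_submodule Q.
Proof.
move=> bQ bgen bind; exists K, b; split=> // [v /bgen[a ->]|s a us s0 k ks].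
  by exists (index_enum K), a.
have := bind (fun k => if k \in s then a k else 0) _ k; rewrite ks; apply.
rewrite -[RHS]s0 [RHS]big_uniq //= [RHS]big_mkcond /=; apply: eq_bigr => l _.
by case: ifP => _; rewrite ?scale0r.
Qed.

End FreeSubmodule.

Section Lifting.
Variables (R : realType) (m n : nat).
Local Notation O := (germ R m).
Local Notation P := (germ R (m + n)).
Local Notation pull := (@germ_pull R m n).
Local Notation y := (ycoord R m).
Variables (h : O) (g : 'I_n -> O).
Hypothesis hfree : free_divisor h.
Hypothesis gI : ideal_gen g = tjurina_ideal h.

Let h0 : h != 0. Proof. by case: hfree. Qed.
Let hsqf : squarefree h. Proof. by case: hfree. Qed.
Local Notation f := (generic_form g).
Local Notation ph := (pull h).

Lemma ideal_genM (I : finType) (G : I -> O) i : ideal_gen G (G i).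
Proof. by exists (fun j => (j == i)%:R); rewrite sum_delta. Qed.

Lemma tjurina_of_gens : exists U : option 'I_m -> 'I_n -> O,
  forall o, tjurina_gen h o = \sum_l U o l * g l.
Proof.
have /choice[U UE] : forall o, exists a : 'I_n -> O, tjurina_gen h o = \sum_l a l * g l; last by exists U.
move=> o; have : tjurina_ideal h (tjurina_gen h o) by exact: (ideal_genM (tjurina_gen h)).
by rewrite -gI.
Qed.

Lemma gens_of_tjurina : exists V : 'I_n -> option 'I_m -> O,
  forall l, g l = \sum_o V l o * tjurina_gen h o.
Proof.
have /choice[V VE] : forall l, exists a : option 'I_m -> O, g l = \sum_o a o * tjurina_gen h o; last by exists V.
by move=> l; have := ideal_genM g l; rewrite gI.
Qed.

Lemma gens_saturated c : (forall i, divides h (c * g i)) -> divides h c.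
Proof.
move=> H; apply: (jacobian_saturated h0 hsqf) => D dD.
have [U UE] := tjurina_of_gens.
rewrite (derivation_vecE dD) mulr_sumr; apply: divides_sum => j _.
have E : germ_der j h = \sum_l U (Some j) l * g l := UE (Some j).
rewrite mulrCA; apply: dividesMl; rewrite E mulr_sumr.
by apply: divides_sum => l _; rewrite mulrCA; exact: dividesMl.
Qed.

Lemma form_neq0 : f != 0.
Proof.
apply: contraNneq h0 => f0; have [U /(_ None) /= ->] := tjurina_of_gens.
by rewrite big1 // => l _; rewrite -(ycoef_form1 g) f0 ycoef0 mulr0.
Qed.

Lemma pull_h_neq0 : ph != 0.
Proof. by rewrite -(rmorph0 pull) (inj_eq (@germ_pull_inj R m n)). Qed.

Lemma product_squarefree : squarefree (ph * f).
Proof.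
have [U /(_ None) /= UE] := tjurina_of_gens.
exact: (squarefree_form h0 gens_saturated hsqf UE).
Qed.

Lemma der_pull D u : derivation D ->
  D (pull u) = \sum_j D (germ_coord R (lshift n j)) * pull (germ_der j u).
Proof.
move=> dD; rewrite (derivation_vecE dD) big_split_ord /= [X in _ + X]big1 ?addr0.
  by apply: eq_bigr => j _; rewrite pull_der.
by move=> l _; rewrite pull_yder mulr0.
Qed.

Lemma der_form D : derivation D ->
  D f = \sum_l D (pull (g l)) * y l + \sum_l pull (g l) * D (y l).
Proof.
move=> dD; have [_ _ DM] := dD.
by rewrite (derivation_sum_arg _ _ _ dD) -big_split; apply: eq_bigr => l _; rewrite DM.
Qed.

Section Basis.
Variables (K1 K2 : finType) (S1 : K1 -> option 'I_m -> O) (S2 : K2 -> 'I_n -> O).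
Hypothesis S1b : is_basis (syzygy (tjurina_gen h)) S1.
Hypothesis S2b : is_basis (syzygy g) S2.

Let delta k := vec_der (fun j => S1 k (Some j)).

Lemma delta_h k : delta k h = - S1 k None * h.
Proof. by apply/syzygy_tjurina; case: S1b. Qed.

Lemma delta_gens : exists c : K1 -> 'I_n -> 'I_n -> O,
  forall k l, delta k (g l) = \sum_l' c k l l' * g l'.
Proof.
have /choice[c cE] : forall kl : K1 * 'I_n, exists a : 'I_n -> O, delta kl.1 (g kl.2) = \sum_l' a l' * g l'.
  move=> [k l] /=; have : tjurina_ideal h (delta k (g l)); last by rewrite -gI.
  by apply: (log_preserves_tjurina (delta_h k)); rewrite -gI; exact: ideal_genM.
by exists (fun k l => c (k, l)) => k l; exact: (cE (k, l)).
Qed.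

(** Components of the vector fields of the basis: the lifts of the basis of
    [Der (- log h)], corrected so as to annihilate the form; the syzygies of [g] as
    vertical fields; and, for [inr None], the Euler field of the second factor. *)
Definition lift_vec (c : K1 -> 'I_n -> 'I_n -> O) (i : K1 + option K2) (x : 'I_(m + n)) : P :=
  match i, fintype.split x with
  | inl k, inl j => pull (S1 k (Some j))
  | inl k, inr l' => - \sum_l y l * pull (c k l l')
  | inr (Some k), inl j => 0
  | inr (Some k), inr l => pull (S2 k l)
  | inr None, inl j => 0
  | inr None, inr l => y l
  end.

Arguments lift_vec : simpl never.

Variable c : K1 -> 'I_n -> 'I_n -> O.
Hypothesis cE : forall k l, delta k (g l) = \sum_l' c k l l' * g l'.
Let W := lift_vec c.
Let B i := vec_der (W i).

Let Bder i : derivation (B i). Proof. exact: derivation_vec. Qed.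

Let Bl i j : B i (germ_coord R (lshift n j)) = W i (lshift n j).
Proof. exact: vec_der_coord. Qed.

Let Br i l : B i (y l) = W i (rshift m l).
Proof. exact: vec_der_coord. Qed.

Let Wl1 k j : W (inl k) (lshift n j) = pull (S1 k (Some j)).
Proof. by rewrite /W /lift_vec (unsplitK (inl j)). Qed.
Let Wl2 i j : W (inr i) (lshift n j) = 0.
Proof. by rewrite /W /lift_vec (unsplitK (inl j)); case: i. Qed.
Let Wr1 k l : W (inl k) (rshift m l) = - \sum_l' y l' * pull (c k l' l).
Proof. by rewrite /W /lift_vec (unsplitK (inr l)). Qed.
Let Wr2 k l : W (inr (Some k)) (rshift m l) = pull (S2 k l).
Proof. by rewrite /W /lift_vec (unsplitK (inr l)). Qed.
Let Wr3 l : W (inr None) (rshift m l) = y l.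
Proof. by rewrite /W /lift_vec (unsplitK (inr l)). Qed.

Lemma lift_pull k u : B (inl k) (pull u) = pull (delta k u).
Proof.
rewrite (der_pull _ (Bder _)) rmorph_sum; apply: eq_bigr => j _.
by rewrite Bl Wl1 rmorphM.
Qed.

Lemma vertical_pull i u : B (inr i) (pull u) = 0.
Proof. by rewrite (der_pull _ (Bder _)) big1 // => j _; rewrite Bl Wl2 mul0r. Qed.

Lemma lift_form k : B (inl k) f = 0.
Proof.
rewrite (der_form (Bder _)).
rewrite [X in _ + X](eq_bigr (fun l => - \sum_l' y l' * pull (c k l' l) * pull (g l))); last first.
  by move=> l _; rewrite Br Wr1 mulrN mulr_sumr; congr (- _); apply: eq_bigr => l' _; rewrite mulrC.
rewrite sumrN exchange_big /= -sumrB big1 // => l _.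
rewrite lift_pull cE rmorph_sum mulr_suml -sumrB big1 // => l' _.
by rewrite rmorphM /= -[X in _ - X]mulrA [X in _ - X]mulrC subrr.
Qed.

Lemma syzygy_form k : B (inr (Some k)) f = 0.
Proof.
rewrite (der_form (Bder _)) big1 ?add0r => [|l _]; last by rewrite vertical_pull mul0r.
have [Ssyz _ _] := S2b; rewrite -[RHS](rmorph0 pull) -(Ssyz k) rmorph_sum.
by apply: eq_bigr => l _; rewrite Br Wr2 rmorphM mulrC.
Qed.

Lemma euler_form : B (inr None) f = f.
Proof.
rewrite (der_form (Bder _)) big1 ?add0r => [|l _]; last by rewrite vertical_pull mul0r.
by apply: eq_bigr => l _; rewrite Br Wr3.
Qed.

Lemma lift_log i : exists a, B i (ph * f) = a * (ph * f).
Proof.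
have [_ _ BM] := Bder i; rewrite BM; case: i BM => [k|[k|]] _.
- rewrite lift_pull lift_form mulr0 addr0 delta_h rmorphM /=.
  by exists (pull (- S1 k None)); rewrite mulrA.
- by exists 0; rewrite vertical_pull syzygy_form !mul0r mulr0 addr0.
- by exists 1; rewrite vertical_pull euler_form mul0r add0r mul1r.
Qed.

(** As [f] is regular modulo [h], a logarithmic derivation of [h * f] is logarithmic
    for [h], so a combination of the lifts has the same horizontal part. The
    difference is vertical and logarithmic for [f]: up to a multiple of the Euler
    field it is a syzygy of [g]. *)
Lemma lift_span D : derivation D -> (exists a, D (ph * f) = a * (ph * f)) ->
  exists a : K1 + option K2 -> P, forall u, D u = \sum_i a i * B i u.
Proof.
move=> dD [a DF]; have [_ _ DM] := dD.
have [w wE] : divides ph (D ph).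
  apply: (form_regular h0 gens_saturated); exists (a * f - D f).
  have E : D ph * f = a * (ph * f) - ph * D f by rewrite -DF DM addrK.
  by rewrite mulrC E mulrBl -mulrA (mulrC f) (mulrC ph (D f)).
have [_ S1gen _] := basis_pull n S1b.
pose v (o : option 'I_m) := if o is Some j then D (germ_coord R (lshift n j)) else - w.
have [|T TE] := S1gen v.
  rewrite /syzygy big_option /= mulNr -wE (der_pull _ dD) addrC subrr //.
pose D' u := D u + (-1) * \sum_k T k * B (inl k) u.
have dD' : derivation D'.
  apply: derivationDl => //; apply: derivationZl.
  split=> [u u'|k u|u u'].
  - by rewrite -big_split; apply: eq_bigr => l _; have [-> _ _] := Bder (inl l); rewrite mulrDr.
  - by rewrite mulr_sumr; apply: eq_bigr => l _; have [_ -> _] := Bder (inl l); rewrite mulrCA.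
  - rewrite mulr_suml mulr_sumr -big_split; apply: eq_bigr => l _ /=.
    by have [_ _ ->] := Bder (inl l); rewrite mulrDr mulrA (mulrCA (T l) u).
have D'x j : D' (germ_coord R (lshift n j)) = 0.
  rewrite /D' mulN1r; apply/eqP; rewrite subr_eq0; apply/eqP.
  by apply: etrans (TE (Some j)) _; apply: eq_bigr => k _; rewrite Bl Wl1.
have D'pull u : D' (pull u) = 0.
  by rewrite (der_pull _ dD') big1 // => j _; rewrite D'x mul0r.
have [a' D'f] : exists a', D' f = a' * f.
  exists (a - w); rewrite /D' [X in _ * X]big1 ?mulr0 ?addr0 => [|k _]; last first.
    by rewrite lift_form mulr0.
  have E : ph * D f = a * (ph * f) - D ph * f by rewrite -DF DM [X in X - _]addrC addrK.
  by apply: (mulfI pull_h_neq0); rewrite E wE mulrBl mulrBr -mulrA !(mulrCA ph).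
have [_ S2gen _] := basis_pull n S2b.
have [|T2 T2E] := S2gen (fun l => D' (y l) - a' * y l).
  rewrite /syzygy; apply/eqP; under eq_bigr do rewrite mulrBl.
  rewrite sumrB subr_eq0; apply/eqP.
  transitivity (D' f).
    rewrite (der_form dD') [X in _ = X + _]big1 ?add0r => [|l _]; last by rewrite D'pull mul0r.
    by apply: eq_bigr => l _; rewrite mulrC.
  rewrite D'f mulr_sumr; apply: eq_bigr => l _; by rewrite -mulrA (mulrC (y l)).
exists (fun i => match i with inl k => T k | inr (Some k) => T2 k | inr None => a' end) => u.
have DE u' : D u' = D' u' + \sum_k T k * B (inl k) u' by rewrite /D' mulN1r subrK.
rewrite DE big_sumType /= addrC; congr (_ + _).
rewrite (derivation_vecE dD') big_split_ord /= big1 ?add0r => [|j _]; last by rewrite D'x mul0r.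
have vert i u' : B (inr i) u' = \sum_l W (inr i) (rshift m l) * germ_der (rshift m l) u'.
  rewrite /B /vec_der [LHS]big_split_ord /= [X in X + _]big1; first by rewrite add0r.
  by move=> j _; rewrite [X in X * _](Wl2 i j) mul0r.
rewrite big_option !vert.
rewrite (eq_bigr (fun l => a' * (W (inr None) (rshift m l) * germ_der (rshift m l) u) +
    \sum_k T2 k * (W (inr (Some k)) (rshift m l) * germ_der (rshift m l) u))).
  rewrite big_split /= -mulr_sumr exchange_big /=; congr (_ + _).
  by apply: eq_bigr => k _; rewrite vert mulr_sumr.
move=> l _; rewrite -[D' _](subrK (a' * y l)) T2E mulrDl addrC Wr3 mulrA; congr (_ + _).
by rewrite mulr_suml; apply: eq_bigr => k _; rewrite Wr2 mulrA.
Qed.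

Lemma lift_independent (a : K1 + option K2 -> P) :
  (forall u, \sum_i a i * B i u = 0) -> forall i, a i = 0.
Proof.
move=> a0.
have ax x : \sum_i a i * W i x = 0.
  by rewrite -[RHS](a0 (germ_coord R x)); apply: eq_bigr => i _; rewrite /B vec_der_coord.
have [_ _ S1ind] := basis_pull n S1b; have [S2syz _ S2ind] := basis_pull n S2b.
have left0 j : \sum_k a (inl k) * pull (S1 k (Some j)) = 0.
  have := ax (lshift n j); rewrite big_sumType /= [X in _ + X]big1 ?addr0 => [E|i _].
    rewrite -[RHS]E; by apply: eq_bigr => k _; rewrite Wl1.
  by rewrite Wl2 mulr0.
have al k : a (inl k) = 0.
  apply: (S1ind (fun k => a (inl k))) => -[j|]; first exact: left0.
  apply: (mulIf pull_h_neq0); rewrite mul0r mulr_suml.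
  rewrite (eq_bigr (fun k => - \sum_j a (inl k) * pull (S1 k (Some j)) * pull (germ_der j h))); last first.
    move=> l _; rewrite -mulrA -rmorphM /= -[S1 l None * h]opprK -mulNr -delta_h rmorphN mulrN.
    rewrite rmorph_sum mulr_sumr; congr (- _); apply: eq_bigr => j _.
    by rewrite rmorphM /= mulrA.
  by rewrite sumrN exchange_big big1 ?oppr0 // => j _ /=; rewrite -mulr_suml left0 mul0r.
have right0 l : a (inr None) * y l + \sum_k a (inr (Some k)) * pull (S2 k l) = 0.
  have := ax (rshift m l); rewrite big_sumType /= big1 ?add0r => [E|i _]; last by rewrite al mul0r.
  by rewrite -[RHS]E big_option Wr3; congr (_ + _); apply: eq_bigr => k _; rewrite Wr2.
have aE : a (inr None) = 0.
  apply: (mulIf form_neq0); rewrite mul0r.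
  transitivity (\sum_l (a (inr None) * y l + \sum_k a (inr (Some k)) * pull (S2 k l)) * pull (g l)); last first.
    by rewrite big1 // => l _; rewrite right0 mul0r.
  under [RHS]eq_bigr do rewrite mulrDl mulr_suml.
  rewrite big_split /= [X in _ + X]exchange_big /= [X in _ + X]big1 ?addr0.
    by rewrite mulr_sumr; apply: eq_bigr => l _; rewrite -mulrA (mulrC (y l)).
  move=> k _; rewrite (eq_bigr (fun l => a (inr (Some k)) * (pull (S2 k l) * pull (g l)))).
    by rewrite -mulr_sumr (S2syz k) mulr0.
  by move=> l _; rewrite mulrA.
case=> [k|[k|]]; [exact: al| |exact: aE].
apply: (S2ind (fun k => a (inr (Some k)))) => l.
by rewrite -[RHS](right0 l) aE mul0r add0r.
Qed.

End Basis.

Theorem free_divisor_form : free_divisor (ph * f).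
Proof.
split; [by rewrite mulf_neq0 ?pull_h_neq0 ?form_neq0|exact: product_squarefree|].
have [_ _ /(log_derivations_basis h0) H1] := hfree.
have [V VE] := gens_of_tjurina; have [U UE] := tjurina_of_gens.
have [K2 [S2 S2b]] := basis_change VE UE H1.
have [K1 [S1 S1b]] := H1.
have [c cE] := delta_gens S1b.
pose b (i : K1 + option K2) : P -> P^o := vec_der (lift_vec S1 S2 c i).
have evalsum (a : K1 + option K2 -> P) u : (\sum_i a i *: b i) u = \sum_i a i * b i u.
  by elim/big_rec2: _ => [|i x z _ <-].
apply: (@finite_free_submodule _ _ _ _ b).
- by move=> i; split; [exact: derivation_vec|exact: lift_log].
- move=> D [dD DF]; have [a aE] := lift_span S1b S2b cE dD DF.
  by exists a; apply/funext => u; rewrite evalsum; exact: aE.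
- move=> a a0; apply: (lift_independent S1b S2b (c := c)) => u.
  by rewrite -[LHS](evalsum a u) a0.
Qed.

End Lifting.

Lemma ideal_gen_eq (A : comNzRingType) (I J : finType) (g : I -> A) (g' : J -> A) :
  (forall i, ideal_gen g' (g i)) -> (forall j, ideal_gen g (g' j)) -> ideal_gen g = ideal_gen g'.
Proof.
have key (I1 I2 : finType) (g1 : I1 -> A) (g2 : I2 -> A) :
    (forall i, ideal_gen g2 (g1 i)) -> ideal_gen g1 `<=` ideal_gen g2.
  move=> /choice[c cE] _ [a ->]; exists (fun j => \sum_i a i * c i j).
  under [RHS]eq_bigr do rewrite mulr_suml; rewrite exchange_big /=; apply: eq_bigr => i _.
  by rewrite cE mulr_sumr; apply: eq_bigr => j _; rewrite mulrA.
by move=> H H'; apply/seteqP; split; exact: key.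
Qed.

Theorem corollary5p6 (R : realType) (m : nat) (h : germ R m)
    (hfree : free_divisor h) :
  (forall (n : nat) (g : 'I_n -> germ R m),
      ideal_gen g = tjurina_ideal h ->
      free_divisor (germ_pull n h *
        \sum_(i < n) germ_pull n (g i) * ycoord R m i)) /\
  free_divisor (germ_pull m.+1 h *
    (germ_pull m.+1 h * ycoord R m (ord_max : 'I_m.+1) +
     \sum_(i < m) germ_pull m.+1 (germ_der i h) *
       ycoord R m (widen_ord (leqnSn m) i))) /\
  (jacobian_ideal h h ->
   free_divisor (germ_pull m h *
     \sum_(i < m) germ_pull m (germ_der i h) * ycoord R m i)).
Proof.
have main n (g : 'I_n -> germ R m) : ideal_gen g = tjurina_ideal h ->
    free_divisor (germ_pull n h * \sum_(i < n) germ_pull n (g i) * ycoord R m i).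
  by move=> gI; exact: free_divisor_form hfree gI.
split; first exact: main; split => [|hJ].
  (* [unlift ord_max] is [None] at [ord_max], so [h] comes last *)
  pose g (l : 'I_m.+1) := tjurina_gen h (unlift ord_max l).
  have gmax : g ord_max = h by rewrite /g unlift_none.
  have gwiden i : g (widen_ord (leqnSn m) i) = germ_der i h.
    rewrite /g (_ : widen_ord _ i = lift ord_max i) ?liftK //.
    by apply/val_inj; rewrite /= /bump leqNgt ltn_ord.
  have := main m.+1 g; rewrite big_ord_recr /= gmax addrC.
  under eq_bigr do rewrite gwiden.
  apply; apply: ideal_gen_eq => [l|o]; first exact: (ideal_genM (tjurina_gen h)).
  case: o => [i|]; first by rewrite -gwiden; exact: ideal_genM.
  by rewrite -[X in ideal_gen _ X]gmax; exact: ideal_genM.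
apply: main; apply: ideal_gen_eq => [i|[i|//]]; first exact: (ideal_genM (tjurina_gen h) (Some i)).
exact: (ideal_genM (fun i => germ_der i h)).
Qed.
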